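(* For $n\ge 2$ and $c>0$, let \[ k_n := 2\cdot\left\lfloor \frac{n}{2^8\,(2+c)\,\ln(n)}\right\rfloor . \] Then, for any measure space $(D,\mathcal A,\mu)$ and any reproducing kernel Hilbert space $H$ of real- or complex-valued functions on $D$ that is embedded into $L_2(D,\mathcal A,\mu)$, we have \[ e(A_n,H)^2 \,\le\, \frac{4}{k_n}\sum_{j\ge k_n/2} a_j(H)^2 \] with probability at least $1-\frac{8}{n^c}$, where $A_n=A_{n,k_n}$ is the weighted least squares algorithm defined in the context, based on i.i.d. random points $x_1,\dots,x_n\in D$ with $\mu$-density $\varrho_{k_n}$.
   Context: Reproducing kernel Hilbert space: a Hilbert space $H$ of real- or complex-valued functions on a set $D$ such that for every $x\in D$ the point evaluation $f\mapsto f(x)$ is a continuous linear functional on $H$. Embedding: $H$ is embedded into $L_2=L_2(D,\mathcal A,\mu)$, the space of square-integrable functions with respect to the measure $\mu$. This means that $H$ consists of square-integrable functions such that two functions that are equal $\mu$-almost everywhere are also equal pointwise. Approximation numbers: \[ a_m=a_m(H):=\inf_{\substack{L_1,\dots,L_m\in H'\\ \varphi_1,\dots,\varphi_m\in L_2}}\ \sup_{f\in H:\ \|f\|_H\le 1}\Big\|f-\sum_{i=1}^m L_i(f)\,\varphi_i\Big\|_{L_2}, \] where $H'$ is the space of all bounded linear functionals on $H$ (for $m=0$ the sum is empty). Basis: let $\mathrm{id}\colon H\to L_2$ be the (injective) embedding and $W:=\mathrm{id}^*\mathrm{id}$, which is positive and compact. There is an orthogonal basis $\{b_k: k\in\mathbb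 N\}$, $\mathbb N=\{1,2,\dots\}$, of $H$ consisting of eigenfunctions of $W$; in this notation $H$ is taken to be infinite-dimensional, without loss of generality. The basis is also orthogonal in $L_2$. The eigenfunctions are normalized in $L_2$ and ordered so that $\|b_1\|_H\le\|b_2\|_H\le\cdots$, so that $a_k(H)=\|b_{k+1}\|_H^{-1}$. Density: for $k\in\mathbb N$, the function $\varrho_k\colon D\to\mathbb R$ is given by \[ \varrho_k(x):=\frac12\left(\frac1k\sum_{0\le j<k}|b_{j+1}(x)|^2+\frac{1}{\sum_{j\ge k}a_j^2}\sum_{j\ge k}a_j^2\,|b_{j+1}(x)|^2\right). \] Algorithm: for sampling nodes $x_1,\dots,x_n\in D$ and $V_k:=\mathrm{span}\{b_1,\dots,b_k\}$, define \[ A_{n,k}(f):=\underset{g\in V_k}{\mathrm{argmin}}\ \sum_{i=1}^n\frac{|g(x_i)-f(x_i)|^2}{\varrho_k(x_i)},\qquad f\in H. \] Worst-case error: $e(A_{n,k},H):=\sup_{f\in H:\ \|f\|_H\le 1}\|f-A_{n,k}(f)\|_{L_2}$. *)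

(* Defs.v *)
From HB Require Import structures.
From mathcomp Require Import all_boot all_order all_algebra.
From mathcomp Require Import sesquilinear.
From mathcomp.real_closed Require Import complex.
From mathcomp Require Import all_classical all_reals all_analysis.

Set Implicit Arguments.
Unset Strict Implicit.
Unset Printing Implicit Defensive.

Import Order.TTheory GRing.Theory Num.Theory.
Import numFieldNormedType.Exports.

Local Open Scope classical_set_scope.
Local Open Scope ring_scope.

(* The scalar field K is either R or R[i], so that real and complex Hilbert
   spaces are treated by one set of definitions. *)
Variant scalar_kind := RealScalars | ComplexScalars.

Section Scalars.
Variable R : realType.

Definition scalar_of (s : scalar_kind) : numFieldType :=
  match s with RealScalars => R | ComplexScalars => R[i] end.

Definition sRe (s : scalar_kind) : scalar_of s -> R :=
  match s with
  | RealScalars => fun x => x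
  | ComplexScalars => fun z => complex.Re z
  end.

Definition sIm (s : scalar_kind) : scalar_of s -> R :=
  match s with
  | RealScalars => fun=> 0
  | ComplexScalars => fun z => complex.Im z
  end.

(* a + i b; the imaginary part is dropped over the reals, where it is only ever
   applied with b = 0. *)
Definition sMk (s : scalar_kind) : R -> R -> scalar_of s :=
  match s with
  | RealScalars => fun a _ => a
  | ComplexScalars => fun a b => Complex a b
  end.

Definition sconj (s : scalar_kind) : scalar_of s -> scalar_of s :=
  match s with
  | RealScalars => fun x => x
  | ComplexScalars => fun z => conjc z
  end.

(* The norm `|z| of the library lives in K itself; sabs is the same number in
   R. *)
Definition sabs (s : scalar_kind) (z : scalar_of s) : R := sRe `|z|.

End Scalars.

Section L2.
Context (R : realType) (s : scalar_kind) (d : measure_display)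
  (D : measurableType d) (mu : {measure set D -> \bar R}).
Implicit Types f g : D -> scalar_of R s.

Definition L2norm f : \bar R := Lnorm mu 2%:E (fun x => (sabs (f x))%:E).

Definition in_L2 f : Prop :=
  [/\ measurable_fun setT (fun x => sRe (f x)),
      measurable_fun setT (fun x => sIm (f x)) & (L2norm f < +oo)%E].

Definition L2dot f g : scalar_of R s :=
  let h x := f x * sconj (g x) in
  sMk s (\int[mu]_x sRe (h x)) (\int[mu]_x sIm (h x)).

End L2.

(* The elements of the Hilbert space are identified with functions on D by the
   injective linear map rk_fun. *)
Record rkhs (R : realType) (s : scalar_kind) (D : Type) := RKHS {
  rk_space :> completeNormedModType (scalar_of R s);
  rk_dot : {dot rk_space for @sconj R s};
  rk_norm : forall f : rk_space, `|f| ^+ 2 = rk_dot f f;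
  rk_fun : {linear rk_space -> (D -> (scalar_of R s)^o)};
  rk_inj : injective rk_fun;
  rk_eval_continuous : forall x : D,
    continuous (fun f : rk_space => rk_fun f x : (scalar_of R s)^o)
}.

Definition first_span (R : realType) (s : scalar_kind) (D : Type)
    (H : rkhs R s D) (b : nat -> H) (k : nat) : set H :=
  [set g | exists c : 'I_k -> scalar_of R s, g = \sum_(i < k) c i *: b i].

Section Approximation.
Context (R : realType) (s : scalar_kind) (d : measure_display)
  (D : measurableType d) (mu : {measure set D -> \bar R}) (H : rkhs R s D).

Definition embedded_in_L2 : Prop :=
  (forall f : H, in_L2 mu (rk_fun H f)) /\
  (forall f g : H, {ae mu, forall x, rk_fun H f x = rk_fun H g x} ->
     forall x, rk_fun H f x = rk_fun H g x).

Definition approx_number (m : nat) : \bar R :=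
  ereal_inf [set e | exists (L : 'I_m -> {linear H -> (scalar_of R s)^o})
                            (phi : 'I_m -> D -> scalar_of R s),
    [/\ forall i, continuous (L i),
        forall i, in_L2 mu (phi i) &
        e = ereal_sup
          [set L2norm mu (fun x => rk_fun H f x - \sum_(i < m) L i f * phi i x)
             | f in [set f : H | `|f| <= 1]]]].

(* idstar is the Hilbert space adjoint of the embedding id : H -> L2. *)
Definition embedding_adjoint (idstar : (D -> scalar_of R s) -> H) : Prop :=
  forall (phi : D -> scalar_of R s) (g : H), in_L2 mu phi ->
    rk_dot H (idstar phi) g = L2dot mu phi (rk_fun H g).

(* b is indexed from 0: b j stands for the usual b_{j+1}. *)
Record eigenbasis (W : H -> H) (b : nat -> H) : Prop := Eigenbasis {
  eb_orthogonal : forall i j, i != j -> rk_dot H (b i) (b j) = 0;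
  eb_total : closure (\bigcup_k first_span b k) = setT;
  eb_eigen : forall k, exists lambda : scalar_of R s, W (b k) = lambda *: b k;
  eb_normalized : forall k, L2norm mu (rk_fun H (b k)) = 1%E;
  eb_ordered : forall i j, (i <= j)%N -> `|b i| <= `|b j|
}.

(* The bracket is computed in \bar R, where 0^-1 = +oo and +oo^-1 = 0; it is
   finite when 0 < k and the squared approximation numbers are summable. *)
Definition rho (b : nat -> H) (k : nat) (x : D) : R :=
  fine ((2^-1)%:E *
    (k%:R%:E^-1 * (\sum_(0 <= j < k) (sabs (rk_fun H (b j) x) ^+ 2))%:E
     + (\sum_(k <= j <oo) approx_number j ^+ 2)^-1
       * \sum_(k <= j <oo)
           approx_number j ^+ 2 * (sabs (rk_fun H (b j) x) ^+ 2)%:E))%E.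

(* Division by zero is harmless: for 0 < k and summable squared approximation
   numbers, rho b k x = 0 forces every function of H to vanish at x. *)
Definition lsq_residual (b : nat -> H) (k n : nat) (x : 'I_n -> D) (f g : H) : R
  := \sum_(i < n)
       sabs (rk_fun H g (x i) - rk_fun H f (x i)) ^+ 2 / rho b k (x i).

(* A x f is a minimizer over the span of b 0, ..., b k.-1; ties between several
   minimizers are broken by A in an arbitrary way. *)
Definition least_squares (b : nat -> H) (k n : nat)
    (A : ('I_n -> D) -> H -> H) : Prop :=
  forall (x : 'I_n -> D) (f : H),
    first_span b k (A x f) /\
    (forall g, first_span b k g ->
       lsq_residual b k x f (A x f) <= lsq_residual b k x f g).

Definition worst_case_error (A : H -> H) : \bar R :=
  ereal_sup [set L2norm mu (fun x => rk_fun H f x - rk_fun H (A f) x)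
               | f in [set f : H | `|f| <= 1]].

End Approximation.

Section Sampling.
Context (R : realType) (d d' : measure_display) (D : measurableType d)
  (Omega : measurableType d') (P : probability Omega R).

Definition mutually_independent (n : nat) (X : 'I_n -> {RV P >-> D}) : Prop :=
  forall (J : {set 'I_n}) (B : 'I_n -> set D), (forall i, measurable (B i)) ->
    P (\bigcap_(i in [set i | i \in J]) (X i @^-1` B i)) =
    (\prod_(i in J) P (X i @^-1` B i))%E.

Definition has_density (mu : {measure set D -> \bar R}) (X : {RV P >-> D})
    (f : D -> R) : Prop :=
  forall B : set D, measurable B ->
    distribution P X B = (\int[mu]_(x in B) (f x)%:E)%E.

End Sampling.

Definition k_of (R : realType) (n : nat) (c : R) : nat :=
  (2 * Num.truncn (n%:R / (2 ^+ 8 * (2 + c) * ln n%:R) : R))%N.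

(* Main.v *)
(* The nodes enter only through two Gram blocks of the vector
   z(x) = (b_j(x))_(j < k), (a_j b_j(x) / gamma)_(j >= k), where
   gamma^2 = a_k^2 + (1/k) sum_(j >= k) a_j^2; the density gives
   |z(x)|^2 <= 2 k rho(x).  The deviation S of sum_i z z^*(x_i) / rho(x_i) from
   its mean is controlled by the moments E tr S^(2m): exchanging one node x_i
   with an independent copy symmetrises E tr (S S^(2m-1)), and an inequality for
   tr (A - B)(A^p - B^p) turns this into a recursion between consecutive even
   moments.  Markov's inequality with 2m of order log n bounds the norm of S by
   n/2 outside an event of probability 8/n^c.  On the complement the first Gram
   block is at least n/2 and the cross block at most (n/2) gamma, so that the
   squared error is at most a_k^2 + gamma^2, which averaging the decreasing a_j
   over k/2 <= j < k bounds by (4/k) sum_(j >= k/2) a_j^2.  All of this is done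
   for the finitely many coordinates j < N, with bounds independent of N. *)

Require Import Defs.
From HB Require Import structures.
From mathcomp Require Import all_boot all_order all_algebra.
From mathcomp Require Import all_classical all_reals all_analysis.
From mathcomp Require Import perm measurable_realfun.
From mathcomp Require Import ring lra zify.

Set Implicit Arguments.
Unset Strict Implicit.
Unset Printing Implicit Defensive.

Import Order.TTheory GRing.Theory Num.Theory.
Import numFieldNormedType.Exports.

Local Open Scope classical_set_scope.
Local Open Scope ring_scope.

(** * Trace inequalities for symmetric matrices *)

(** Only polynomial functions of the deviation are averaged, so independence of events, extended to
    products of bounded functions, is all that the exchange argument takes from probability.
    Matrices are never diagonalised: powers are compared through Frobenius products and
    Cauchy-Schwarz. Constants: each summand is at most [r = 2k] times a projection, and with
    [l = (2 + c) ln n] the factor [2^8] in [k_n] means [128 k l <= n], hence [32 (2m+1) r <= n]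
    whenever [m + 1 <= l]. Under that condition consecutive even moments grow at most by
    [(9/124) n^2]. Measured against [(n/2)^2] the ratio is [9/31 < 1/e], so about [l] steps gain
    [n^(2+c)], and the extra [n^2] absorbs the trace of the mean. The bound at each truncation [N]
    holds outside an event that depends on [N], and infinitely many such events cannot be summed.
    The final event therefore asks only that good [N] be unbounded. This suffices, since every
    estimate is first proved for a finite combination, which needs one good [N] beyond its length,
    and then extended by density. *)

Lemma exprD1_sub_sum (R : pzRingType) (x y : R) m :
  x ^+ m.+1 - y ^+ m.+1 = \sum_(q < m.+1) x ^+ q * (x - y) * y ^+ (m - q).
Proof.
elim: m => [|m IH]; first by rewrite big_ord1 !expr0 !expr1 mul1r mulr1.
rewrite big_ord_recl /= expr0 mul1r subn0.
transitivity ((x - y) * y ^+ m.+1 + x * (x ^+ m.+1 - y ^+ m.+1)).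
  by rewrite mulrBl mulrBr -!exprS [RHS]addrC subrKA.
congr (_ + _); rewrite IH mulr_sumr; apply: eq_bigr => q _.
by rewrite !mulrA -exprS.
Qed.

Lemma midpoint_convex_sum (R : realFieldType) (T : nat -> R) m :
  (forall a, (a < m)%N -> 2 * T a.*2.+1 <= T a.*2 + T a.*2.+2) ->
  (forall a, (a.+1 < m)%N -> 2 * T a.*2.+2 <= T a.*2 + T a.+2.*2) ->
  2 * \sum_(q < m.*2.+1) T q <= m.*2.+1%:R * (T 0%N + T m.*2).
Proof.
move=> odd_mid even_mid.
(* Convexity of the even subsequence: [T a.*2] lies below the chord from index 0 to index
   [a.+1.*2]. *)
have slope a : (a < m)%N -> a.+1%:R * T a.*2 <= T 0%N + a%:R * T a.+1.*2.
  elim: a => [|a IH] am; first by rewrite mul1r mul0r addr0.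
  have := IH (ltnW am); have := even_mid _ am.
  rewrite !doubleS -!natr1; have : 0 <= a%:R :> R by [].
  move: (a%:R) (T _) (T _) (T _) (T _) => r t0 t1 t2 t3; nra.
elim: m odd_mid even_mid slope => [|m IH] odd_mid even_mid slope.
  by rewrite big_ord1 mul1r; lra.
rewrite doubleS !big_ord_recr /= -/(\sum_(q < m.*2.+1) T q).
have {}IH : 2 * \sum_(q < m.*2.+1) T q <= m.*2.+1%:R * (T 0%N + T m.*2).
  apply: IH => a am; [exact/odd_mid/ltnW|exact/even_mid/ltnW|exact/slope/ltnW].
move: IH (odd_mid _ (ltnSn m)) (slope _ (ltnSn m)); rewrite big_ord_recr /=.
rewrite !doubleS -addnn -!natr1 natrD; move: (m%:R) (\sum_(_ < _) _).
move: (T 0%N) (T (m + m)%N) (T (m + m).+1) (T (m + m).+2) => t0 t1 t2 t3 r S; lra.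
Qed.

Section TraceInequalities.
Context (R : realFieldType) (N : nat).
Implicit Types (A B H X Y E U V : 'M[R]_N) (u v : 'cV[R]_N).

Definition dotv u v : R := (u^T *m v) 0 0.

Lemma dotvE u v : dotv u v = \sum_i u i 0 * v i 0.
Proof. by rewrite /dotv mxE; apply: eq_bigr => i _; rewrite mxE. Qed.

Lemma dotvC u v : dotv u v = dotv v u.
Proof. by rewrite !dotvE; apply: eq_bigr => i _; rewrite mulrC. Qed.

Lemma dotv_ge0 u : 0 <= dotv u u.
Proof. by rewrite dotvE sumr_ge0 // => i _; rewrite -expr2 sqr_ge0. Qed.

Lemma dotv_eq0 u : dotv u u = 0 -> u = 0.
Proof.
rewrite dotvE => /eqP; rewrite psumr_eq0; last by move=> i _; rewrite -expr2 sqr_ge0.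
move=> /allP u0; apply/colP => i; have := u0 i; rewrite mem_index_enum mxE => /(_ isT).
by rewrite -expr2 sqrf_eq0 => /eqP.
Qed.

Lemma dotvDl u1 u2 v : dotv (u1 + u2) v = dotv u1 v + dotv u2 v.
Proof. by rewrite /dotv linearD mulmxDl mxE. Qed.

Lemma dotvZl a u v : dotv (a *: u) v = a * dotv u v.
Proof. by rewrite /dotv linearZ /= -scalemxAl mxE. Qed.

Lemma dotvDr u v1 v2 : dotv u (v1 + v2) = dotv u v1 + dotv u v2.
Proof. by rewrite /dotv mulmxDr mxE. Qed.

Lemma dotvZr a u v : dotv u (a *: v) = a * dotv u v.
Proof. by rewrite /dotv -scalemxAr mxE. Qed.

Lemma dotv_mulmx A u v : dotv u (A *m v) = dotv (A^T *m u) v.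
Proof. by rewrite /dotv trmx_mul trmxK mulmxA. Qed.

Lemma dotv_CS u v : dotv u v ^+ 2 <= dotv u u * dotv v v.
Proof.
have [v0|v0] := eqVneq (dotv v v) 0.
  by rewrite (dotv_eq0 v0) -(scale0r (0 : 'cV_N)) !dotvZr !mul0r expr0n !mulr0.
have vgt0 : 0 < dotv v v by rewrite lt_def v0 dotv_ge0.
have := dotv_ge0 (dotv v v *: u + (- dotv u v) *: v).
rewrite !(dotvDl, dotvDr, dotvZl, dotvZr) (dotvC v u).
move: (dotv u u) (dotv u v) (dotv v v) vgt0 => a b c c0 H.
suff : 0 <= c * (a * c - b ^+ 2) by rewrite pmulr_rge0 // subr_ge0.
by apply: le_trans H _; rewrite le_eqVlt; apply/orP; left; apply/eqP; ring.
Qed.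

Lemma trmxX A m : (A ^+ m)^T = A^T ^+ m.
Proof.
elim: m => [|m IH]; first by rewrite !expr0 trmx1.
by rewrite exprS exprSr -IH; exact: trmx_mul.
Qed.

Lemma mxtrace_trmul U V : \tr (U^T *m V) = \sum_j dotv (col j U) (col j V).
Proof.
rewrite /mxtrace; apply: eq_bigr => j _; rewrite mxE dotvE.
by apply: eq_bigr => i _; rewrite !mxE.
Qed.

Lemma mxtrace_trmul_ge0 U : 0 <= \tr (U^T *m U).
Proof. by rewrite mxtrace_trmul sumr_ge0 // => j _; exact: dotv_ge0. Qed.

Lemma mxtrace_AMGM U V : 2 * \tr (U^T *m V) <= \tr (U^T *m U) + \tr (V^T *m V).
Proof.
have := mxtrace_trmul_ge0 (U - V).
rewrite [(U - V)^T]linearB /= mulmxBl !mulmxBr !linearB /=.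
have -> : \tr (V^T *m U) = \tr (U^T *m V) by rewrite -mxtrace_tr trmx_mul trmxK.
lra.
Qed.

(** The Frobenius norm dominates the operator norm, by Cauchy-Schwarz in each row of [U]. *)
Lemma dotv_mul_trace U v : dotv (U *m v) (U *m v) <= \tr (U^T *m U) * dotv v v.
Proof.
have -> : \tr (U^T *m U) = \sum_i dotv (row i U)^T (row i U)^T.
  rewrite mxtrace_mulC /mxtrace; apply: eq_bigr => i _; rewrite mxE dotvE.
  by apply: eq_bigr => j _; rewrite !mxE.
rewrite dotvE mulr_suml; apply: ler_sum => i _; rewrite -expr2.
have -> : (U *m v) i 0 = dotv (row i U)^T v.
  by rewrite mxE dotvE; apply: eq_bigr => j _; rewrite !mxE.
exact: dotv_CS.
Qed.

Definition psd X := X^T = X /\ forall u, 0 <= dotv u (X *m u).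

Lemma psd_trace_ge0 X U : psd X -> 0 <= \tr (U^T *m (X *m U)).
Proof.
move=> [_ X0]; rewrite mxtrace_trmul sumr_ge0 // => j _.
by rewrite (_ : col j (X *m U) = X *m col j U) ?X0 // !colE mulmxA.
Qed.

Lemma psd_trace_even X A m : A^T = A -> psd X -> 0 <= \tr (X *m A ^+ m.*2).
Proof.
move=> sA X0; rewrite -addnn exprD -[A ^+ m * _]/(A ^+ m *m _) mulmxA mxtrace_mulC.
by have := psd_trace_ge0 (A ^+ m) X0; rewrite trmxX sA.
Qed.

Lemma psd_trace_le X Y A m : A^T = A -> psd (Y - X) ->
  \tr (X *m A ^+ m.*2) <= \tr (Y *m A ^+ m.*2).
Proof.
by move=> sA YX; rewrite -subr_ge0 -linearB -mulmxBl; exact: psd_trace_even.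
Qed.

Lemma psdD X Y : psd X -> psd Y -> psd (X + Y).
Proof.
move=> [sX X0] [sY Y0]; split=> [|u]; first by rewrite linearD /= sX sY.
by rewrite mulmxDl dotvDr addr_ge0.
Qed.

Lemma psdZ a X : 0 <= a -> psd X -> psd (a *: X).
Proof.
move=> a0 [sX X0]; split=> [|u]; first by rewrite linearZ /= sX.
by rewrite -scalemxAl dotvZr mulr_ge0.
Qed.

Lemma psd_sqr X : X^T = X -> psd (X *m X).
Proof.
move=> sX; split=> [|u]; first by rewrite trmx_mul sX.
by rewrite -mulmxA dotv_mulmx sX dotv_ge0.
Qed.

(** By the identity [(X - Y)^2 + (X + Y)^2 = 2 X^2 + 2 Y^2], multiples of projections satisfy
    [(X - Y)^2 <= 2 r (X + Y)] in the semidefinite order. The even power of [A] is a square, so the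
    trace against it preserves that order. *)
Lemma trace_sub_sqr_even X Y A (r1 r2 r : R) m : A^T = A -> psd X -> psd Y ->
  X *m X = r1 *: X -> Y *m Y = r2 *: Y -> r1 <= r -> r2 <= r ->
  \tr ((X - Y) *m (X - Y) *m A ^+ m.*2) <= 2 * r * \tr ((X + Y) *m A ^+ m.*2).
Proof.
move=> sA X0 Y0 XX YY r1r r2r.
have [sX sY] := (proj1 X0, proj1 Y0).
rewrite -[2 * r * _]/((2 * r) *: (_ : R^o)) -linearZ /= scalemxAl.
apply: psd_trace_le => //.
have -> : (2 * r) *: (X + Y) - (X - Y) *m (X - Y)
    = (X + Y) *m (X + Y) + ((2 * (r - r1)) *: X + (2 * (r - r2)) *: Y).
  rewrite !mulmxDl !mulmxDr !mulmxN !mulNmx XX YY.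
  by apply/matrixP => i j; rewrite !mxE; ring.
apply: psdD; first by apply: psd_sqr; rewrite linearD /= sX sY.
by apply: psdD; apply: psdZ => //; rewrite mulr_ge0 // subr_ge0.
Qed.

(* With [U_a = A^a H B^(m-a)], the number [T_(a+a') = tr (H A^(a+a') H
   B^(2m-a-a'))] is the Frobenius product of [U_a] and [U_a'], which makes [T]
   midpoint convex. *)
Lemma trace_power_diff A B m : A^T = A -> B^T = B ->
  2 * \tr ((A - B) *m (A ^+ m.*2.+1 - B ^+ m.*2.+1)) <=
  m.*2.+1%:R * \tr ((A - B) *m (A - B) *m (A ^+ m.*2 + B ^+ m.*2)).
Proof.
move=> sA sB; set H := A - B.
have sH : H^T = H by rewrite linearB /= sA sB.
pose T q := \tr (H *m A ^+ q *m H *m B ^+ (m.*2 - q)).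
pose U a := A ^+ a *m H *m B ^+ (m - a).
have UE a a' : (a <= m)%N -> (a' <= m)%N -> \tr ((U a)^T *m U a') = T (a + a')%N.
  move=> am am'; rewrite /U /T !trmx_mul !trmxX sA sB sH.
  rewrite !mulmxA mxtrace_mulC !mulmxA.
  have -> : (m.*2 - (a + a') = (m - a') + (m - a))%N by lia.
  rewrite exprD mxtrace_mulC exprD -![_ * _]/(_ *m _) !mulmxA.
  transitivity (\tr ((H *m B ^+ (m - a') *m B ^+ (m - a)) *m
                     (H *m A ^+ a *m A ^+ a'))); first by rewrite !mulmxA.
  by rewrite mxtrace_mulC !mulmxA.
have mid a a' : (a <= m)%N -> (a' <= m)%N -> 2 * T (a + a')%N <= T a.*2 + T a'.*2.
  by move=> am am'; rewrite -!UE // -!addnn -!UE //; exact: mxtrace_AMGM.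
have -> : \tr (H *m (A ^+ m.*2.+1 - B ^+ m.*2.+1)) = \sum_(q < m.*2.+1) T q.
  rewrite exprD1_sub_sum mulmx_sumr raddf_sum; apply: eq_bigr => q _.
  by rewrite /T -![_ * _]/(_ *m _) !mulmxA.
have -> : \tr (H *m H *m (A ^+ m.*2 + B ^+ m.*2)) = T 0%N + T m.*2.
  rewrite /T subnn subn0 !expr0 -![1]/(1%:M) !mulmx1 mulmxDr linearD /= addrC.
  by congr (_ + _); rewrite [RHS]mxtrace_mulC mulmxA.
apply: midpoint_convex_sum => a am.
  by have := mid a a.+1 (ltnW am) am; rewrite addnS addnn doubleS.
by have := mid a a.+2 ltac:(lia) am; rewrite !addnS addnn !doubleS.
Qed.

(** The arithmetic-geometric inequality for the Frobenius product of [A ^+ m.+1] and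
    [(t / 2) *: A ^+ m]. The free [t] decides how much of an odd moment is charged to the next even
    one. *)
Lemma trace_odd_power_le A m (t : R) : A^T = A -> 0 < t ->
  \tr (A ^+ m.*2.+1) <= t^-1 * \tr (A ^+ m.+1.*2) + t / 4 * \tr (A ^+ m.*2).
Proof.
move=> sA t0.
have trE p q : \tr ((A ^+ p)^T *m A ^+ q) = \tr (A ^+ (p + q)).
  by rewrite trmxX sA exprD.
have := mxtrace_AMGM (A ^+ m.+1) ((t / 2) *: A ^+ m).
rewrite [(_ *: _)^T]linearZ /= -!scalemxAl -!scalemxAr !mxtraceZ !trE.
rewrite addSn !addnn => H.
rewrite -(ler_pM2l t0) mulrDr mulrA mulfV ?gt_eqF // mul1r.
by apply: le_trans (le_trans _ H) _; rewrite le_eqVlt; apply/orP; left; apply/eqP; field.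
Qed.

(** For [h p], the squared norm of [A ^+ p *m v], symmetry and Cauchy-Schwarz give
    [h p.+1 ^+ 2 <= h p * h p.+2]. Ratios of consecutive terms thus increase, and each is at least
    the first. This stands in for the spectral theorem. *)
Lemma dotv_pow_le A v m : A^T = A ->
  dotv (A *m v) (A *m v) ^+ m.+1 <=
  dotv v v ^+ m * dotv (A ^+ m.+1 *m v) (A ^+ m.+1 *m v).
Proof.
move=> sA; pose h m := dotv (A ^+ m *m v) (A ^+ m *m v).
have h0 p : 0 <= h p by exact: dotv_ge0.
have hS p : h p.+1 ^+ 2 <= h p * h p.+2.
  have -> : h p.+1 = dotv (A ^+ p *m v) (A ^+ p.+2 *m v).
    rewrite /h !exprS -![_ * _]/(_ *m _) -!mulmxA [RHS]dotv_mulmx sA.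
    by [].
  exact: dotv_CS.
have key p : h 1%N * h p <= h 0%N * h p.+1.
  elim: p => [|p IH]; first by rewrite mulrC.
  have [hp0|hp0] := eqVneq (h p) 0.
    have /eqP -> : h p.+1 == 0.
      by rewrite -sqrf_eq0 eq_le sqr_ge0 andbT (le_trans (hS p)) // hp0 mul0r.
    by rewrite mulr0 mulr_ge0.
  have hgt : 0 < h p by rewrite lt_def hp0 h0.
  rewrite -(ler_pM2l hgt) [leRHS]mulrCA; apply: le_trans (ler_wpM2l (h0 0%N) (hS p)).
  by rewrite mulrA [h p * _]mulrC expr2 mulrA ler_wpM2r.
have -> : dotv v v = h 0%N by rewrite /h expr0 -[1]/(1%:M) mul1mx.
have -> : dotv (A *m v) (A *m v) = h 1%N by rewrite /h expr1.
rewrite -/(h m.+1); elim: m => [|m IH]; first by rewrite expr1 mul1r.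
rewrite exprS; apply: le_trans (ler_wpM2l (h0 1%N) IH) _.
by rewrite mulrCA [h 0%N ^+ m.+1]exprSr -mulrA ler_wpM2l ?exprn_ge0.
Qed.

(** The operator norm is at most the Schatten norm of order [p.+1.*2], stated as a bound on the
    bilinear form because the Gram blocks are read off by choosing [u] and [v]. *)
Lemma trace_power_form_le A (t : R) p u v : A^T = A -> 0 <= t ->
  \tr (A ^+ p.+1.*2) <= t ^+ p.+1.*2 ->
  dotv u (A *m v) ^+ 2 <= t ^+ 2 * (dotv u u * dotv v v).
Proof.
move=> sA t0 trt; apply: le_trans (dotv_CS _ _) _.
rewrite mulrCA ler_wpM2l ?dotv_ge0 //.
rewrite -(@ler_pXn2r _ p.+1) // ?nnegrE ?mulr_ge0 ?sqr_ge0 ?dotv_ge0 //.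
apply: le_trans (dotv_pow_le _ _ sA) _.
rewrite exprMn -exprM mul2n [dotv v v ^+ p.+1]exprSr [leRHS]mulrCA.
rewrite ler_wpM2l ?exprn_ge0 ?dotv_ge0 //.
apply: le_trans (dotv_mul_trace _ _) _.
by rewrite ler_wpM2r ?dotv_ge0 // trmxX sA -[_ *m _]/(_ * _) -exprD addnn.
Qed.

End TraceInequalities.

Lemma dotv_col_mx (R : realFieldType) m n (a c : 'cV[R]_m) (b e : 'cV[R]_n) :
  dotv (col_mx a b) (col_mx c e) = dotv a c + dotv b e.
Proof.
rewrite !dotvE big_split_ord; congr (_ + _); apply: eq_bigr => i _.
  by rewrite !col_mxEu.
by rewrite !col_mxEd.
Qed.

Section TwoRankOnes.
Context (R : realFieldType) (N : nat) (r : R) (u v : 'cV[R]_N).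

Definition rank2_mx : 'M[R]_N := r *: (u *m u^T + v *m v^T).

Lemma rank2_mxE i j : rank2_mx i j = r * (u i 0 * u j 0 + v i 0 * v j 0).
Proof. by rewrite !mxE !big_ord1 !mxE. Qed.

Lemma rank2_mx_mul w : rank2_mx *m w = r *: (dotv u w *: u + dotv v w *: v).
Proof.
rewrite -scalemxAl mulmxDl -!mulmxA; congr (_ *: (_ + _)); apply/colP => i;
  by rewrite !mxE big_ord1 mulrC.
Qed.

Lemma rank2_mx_form w w' : dotv w (rank2_mx *m w') =
  r * (dotv w u * dotv w' u + dotv w v * dotv w' v).
Proof. by rewrite rank2_mx_mul !(dotvZr, dotvDr) !(dotvC _ w') [_ * dotv w u]mulrC [_ * dotv w v]mulrC. Qed.

Lemma rank2_mx_psd : 0 <= r -> psd rank2_mx.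
Proof.
move=> r0; split=> [|w].
  by apply/matrixP => i j; rewrite mxE !rank2_mxE [u j 0 * _]mulrC [v j 0 * _]mulrC.
by rewrite rank2_mx_form mulr_ge0 // addr_ge0 // -expr2 sqr_ge0.
Qed.

(** Orthogonal vectors of equal squared norm [t] make [u u^T + v v^T] equal to [t] times a
    projection. *)
Lemma rank2_mx_sqr t : dotv u v = 0 -> dotv u u = t -> dotv v v = t ->
  rank2_mx *m rank2_mx = (r * t) *: rank2_mx.
Proof.
move=> uv uu vv; rewrite {1 2}/rank2_mx -scalemxAl -scalemxAr scalerA.
have mulE (a b c : 'cV[R]_N) : a *m b^T *m (b *m c^T) = dotv b b *: (a *m c^T).
  rewrite mulmxA -[a *m b^T *m b]mulmxA scalemxAl; congr (_ *m _).
  by apply/colP => i; rewrite !mxE big_ord1 mulrC.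
have mul0 (a b c e : 'cV[R]_N) : dotv b c = 0 -> a *m b^T *m (c *m e^T) = 0.
  move=> bc; rewrite mulmxA -[a *m b^T *m c]mulmxA (_ : b^T *m c = 0) ?mulmx0 ?mul0mx //.
  by apply/matrixP => i j; rewrite !ord1 -[LHS]/(dotv b c) bc mxE.
rewrite mulmxDl !mulmxDr !mulE (mul0 u u v v) // (mul0 v v u u); last by rewrite dotvC.
by rewrite uu vv addr0 add0r /rank2_mx -scalerDr !scalerA; congr (_ *: _); ring.
Qed.
End TwoRankOnes.

(** * Integrals of bounded functions of independent variables *)

Section Weight.
Context d d' (T : measurableType d) (T' : measurableType d') (R : realType).
Variables (m : {measure set T -> \bar R}) (m' : {measure set T' -> \bar R}).
Variables (phi : T -> T') (g : T -> R).
Hypotheses (mphi : measurable_fun setT phi) (mg : measurable_fun setT g)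
  (g0 : forall x, 0 <= g x)
  (m'E : forall B, measurable B -> m' B = (\int[m]_(x in phi @^-1` B) (g x)%:E)%E).
Local Open Scope ereal_scope.
Import HBNNSimple.

Let weight_indic B (r : R) : measurable B -> (0 <= r)%R ->
  \int[m']_y (r * \1_B y)%:E = \int[m]_x ((r * \1_B (phi x))%:E * (g x)%:E).
Proof.
move=> mB r0.
under [LHS]eq_integral do rewrite EFinM.
rewrite ge0_integralZl_EFin//; last first.
  exact/measurable_EFinP/measurable_indic.
have mpB : measurable (phi @^-1` B) by rewrite -[_ @^-1` _]setTI; exact: mphi.
under [RHS]eq_integral do rewrite EFinM -muleA.
rewrite ge0_integralZl_EFin//; last 2 first.
- by move=> x _; rewrite -EFinM lee_fin mulr_ge0.
- apply: emeasurable_funM; last exact/measurable_EFinP.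
  apply/measurable_EFinP; rewrite (_ : (fun x => _) = \1_(phi @^-1` B) :> (T -> R)).
    exact/measurable_indic.
  by apply/funext => x; rewrite !indicE /=; congr (_%:R); congr nat_of_bool; apply/idP/idP => /set_mem ?; apply/mem_set.
congr (_ * _); rewrite integral_indic// setIT m'E// integral_mkcond.
apply: eq_integral => x _; rewrite patchE indicE.
rewrite (_ : (phi x \in B) = (x \in phi @^-1` B)).
  by case: ifPn => _; rewrite ?mul1e ?mul0e.
by apply/idP/idP => /set_mem ?; apply/mem_set.
Qed.

(** Change of variables when [m'] is the image under [phi] of the measure with density [g], by
    simple functions and monotone convergence. It serves with [phi] a node and [g] the product of
    the other factors, and later with [phi] the identity and [g] the sampling density. *)
Lemma ge0_integral_weight (h : T' -> \bar R) :
  measurable_fun setT h -> (forall y, 0 <= h y) ->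
  \int[m']_y h y = \int[m]_x (h (phi x) * (g x)%:E).
Proof.
move=> mh h0; pose s := nnsfun_approx measurableT mh.
have cvgs y : EFin \o s ^~ y @ \oo --> h y by exact: cvg_nnsfun_approx.
have ms n : measurable_fun setT (EFin \o s n).
  exact/measurable_EFinP.
have mono y : {homo s ^~ y : a b / (a <= b)%N >-> (a <= b)%R}.
  by move=> a b ab; exact/lefP/nd_nnsfun_approx.
have -> : \int[m']_y h y = lim (\int[m']_y (s n y)%:E @[n --> \oo]).
  under eq_integral => y _ do rewrite -(cvg_lim _ (cvgs y))//.
  apply: monotone_convergence => //.
  - by move=> n y _; rewrite lee_fin.
  - by move=> y _ a b ab; rewrite lee_fin mono.
have -> : \int[m]_x (h (phi x) * (g x)%:E) =
    lim (\int[m]_x ((s n (phi x))%:E * (g x)%:E) @[n --> \oo]).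
  have cvgg x : (s n (phi x))%:E * (g x)%:E @[n --> \oo] --> h (phi x) * (g x)%:E.
    by apply: cvgeZr => //; exact: cvgs.
  under eq_integral => x _ do rewrite -(cvg_lim _ (cvgg x))//.
  apply: monotone_convergence => //.
  - move=> n; apply: emeasurable_funM; last exact/measurable_EFinP.
    exact: measurableT_comp (ms n) mphi.
  - by move=> n x _; rewrite mule_ge0 ?lee_fin.
  - by move=> x _ a b ab; rewrite lee_wpmul2r ?lee_fin ?mono.
suff sE n : \int[m']_y (s n y)%:E = \int[m]_x ((s n (phi x))%:E * (g x)%:E).
  by under eq_fun do rewrite sE.
transitivity (\int[m']_y (\sum_(r \in range (s n)) (r * \1_(s n @^-1` [set r]) y)%:E)).
  by apply: eq_integral => y _; rewrite fimfunE -fsumEFin.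
rewrite ge0_integral_fsum//; last 2 first.
- by move=> r; apply/measurable_EFinP; exact: measurable_funM.
- by move=> r y _; exact: nnfun_muleindic_ge0.
transitivity (\int[m]_x (\sum_(r \in range (s n))
    ((r * \1_(s n @^-1` [set r]) (phi x))%:E * (g x)%:E))); last first.
  apply: eq_integral => x _; rewrite -ge0_mule_fsuml; last first.
    by move=> r; exact: nnfun_muleindic_ge0.
  by rewrite fsumEFin// -fimfunE.
rewrite ge0_integral_fsum//; last 2 first.
- move=> r; apply: emeasurable_funM; last exact/measurable_EFinP.
  apply/measurable_EFinP.
  apply: (@measurableT_comp _ _ _ _ _ _ (fun y => r * \1_(s n @^-1` [set r]) y)%R _ phi) => //.
  exact: measurable_funM.
- by move=> r x _; rewrite mule_ge0 ?lee_fin ?nnfun_muleindic_ge0 //; exact: nnfun_muleindic_ge0.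
apply: eq_fsbigr => r /set_mem[y _ <-]; exact: weight_indic.
Qed.
Lemma Rintegral_weight (f : T' -> R) : measurable_fun setT f ->
  (\int[m']_y f y = \int[m]_x (f (phi x) * g x))%R.
Proof.
move=> mf; rewrite /Rintegral integralE [in RHS]integralE.
have mEf : measurable_fun setT (EFin \o f) by exact/measurable_EFinP.
rewrite !ge0_integral_weight //; last 2 first.
- exact: measurable_funeneg.
- exact: measurable_funepos.
congr fine; congr (_ - _); apply: eq_integral => x _.
  by rewrite !funeposE /= -EFin_max -[X in maxe _ X]/(0%R%:E) -!EFin_max -EFinM maxr_pMl // mul0r.
by rewrite !funenegE /= -[X in maxe _ X]/(0%R%:E) -!EFin_max -EFinM maxr_pMl // mul0r mulNr.
Qed.
End Weight.

(** * Bounded measurable functions under a probability measure *)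

Section BoundedMeasurable.
Context d (D : measurableType d) (R : realType).
Implicit Types f g : D -> R.

(** The class is closed under sums and products and is integrable for every probability, so moments
    raise no integrability question. *)
Definition bmf f := measurable_fun setT f /\ exists M : R, forall x, `|f x| <= M.

Lemma bmf_cst r : bmf (fun=> r).
Proof. by split=> //; exists `|r|. Qed.

Lemma bmfD f g : bmf f -> bmf g -> bmf (fun x => f x + g x).
Proof.
move=> [mf [M fM]] [mg [M' gM]]; split; first exact: measurable_funD.
by exists (M + M') => x; rewrite (le_trans (ler_normD _ _)) ?lerD.
Qed.

Lemma bmfM f g : bmf f -> bmf g -> bmf (fun x => f x * g x).
Proof.
move=> [mf [M fM]] [mg [M' gM]]; split; first exact: measurable_funM.
by exists (M * M') => x; rewrite normrM ler_pM.
Qed.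

Lemma bmf_sum I (r : seq I) (F : I -> D -> R) : (forall i, bmf (F i)) ->
  bmf (fun x => \sum_(i <- r) F i x).
Proof.
move=> bF; elim: r => [|i r IH].
  by under eq_fun do rewrite big_nil; exact: bmf_cst.
by under eq_fun do rewrite big_cons; exact: bmfD.
Qed.

Lemma bmf_prod I (r : seq I) (F : I -> D -> R) : (forall i, bmf (F i)) ->
  bmf (fun x => \prod_(i <- r) F i x).
Proof.
move=> bF; elim: r => [|i r IH].
  by under eq_fun do rewrite big_nil; exact: bmf_cst.
by under eq_fun do rewrite big_cons; exact: bmfM.
Qed.

Lemma bmf_integrable (P : probability D R) f : bmf f -> P.-integrable setT (EFin \o f).
Proof.
move=> [mf [M fM]]; apply: measurable_bounded_integrable => //.
  by rewrite -ge0_fin_numE //; exact: fin_num_measure.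
by exists M; split; [rewrite num_real|move=> N MN x _; exact: le_trans (fM x) (ltW MN)].
Qed.
End BoundedMeasurable.

Lemma bmf_comp d d' (D : measurableType d) (T : measurableType d') (R : realType)
    (f : D -> R) (phi : T -> D) :
  measurable_fun setT phi -> bmf f -> bmf (fun x => f (phi x)).
Proof.
move=> mphi [mf [M fM]]; split; first exact: measurableT_comp mf mphi.
by exists M => x; exact: fM.
Qed.

Section IntegralRules.
Context d (D : measurableType d) (R : realType) (P : probability D R).
Implicit Types f g : D -> R.

Lemma bmf_RintegralD f g : bmf f -> bmf g ->
  \int[P]_x (f x + g x) = \int[P]_x f x + \int[P]_x g x.
Proof. by move=> bf bg; apply: RintegralD => //; exact: bmf_integrable. Qed.

Lemma bmf_RintegralZl r f : bmf f -> \int[P]_x (r * f x) = r * \int[P]_x f x.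
Proof. by move=> bf; apply: RintegralZl => //; exact: bmf_integrable. Qed.

Lemma bmf_RintegralZr r f : bmf f -> \int[P]_x (f x * r) = (\int[P]_x f x) * r.
Proof. by move=> bf; apply: RintegralZr => //; exact: bmf_integrable. Qed.

Lemma bmf_Rintegral_sum I (r : seq I) (F : I -> D -> R) : (forall i, bmf (F i)) ->
  \int[P]_x (\sum_(i <- r) F i x) = \sum_(i <- r) \int[P]_x F i x.
Proof.
move=> bF; elim: r => [|i r IH].
  under eq_Rintegral do rewrite big_nil.
  by rewrite big_nil Rintegral_cst// mul0r.
under eq_Rintegral do rewrite big_cons.
by rewrite big_cons bmf_RintegralD ?IH //; exact: bmf_sum.
Qed.

Lemma bmf_Rintegral_le f g : bmf f -> bmf g -> (forall x, f x <= g x) ->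
  \int[P]_x f x <= \int[P]_x g x.
Proof. by move=> bf bg fg; apply: le_Rintegral => //; exact: bmf_integrable. Qed.

Lemma prob_Rintegral_cst r : \int[P]_x r = r.
Proof.
by rewrite Rintegral_cst// [X in fine X](_ : _ = 1%E) ?mulr1 //; exact: probability_setT.
Qed.

Lemma EFin_bmf_Rintegral f : bmf f -> (\int[P]_x f x)%:E = (\int[P]_x (f x)%:E)%E.
Proof. by move=> bf; rewrite /Rintegral fineK //; exact/integrable_fin_num/bmf_integrable. Qed.

Lemma bmf_markov f (t : R) : bmf f -> (forall x, 0 <= f x) -> 0 < t ->
  (t%:E * P [set x | (t < f x)%R] <= (\int[P]_x f x)%:E)%E.
Proof.
move=> bf f0 t0; rewrite EFin_bmf_Rintegral //; have mf := bf.1.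
have mA : measurable [set x | t < f x].
  have := bf.1 measurableT `]t, +oo[%classic (measurable_itv _).
  by rewrite setTI; congr measurable; apply/seteqP; split => x /=; rewrite in_itv/= andbT.
rewrite -[X in P X]setIT -integral_indic// -ge0_integralZl_EFin//; last 2 first.
- exact/measurable_EFinP/measurable_indic.
- exact: ltW.
apply: ge0_le_integral => //.
- by move=> x _; rewrite mule_ge0// lee_fin ltW.
- by apply: emeasurable_funM => //; exact/measurable_EFinP/measurable_indic.
- exact/measurable_EFinP.
move=> x _; rewrite -EFinM lee_fin indicE; case: (boolP (x \in _)) => [/set_mem/=|_].
  by rewrite mulr1 => /ltW.
by rewrite mulr0.
Qed.
End IntegralRules.

(** * The product rule for independent variables *)

Section Independence.
Context (R : realType) d d' (D : measurableType d) (Omega : measurableType d')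
  (P : probability Omega R) (n : nat) (X : 'I_n -> {RV P >-> D})
  (nu : probability D R).
Hypotheses (Xind : mutually_independent X)
  (Xlaw : forall i B, measurable B -> distribution P (X i) B = nu B).
Implicit Types f : 'I_n -> D -> R.

Let product_rule f := \int[P]_w (\prod_i f i (X i w)) = \prod_i \int[nu]_y f i y.

Let upd f j h : 'I_n -> D -> R := fun i => if i == j then h else f i.

Let mX i : measurable_fun setT (X i).
Proof. exact: measurable_funPT. Qed.

Let bmf_prodX f (p : pred 'I_n) : (forall i, bmf (f i)) ->
  bmf (fun w => \prod_(i | p i) f i (X i w)).
Proof.
move=> bf; under eq_fun do rewrite -big_filter.
by apply: (@bmf_prod _ Omega R _ _ (fun i w => f i (X i w))) => i; exact: bmf_comp.
Qed.

Let prod_upd f j h (G : 'I_n -> (D -> R) -> R) :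
  \prod_i G i (upd f j h i) = G j h * \prod_(i | i != j) G i (f i).
Proof.
rewrite (bigD1 j) //= /upd eqxx; congr (_ * _).
by apply: eq_bigr => i /negbTE ->.
Qed.

Let product_rule_indic f : (forall i, exists2 B, measurable B & f i = \1_B) ->
  product_rule f.
Proof.
move=> fB.
have [B mB fE] : exists2 B : 'I_n -> set D, (forall i, measurable (B i)) & forall i, f i = \1_(B i).
  have /choice[B BP] : forall i, exists B, measurable B /\ f i = \1_B.
    by move=> i; have [B mB fE] := fB i; exists B.
  by exists B => i; have [] := BP i.
have mXB i : measurable (X i @^-1` B i) by rewrite -[_ @^-1` _]setTI; exact: mX.
have /= := Xind [set: 'I_n]%SET mB.
rewrite (_ : \bigcap_(i in [set i | i \in [set: 'I_n]%SET]) (X i @^-1` B i)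
    = \bigcap_(i in setT) (X i @^-1` B i)); last first.
  by congr bigcap; apply/seteqP; split => i //= _; rewrite finset.in_setT.
set A := \bigcap_(_ in _) _ => PA.
have mA : measurable A by apply: fin_bigcap_measurable => // i _; exact: mXB.
rewrite /product_rule; have -> : \int[P]_w (\prod_i f i (X i w)) = fine (P A).
  rewrite -[X in P X]setIT -integral_indic// /Rintegral; congr fine.
  apply: eq_integral => w _; congr EFin; rewrite indicE.
  have [/set_mem wA|wA] := boolP (w \in A).
    by rewrite big1// => i _; rewrite fE indicE mem_set //; exact: wA.
  have [i wi] : exists i, ~ B i (X i w).
    by apply: contrapT => /forallNP H; case/negP: wA; apply/mem_set => i _; exact: contrapT (H i).
  by rewrite (bigD1 i)//= fE indicE memNset// mul0r.
rewrite PA.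
have -> : (\prod_(i in [set: 'I_n]%SET) P (X i @^-1` B i) = (\prod_i \int[nu]_y f i y)%:E)%E.
  rewrite -prodEFin; apply: eq_big => [i|i _]; first by rewrite finset.in_setT.
  rewrite -[LHS]/(distribution P (X i) (B i)) Xlaw// fE EFin_bmf_Rintegral; last first.
    by split; [exact: measurable_indic|exists 1 => x; rewrite indicE; case: (_ \in _); rewrite ?normr1 ?normr0].
  by rewrite integral_indic// setIT.
by [].
Qed.

(** Induction on a list containing every index whose factor may fail to be an indicator. The
    induction hypothesis, with an indicator placed at [j], says that the law of [X j] weighted by
    the product [g] of the other factors is [C] times [nu]; [ge0_integral_weight] then admits any
    nonnegative factor at [j]. *)
Let product_rule_ge0 (s : seq 'I_n) f : (forall i, bmf (f i)) ->
  (forall i x, 0 <= f i x) ->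
  (forall i, i \notin s -> exists2 B, measurable B & f i = \1_B) ->
  product_rule f.
Proof.
elim: s f => [|j s IH] f bf f0 fB; first by apply: product_rule_indic => i; exact: fB.
pose C := \prod_(i | i != j) \int[nu]_y f i y.
have C0 : 0 <= C by apply: prodr_ge0 => i _; exact: Rintegral_ge0.
pose g w := \prod_(i | i != j) f i (X i w).
have bg : bmf g by exact: bmf_prodX.
have g0 w : 0 <= g w by apply: prodr_ge0.
have b1 B : measurable B -> bmf (\1_B : D -> R).
  move=> mB; split; first exact: measurable_indic.
  by exists 1 => x; rewrite indicE; case: (_ \in _); rewrite ?normr1 ?normr0.
have weight B : measurable B ->
    mscale (NngNum C0) nu B = (\int[P]_(x in X j @^-1` B) (g x)%:E)%E.
  move=> mB; have : product_rule (upd f j \1_B).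
    apply: IH.
    - by move=> i; rewrite /upd; case: ifP => // _; exact: b1.
    - by move=> i x; rewrite /upd; case: ifP => // _; rewrite indicE.
    - move=> i is'; rewrite /upd; case: ifPn => [_|ij]; first by exists B.
      by apply: fB; rewrite inE negb_or ij.
  rewrite /product_rule (prod_upd _ _ _ (fun i h => \int[nu]_y h y)).
  under eq_Rintegral => w _ do rewrite (prod_upd _ _ _ (fun i h => h (X i w))).
  rewrite -/C => E.
  transitivity ((\int[P]_w (\1_B (X j w) * g w))%:E).
    rewrite E EFinM EFin_bmf_Rintegral; last exact: b1.
    by rewrite integral_indic// setIT muleC.
  rewrite EFin_bmf_Rintegral; last first.
    by apply: bmfM bg; apply: bmf_comp => //; exact: b1.
  rewrite [RHS]integral_mkcond; apply: eq_integral => x _.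
  rewrite patchE indicE (_ : (X j x \in B) = (x \in X j @^-1` B)).
    by case: ifPn; rewrite ?mul1r ?mul0r.
  by apply/idP/idP => /set_mem ?; apply/mem_set.
have := ge0_integral_weight (mX j) bg.1 g0 weight.
move=> /(_ (fun y => (f j y)%:E)) H.
rewrite /product_rule (bigD1 j)//= -/C.
apply: EFin_inj; rewrite EFin_bmf_Rintegral; last exact: bmf_prodX.
rewrite EFinM EFin_bmf_Rintegral// muleC.
under eq_integral => w _ do rewrite (bigD1 j)//= EFinM.
rewrite -H; last 2 first.
- by apply/measurable_EFinP; exact: (bf j).1.
- by move=> y; rewrite lee_fin.
rewrite ge0_integral_mscale //=; last by move=> y _; rewrite lee_fin.
by apply/measurable_EFinP; exact: (bf j).1.
Qed.

(** Now the list contains the indices whose factor may change sign. Both sides are additive in the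
    factor at [j], and [f j] is the difference of the nonnegative functions [f j + M] and [M]. *)
Let product_rule_bmf (s : seq 'I_n) f : (forall i, bmf (f i)) ->
  (forall i x, i \notin s -> 0 <= f i x) -> product_rule f.
Proof.
elim: s f => [|j s IH] f bf f0.
  by apply: (@product_rule_ge0 (enum 'I_n)) => // i; rewrite ?mem_enum // => x; exact: f0.
have [mf [M fM]] := bf j.
pose u x := f j x + M.
have M0 (x : D) : 0 <= M by exact: le_trans (normr_ge0 _) (fM x).
have bu : bmf u by apply: bmfD => //; exact: bmf_cst.
have u0 x : 0 <= u x by have := fM x; rewrite ler_norml /u -lerBlDr sub0r => /andP[].
have pu : product_rule (upd f j u).
  apply: IH => [i|i x is']; rewrite /upd; case: eqP => // /eqP ij.
  by apply: f0; rewrite inE negb_or ij.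
have pM : product_rule (upd f j (fun=> M)).
  apply: IH => [i|i x is']; rewrite /upd; case: eqP => [_|/eqP ij] //.
  - exact: bmf_cst.
  - exact: M0 x.
  - by apply: f0; rewrite inE negb_or ij.
have bg : bmf (fun w => \prod_(i | i != j) f i (X i w)) by exact: bmf_prodX.
move: pu pM; rewrite /product_rule !(prod_upd _ _ _ (fun i h => \int[nu]_y h y)).
under eq_Rintegral => w _ do
  rewrite (prod_upd _ _ _ (fun i h => h (X i w))) /u mulrDl.
move=> pu.
under eq_Rintegral => w _ do rewrite (prod_upd _ _ _ (fun i h => h (X i w))).
move=> pM; move: pu.
rewrite bmf_RintegralD; last 2 first.
- by apply: bmfM bg; exact: bmf_comp.
- by apply: bmfM bg; exact: bmf_cst.
rewrite pM bmf_RintegralD//; last exact: bmf_cst.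
rewrite mulrDl => /addIr E; rewrite [RHS](bigD1 j)//= -E.
by apply: eq_Rintegral => w _; rewrite (bigD1 j).
Qed.

Lemma independent_Rintegral_prod f : (forall i, bmf (f i)) ->
  \int[P]_w (\prod_i f i (X i w)) = \prod_i \int[nu]_y f i y.
Proof.
by move=> bf; apply: (@product_rule_bmf (enum 'I_n)) => // i x; rewrite mem_enum.
Qed.
End Independence.

(** * Finite sums of products of one-coordinate functions *)

Section PolyFun.
Context d (D : measurableType d) (R : realType) (T : finType).
Implicit Types F G : (T -> D) -> R.

(** On this class expectations over independent coordinates reduce to products of one-dimensional
    integrals, so no product measure has to be formed. The entries of powers of the deviation belong
    to it. *)
Definition polyfun F := exists (K : finType) (c : K -> R) (f : K -> T -> D -> R),
  (forall k t, bmf (f k t)) /\ forall x, F x = \sum_k c k * \prod_t f k t (x t).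

Lemma polyfun_cst r : polyfun (fun=> r).
Proof.
exists unit, (fun=> r), (fun _ _ _ => 1); split; first by move=> *; exact: bmf_cst.
by move=> x; rewrite big_const card_unit /= addr0 big1 ?mulr1.
Qed.

Lemma polyfun_coord t (h : D -> R) : bmf h -> polyfun (fun x => h (x t)).
Proof.
move=> bh; exists unit, (fun=> 1), (fun _ t' => if t' == t then h else fun=> 1).
split; first by move=> _ t'; case: eqP => _ //; exact: bmf_cst.
move=> x; rewrite big_const card_unit /= addr0 mul1r (bigD1 t) //= eqxx big1 ?mulr1 //.
by move=> t' /negbTE ->.
Qed.

Lemma polyfunD F G : polyfun F -> polyfun G -> polyfun (fun x => F x + G x).
Proof.
move=> [K [c [f [bf FE]]]] [K' [c' [g [bg GE]]]].
exists (K + K')%type, (fun k => match k with inl a => c a | inr a => c' a end),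
  (fun k => match k with inl a => f a | inr a => g a end).
split; first by case.
by move=> x; rewrite big_sumType /= FE GE.
Qed.

Lemma polyfunM F G : polyfun F -> polyfun G -> polyfun (fun x => F x * G x).
Proof.
move=> [K [c [f [bf FE]]]] [K' [c' [g [bg GE]]]].
exists (K * K')%type, (fun k => c k.1 * c' k.2), (fun k t y => f k.1 t y * g k.2 t y).
split; first by move=> k t; exact: bmfM.
move=> x; rewrite FE GE big_distrlr /= pair_big /=.
by apply: eq_bigr => k _; rewrite big_split /= mulrACA.
Qed.

Lemma polyfun_sum I (r : seq I) (F : I -> (T -> D) -> R) :
  (forall i, polyfun (F i)) -> polyfun (fun x => \sum_(i <- r) F i x).
Proof.
move=> pF; elim: r => [|i r IH].
  by under eq_fun do rewrite big_nil; exact: polyfun_cst.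
by under eq_fun do rewrite big_cons; exact: polyfunD.
Qed.

Lemma polyfunZ r F : polyfun F -> polyfun (fun x => r * F x).
Proof. by move=> pF; apply: polyfunM => //; exact: polyfun_cst. Qed.

Lemma polyfunN F : polyfun F -> polyfun (fun x => - F x).
Proof. by move=> pF; under eq_fun do rewrite -mulN1r; exact: polyfunZ. Qed.

Lemma polyfun_perm (tau : {perm T}) F : polyfun F ->
  polyfun (fun x => F (fun t => x (tau t))).
Proof.
move=> [K [c [f [bf FE]]]].
exists K, c, (fun k t => f k ((tau^-1)%g t)); split => // x; rewrite FE.
apply: eq_bigr => k _; rewrite [in RHS](reindex_inj (@perm_inj _ tau)) /=.
by congr (_ * _); apply: eq_bigr => t _; rewrite permK.
Qed.

Section Matrices.
Context (N : nat).
Implicit Types A B : (T -> D) -> 'M[R]_N.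

Definition mxpolyfun A := forall i j, polyfun (fun x => A x i j).

Lemma mxpolyfun_cst (M : 'M[R]_N) : mxpolyfun (fun=> M).
Proof. by move=> i j; exact: polyfun_cst. Qed.

Lemma mxpolyfun_coord t (h : D -> 'M[R]_N) :
  (forall i j, bmf (fun y => h y i j)) -> mxpolyfun (fun x => h (x t)).
Proof. by move=> bh i j; exact: (polyfun_coord t (bh i j)). Qed.

Lemma mxpolyfunD A B : mxpolyfun A -> mxpolyfun B -> mxpolyfun (fun x => A x + B x).
Proof. by move=> pA pB i j; under eq_fun do rewrite mxE; exact: polyfunD. Qed.

Lemma mxpolyfunZ r A : mxpolyfun A -> mxpolyfun (fun x => r *: A x).
Proof. by move=> pA i j; under eq_fun do rewrite mxE; exact: polyfunZ. Qed.

Lemma mxpolyfunB A B : mxpolyfun A -> mxpolyfun B -> mxpolyfun (fun x => A x - B x).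
Proof.
move=> pA pB; under eq_fun do rewrite -scaleN1r.
by apply: mxpolyfunD => //; exact: mxpolyfunZ.
Qed.

Lemma mxpolyfunM A B : mxpolyfun A -> mxpolyfun B -> mxpolyfun (fun x => A x *m B x).
Proof.
move=> pA pB i j; under eq_fun do rewrite mxE.
by apply: polyfun_sum => k; exact: polyfunM.
Qed.

Lemma mxpolyfunX A m : mxpolyfun A -> mxpolyfun (fun x => A x ^+ m).
Proof.
move=> pA; elim: m => [|m IH].
  by under eq_fun do rewrite expr0; exact: mxpolyfun_cst.
by under eq_fun do rewrite exprS; exact: mxpolyfunM.
Qed.

Lemma mxpolyfun_sum I (r : seq I) (F : I -> (T -> D) -> 'M[R]_N) :
  (forall i, mxpolyfun (F i)) -> mxpolyfun (fun x => \sum_(i <- r) F i x).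
Proof.
move=> pF; elim: r => [|i r IH].
  by under eq_fun do rewrite big_nil; exact: mxpolyfun_cst.
by under eq_fun do rewrite big_cons; exact: mxpolyfunD.
Qed.

Lemma polyfun_trace A : mxpolyfun A -> polyfun (fun x => \tr (A x)).
Proof. by move=> pA; apply: polyfun_sum => i; exact: pA. Qed.
End Matrices.
End PolyFun.

(** * A sample extended by one independent point *)

Section Resampling.
Context (R : realType) d d' (D : measurableType d) (Omega : measurableType d')
  (P : probability Omega R) (n : nat) (X : 'I_n -> {RV P >-> D})
  (nu : probability D R).
Hypotheses (Xind : mutually_independent X)
  (Xlaw : forall i B, measurable B -> distribution P (X i) B = nu B).
Implicit Types F G : ('I_n.+1 -> D) -> R.

Definition ext (x : 'I_n -> D) (y : D) : 'I_n.+1 -> D :=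
  fun t => if unlift ord0 t is Some i then x i else y.

Lemma ext0 x y : ext x y ord0 = y.
Proof. by rewrite /ext unlift_none. Qed.

Lemma ext_lift x y i : ext x y (lift ord0 i) = x i.
Proof. by rewrite /ext liftK. Qed.

Lemma ext_comp_lift x y : (fun i => ext x y (lift ord0 i)) = x.
Proof. by apply/funext => i; rewrite ext_lift. Qed.

Definition sampleX w : 'I_n -> D := fun i => X i w.

(* The expectation of [F] at the sample [X] together with an independent point
   of law [nu], placed at index [ord0]. *)
Definition resample F : R := \int[P]_w \int[nu]_y F (ext (sampleX w) y).

Let rep_ext (K : finType) (c : K -> R) (f : K -> 'I_n.+1 -> D -> R) x y :
  \sum_k c k * \prod_t f k t (ext x y t) =
  \sum_k c k * ((\prod_i f k (lift ord0 i) (x i)) * f k ord0 y).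
Proof.
apply: eq_bigr => k _; congr (_ * _); rewrite big_ord_recl ext0 mulrC; congr (_ * _).
by apply: eq_bigr => i _; rewrite ext_lift.
Qed.

Let bmf_prodX (f : 'I_n -> D -> R) : (forall i, bmf (f i)) ->
  bmf (fun w => \prod_i f i (X i w)).
Proof.
move=> bf; apply: (@bmf_prod _ Omega R _ _ (fun i w => f i (X i w))) => i.
by apply: bmf_comp => //; exact: measurable_funPT.
Qed.

Let inner_rep (K : finType) (c : K -> R) (f : K -> 'I_n.+1 -> D -> R) F :
  (forall k t, bmf (f k t)) ->
  (forall x, F x = \sum_k c k * \prod_t f k t (x t)) -> forall x,
  \int[nu]_y F (ext x y) =
  \sum_k c k * ((\prod_i f k (lift ord0 i) (x i)) * \int[nu]_y f k ord0 y).
Proof.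
move=> bf FE x; under eq_Rintegral => y _ do rewrite FE rep_ext.
rewrite bmf_Rintegral_sum; last first.
  by move=> k; do 2 (apply: bmfM; first exact: bmf_cst).
apply: eq_bigr => k _; rewrite !bmf_RintegralZl //.
by apply: bmfM => //; exact: bmf_cst.
Qed.

Lemma bmf_inner F x : polyfun F -> bmf (fun y => F (ext x y)).
Proof.
move=> [K [c [f [bf FE]]]]; under eq_fun do rewrite FE rep_ext.
by apply: bmf_sum => k; do 2 (apply: bmfM; first exact: bmf_cst).
Qed.

Lemma bmf_outer F : polyfun F -> bmf (fun w => \int[nu]_y F (ext (sampleX w) y)).
Proof.
move=> [K [c [f [bf FE]]]]; under eq_fun do rewrite (inner_rep bf FE).
apply: bmf_sum => k; apply: bmfM; first exact: bmf_cst.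
apply: bmfM; last exact: bmf_cst.
exact: (bmf_prodX (fun i => bf k (lift ord0 i))).
Qed.

(** The product rule for the sample, joined with the separate integral over the fresh point, lets
    all [n.+1] coordinates enter alike. Invariance under exchanging a node with the fresh point
    follows by reindexing. *)
Lemma resampleE (K : finType) (c : K -> R) (f : K -> 'I_n.+1 -> D -> R) F :
  (forall k t, bmf (f k t)) ->
  (forall x, F x = \sum_k c k * \prod_t f k t (x t)) ->
  resample F = \sum_k c k * \prod_t \int[nu]_y f k t y.
Proof.
move=> bf FE; rewrite /resample.
under eq_Rintegral => w _ do rewrite (inner_rep bf FE).
have bfX k : bmf (fun w => \prod_i f k (lift ord0 i) (X i w)).
  exact: (bmf_prodX (fun i => bf k (lift ord0 i))).
rewrite bmf_Rintegral_sum; last first.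
  by move=> k; apply: bmfM; [|apply: bmfM => //]; exact: bmf_cst.
apply: eq_bigr => k _; rewrite bmf_RintegralZl; last first.
  by apply: bmfM => //; exact: bmf_cst.
rewrite bmf_RintegralZr //.
rewrite (independent_Rintegral_prod Xind Xlaw (fun i => bf k (lift ord0 i))).
by congr (_ * _); rewrite big_ord_recl mulrC.
Qed.

Lemma resample_swap i F : polyfun F ->
  resample (fun x => F (fun t => x (tperm ord0 (lift ord0 i) t))) = resample F.
Proof.
set tau := tperm _ _; move=> [K [c [f [bf FE]]]]; rewrite (resampleE bf FE).
rewrite (@resampleE _ c (fun k t => f k (tau t))) //.
  apply: eq_bigr => k _; congr (_ * _).
  by rewrite [RHS](reindex_inj (@perm_inj _ tau)).
move=> x; rewrite FE; apply: eq_bigr => k _; congr (_ * _).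
rewrite [RHS](reindex_inj (@perm_inj _ tau)); apply: eq_bigr => t _.
by rewrite tpermK.
Qed.

Lemma resampleD F G : polyfun F -> polyfun G ->
  resample (fun x => F x + G x) = resample F + resample G.
Proof.
move=> pF pG; rewrite /resample -bmf_RintegralD; try exact: bmf_outer.
by apply: eq_Rintegral => w _; rewrite bmf_RintegralD //; exact: bmf_inner.
Qed.

Lemma resampleZ r F : polyfun F -> resample (fun x => r * F x) = r * resample F.
Proof.
move=> pF; rewrite /resample -bmf_RintegralZl; last exact: bmf_outer.
by apply: eq_Rintegral => w _; rewrite bmf_RintegralZl //; exact: bmf_inner.
Qed.

Lemma resample_sum I (r : seq I) (F : I -> ('I_n.+1 -> D) -> R) :
  (forall i, polyfun (F i)) ->
  resample (fun x => \sum_(i <- r) F i x) = \sum_(i <- r) resample (F i).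
Proof.
move=> pF; elim: r => [|i r IH].
  rewrite /resample big_nil; under eq_Rintegral => w _.
    under eq_Rintegral do rewrite big_nil.
    by rewrite prob_Rintegral_cst; over.
  by rewrite prob_Rintegral_cst.
rewrite big_cons -IH -resampleD //; last exact: polyfun_sum.
by congr resample; apply/funext => x; rewrite big_cons.
Qed.

Lemma resample_le F G : polyfun F -> polyfun G -> (forall x, F x <= G x) ->
  resample F <= resample G.
Proof.
move=> pF pG FG; apply: bmf_Rintegral_le; try exact: bmf_outer.
by move=> w; apply: bmf_Rintegral_le => //; exact: bmf_inner.
Qed.

Lemma resample_lift (F : ('I_n -> D) -> R) :
  resample (fun x => F (fun i => x (lift ord0 i))) = \int[P]_w F (sampleX w).
Proof.
apply: eq_Rintegral => w _; under eq_Rintegral do rewrite ext_comp_lift.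
exact: prob_Rintegral_cst.
Qed.

Lemma polyfun_lift (F : ('I_n -> D) -> R) : polyfun F ->
  polyfun (fun x : 'I_n.+1 -> D => F (fun i => x (lift ord0 i))).
Proof.
move=> [K [c [f [bf FE]]]].
exists K, c, (fun k t => if unlift ord0 t is Some i then f k i else fun=> 1); split.
  by move=> k t; case: unlift => [i|] //; exact: bmf_cst.
move=> x; rewrite FE; apply: eq_bigr => k _; rewrite big_ord_recl unlift_none mul1r.
by congr (_ * _); apply: eq_bigr => i _; rewrite liftK.
Qed.

Lemma polyfun_sampleX (F : ('I_n -> D) -> R) : polyfun F -> bmf (fun w => F (sampleX w)).
Proof.
move=> /polyfun_lift/bmf_outer; congr bmf; apply/funext => w.
by under eq_Rintegral do rewrite ext_comp_lift; exact: prob_Rintegral_cst.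
Qed.

Lemma resample_indep (F : ('I_n -> D) -> R) h : polyfun F -> bmf h ->
  resample (fun x => F (fun i => x (lift ord0 i)) * h (x ord0)) =
  (\int[P]_w F (sampleX w)) * \int[nu]_y h y.
Proof.
move=> pF bh; rewrite -bmf_RintegralZr; last exact: polyfun_sampleX.
apply: eq_Rintegral => w _.
under eq_Rintegral do rewrite ext_comp_lift ext0.
by rewrite bmf_RintegralZl.
Qed.
End Resampling.

(** * Moments of the deviation of a random Gram matrix *)

(** In the application [a] and [b] are consecutive even moments, [c] is the odd moment between them,
    [e] the term with the mean and [q] the factor from [moment_step]. The factor 32 yields
    [32 a <= a + (2 + 1/4) n^2 b]; moving [a] to the left leaves 31, whence [(9/4) / 31 = 9/124]. *)
Lemma moment_recursion_absorb (R : realFieldType) (n q a b c e : R) :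
  0 < n -> 0 <= q -> 32 * q <= n -> 0 <= a -> 0 <= b ->
  c <= n^-1 * a + n / 4 * b -> e <= b -> a <= q * (c + 2 * n * e) ->
  a <= 9 / 124 * n ^+ 2 * b.
Proof.
move=> n0 q0 qn a0 b0 cle eb ale; have n0' := ltW n0.
have {}ale : a <= q * (n^-1 * a + n / 4 * b + 2 * n * b).
  apply: le_trans ale _; rewrite ler_wpM2l // lerD // ler_wpM2l // mulr_ge0 //.
have {ale} : 32 * a <= n * (n^-1 * a + n / 4 * b + 2 * n * b).
  rewrite -(ler_pM2l (ltr0n R 32)) in ale; apply: le_trans ale _.
  by rewrite mulrA ler_wpM2r // !addr_ge0 // !mulr_ge0 // invr_ge0.
have -> : n * (n^-1 * a + n / 4 * b + 2 * n * b) = a + n ^+ 2 * (9 / 4) * b.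
  by field; rewrite gt_eqF.
have -> : 9 / 124 * n ^+ 2 * b = (n ^+ 2 * (9 / 4) * b) / 31 by field.
move: (n ^+ 2 * (9 / 4) * b) => t; lra.
Qed.

Lemma sum_ord_subr (R : pzRingType) n (F : 'I_n -> R) c :
  \sum_i F i - n%:R * c = \sum_i (F i - c).
Proof. by rewrite sumrB sumr_const card_ord mulr_natl. Qed.

Section MatrixMoments.
Context (R : realType) d d' (D : measurableType d) (Omega : measurableType d')
  (P : probability Omega R) (n : nat) (X : 'I_n -> {RV P >-> D})
  (nu : probability D R).
Hypotheses (Xind : mutually_independent X)
  (Xlaw : forall i B, measurable B -> distribution P (X i) B = nu B).
Context (N : nat) (Z : D -> 'M[R]_N) (r : R).
Hypotheses (bZ : forall i j, bmf (fun y => Z y i j)) (Z_psd : forall y, psd (Z y))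
  (Z_sqr : forall y, exists2 t, t <= r & Z y *m Z y = t *: Z y).

Definition mean_mx : 'M[R]_N := \matrix_(i, j) \int[nu]_y Z y i j.

Local Notation E := mean_mx.
Hypothesis E_le1 : psd (1%:M - E).

Definition deviation (x : 'I_n -> D) : 'M[R]_N := \sum_i Z (x i) - n%:R *: E.

Definition moment m : R := \int[P]_w \tr (deviation (sampleX X w) ^+ m).

Let lft (x : 'I_n.+1 -> D) : 'I_n -> D := fun i => x (lift ord0 i).
Let S (x : 'I_n.+1 -> D) := deviation (lft x).
Let swap i (x : 'I_n.+1 -> D) := fun t => x (tperm ord0 (lift ord0 i) t).
Local Notation L := (resample X nu).

Let symZ y : (Z y)^T = Z y. Proof. by case: (Z_psd y). Qed.

Let symE : E^T = E.
Proof. by apply/matrixP => i j; rewrite !mxE; apply: eq_Rintegral => y _; rewrite -{1}symZ mxE. Qed.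

Lemma deviation_sym x : (deviation x)^T = deviation x.
Proof.
rewrite linearB /= linearZ /= symE linear_sum /=.
by congr (_ - _); apply: eq_bigr => i _.
Qed.

Let mxpoly_dev : mxpolyfun deviation.
Proof.
apply: mxpolyfunB; last exact: mxpolyfun_cst.
by apply: mxpolyfun_sum => i; exact: mxpolyfun_coord.
Qed.

Let mxpoly_S : mxpolyfun S.
Proof. by move=> i j; exact: (polyfun_lift (mxpoly_dev i j)). Qed.

Let mxpoly_Z t : mxpolyfun (fun x : 'I_n.+1 -> D => Z (x t)).
Proof. exact: mxpolyfun_coord. Qed.

Let S_swap i x : S x - S (swap i x) = Z (x (lift ord0 i)) - Z (x ord0).
Proof.
rewrite /S /deviation opprB addrA subrK (bigD1 i) //= [X in _ - X](bigD1 i) //=.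
have -> : lft (swap i x) i = x ord0 by rewrite /lft /swap tpermR.
have -> : \sum_(j < n | j != i) Z (lft (swap i x) j) = \sum_(j < n | j != i) Z (lft x j).
  apply: eq_bigr => j ji; congr Z; rewrite /lft /swap tpermD //.
  by rewrite (inj_eq lift_inj) eq_sym.
by rewrite opprD addrACA subrr addr0.
Qed.

(** The fresh point is independent of the sample, so [Z (x ord0)] averages to [E] inside the
    trace. *)
Let trace_indep (M : ('I_n -> D) -> 'M[R]_N) : mxpolyfun M ->
  L (fun x => \tr (M (lft x) *m Z (x ord0))) = \int[P]_w \tr (M (sampleX X w) *m E).
Proof.
move=> pM; rewrite -(resample_lift X nu (fun x => \tr (M x *m E))).
have trE (A B : 'M[R]_N) : \tr (A *m B) = \sum_i \sum_j A i j * B j i.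
  by apply: eq_bigr => i _; rewrite mxE.
under eq_fun do rewrite trE; under [in RHS]eq_fun do rewrite trE.
have pl i j : polyfun (fun x : 'I_n.+1 -> D => M (lft x) i j).
  exact: (polyfun_lift (pM i j)).
rewrite !resample_sum; last 2 first.
- by move=> i; apply: polyfun_sum => j; apply: polyfunM; [exact: pl|exact: polyfun_cst].
- by move=> i; apply: polyfun_sum => j; apply: polyfunM; [exact: pl|exact: (mxpoly_Z ord0 j i)].
apply: eq_bigr => i _; rewrite !resample_sum; last 2 first.
- by move=> j; apply: polyfunM; [exact: pl|exact: polyfun_cst].
- by move=> j; apply: polyfunM; [exact: pl|exact: (mxpoly_Z ord0 j i)].
apply: eq_bigr => j _.
rewrite (resample_indep X nu (pM i j) (bZ j i)).
rewrite (resample_lift X nu (fun x => M x i j * E j i)) /=.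
rewrite bmf_RintegralZr; last exact: (polyfun_sampleX X nu (pM i j)).
by rewrite mxE.
Qed.

(** The swap of node [i] with the fresh point preserves [resample], reverses the sign of [H] and
    moves [S] by exactly [H]. Averaging the trace with its swapped form produces the difference of
    powers in [trace_power_diff]. The two even powers that come out have equal expectation, again by
    the swap, and [trace_sub_sqr_even] replaces [H^2] by an expression linear in [Z]. *)
Let trace_resample_le i m :
  L (fun x => \tr ((Z (x (lift ord0 i)) - Z (x ord0)) *m S x ^+ m.*2.+1)) <=
  m.*2.+1%:R * r * L (fun x => \tr ((Z (x (lift ord0 i)) + Z (x ord0)) *m S x ^+ m.*2)).
Proof.
pose H x := Z (x (lift ord0 i)) - Z (x ord0).
have pH : mxpolyfun H by apply: mxpolyfunB; exact: mxpoly_Z.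
have pSw : mxpolyfun (fun x => S (swap i x)).
  by move=> a b; exact: (polyfun_perm (tperm ord0 (lift ord0 i)) (mxpoly_S a b)).
have Hsw x : H (swap i x) = - H x by rewrite /H /swap tpermL tpermR opprB.
set a := L _; pose q x := \tr (H x *m H x *m S x ^+ m.*2).
have pq : polyfun q.
  by apply: polyfun_trace; apply: mxpolyfunM; [exact: mxpolyfunM|exact: mxpolyfunX].
pose p x := \tr (H x *m S x ^+ m.*2.+1).
have pp : polyfun p by apply: polyfun_trace; apply: mxpolyfunM => //; exact: mxpolyfunX.
have aE : a = L (fun x => - \tr (H x *m S (swap i x) ^+ m.*2.+1)).
  rewrite /a -(resample_swap Xind Xlaw i pp); congr resample; apply/funext => x.
  by rewrite /p -/(swap i x) Hsw mulNmx linearN.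
pose p2 x := - \tr (H x *m S (swap i x) ^+ m.*2.+1).
have pp2 : polyfun p2.
  by apply: polyfunN; apply: polyfun_trace; apply: mxpolyfunM => //; exact: mxpolyfunX.
pose q2 x := q (swap i x).
have pq2 : polyfun q2 by exact: (polyfun_perm (tperm ord0 (lift ord0 i)) pq).
have q2E : L q2 = L q by exact: (resample_swap Xind Xlaw i pq).
have step1 : 2 * a <= m.*2.+1%:R * L q.
  have -> : 2 * a = L (fun x => p x + p2 x).
    by rewrite (resampleD X nu pp pp2) mulr_natl mulr2n; congr (_ + _); exact: aE.
  have -> : m.*2.+1%:R * L q = L (fun x => m.*2.+1%:R / 2 * (q x + q2 x)).
    rewrite (resampleZ X nu _ (polyfunD pq pq2)) (resampleD X nu pq pq2) q2E.
    by move: (L q) => t; field.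
  apply: resample_le; first exact: polyfunD.
    by apply: polyfunZ; exact: polyfunD.
  move=> x; have := @trace_power_diff R N (S x) (S (swap i x)) m (deviation_sym _) (deviation_sym _).
  rewrite S_swap -/(H x) mulmxBr linearB mulmxDr linearD.
  have q2x : q2 x = \tr (H x *m H x *m S (swap i x) ^+ m.*2).
    rewrite /q2 /q Hsw -[- H x](scaleN1r (H x)) -scalemxAl -scalemxAr scalerA.
    by rewrite mulrNN mulr1 scale1r.
  move=> h; have {h} : 2 * (p x + p2 x) <= m.*2.+1%:R * (q x + q2 x).
    by rewrite q2x; exact: h.
  move: (p x + p2 x) (q x + q2 x) => u v h.
  by rewrite -(ler_pM2l (ltr0n R 2)) [2 * (_ / 2 * _)]mulrA [2 * (_ / 2)]mulrC divfK.
have step2 : L q <= 2 * r * L (fun x => \tr ((Z (x (lift ord0 i)) + Z (x ord0)) *m S x ^+ m.*2)).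
  have pZZ : polyfun (fun x => \tr ((Z (x (lift ord0 i)) + Z (x ord0)) *m S x ^+ m.*2)).
    by apply: polyfun_trace; apply: mxpolyfunM; [exact: mxpolyfunD|exact: mxpolyfunX].
  rewrite -(resampleZ X nu (2 * r) pZZ); apply: resample_le; [exact: pq|exact: polyfunZ|].
  move=> x; have [t1 t1r Z1] := Z_sqr (x (lift ord0 i)).
  have [t2 t2r Z2] := Z_sqr (x ord0).
  exact: (trace_sub_sqr_even m (deviation_sym _) (Z_psd _) (Z_psd _) Z1 Z2 t1r t2r).
have fin (c u v w : R) : 0 <= c -> 2 * u <= c * v -> v <= 2 * r * w -> u <= c * r * w.
  move=> c0 h1 h2; rewrite -(ler_pM2l (ltr0n R 2)); apply: le_trans h1 _.
  apply: le_trans (ler_wpM2l c0 h2) _.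
  by have -> : c * (2 * r * w) = 2 * (c * r * w) by ring.
exact: fin (ler0n _ _) step1 step2.
Qed.

(** Given the sample, the sum over [i] of [Z (x_i) - Z (x_0)] has mean [S], and that of
    [Z (x_i) + Z (x_0)] has mean [S + 2 n E], because the fresh [Z (x_0)] has mean [E]. Summing
    [trace_resample_le] over [i] thus closes up in terms of moments. *)
Lemma moment_step m :
  moment m.*2.+2 <= m.*2.+1%:R * r *
    (moment m.*2.+1 + 2 * n%:R * \int[P]_w \tr (E *m deviation (sampleX X w) ^+ m.*2)).
Proof.
have pX q : mxpolyfun (fun x => deviation x ^+ q) by exact: mxpolyfunX.
have pSX q : mxpolyfun (fun x => S x ^+ q) by exact: mxpolyfunX.
have momE q : moment q = L (fun x => \tr (S x ^+ q)).
  by rewrite (resample_lift X nu (fun x => \tr (deviation x ^+ q))).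
have indep q : L (fun x => \tr (Z (x ord0) *m S x ^+ q)) =
    \int[P]_w \tr (E *m deviation (sampleX X w) ^+ q).
  under eq_fun do rewrite mxtrace_mulC.
  rewrite (trace_indep (pX q)); apply: eq_Rintegral => w _; exact: mxtrace_mulC.
set K := m.*2.+1%:R * r.
pose zi q i := L (fun x => \tr (Z (x (lift ord0 i)) *m S x ^+ q)).
pose z0 q := L (fun x => \tr (Z (x ord0) *m S x ^+ q)).
have pZ q t : polyfun (fun x => \tr (Z (x t) *m S x ^+ q)).
  by apply: polyfun_trace; exact: mxpolyfunM.
have sumE q : moment q.+1 = \sum_i zi q i - n%:R * z0 q.
  have -> : n%:R * z0 q = L (fun x => n%:R * \tr (E *m S x ^+ q)).
    rewrite resampleZ; last by apply: polyfun_trace; apply: mxpolyfunM => //; exact: mxpolyfun_cst.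
    rewrite /z0 indep -(resample_lift X nu (fun x => \tr (E *m deviation x ^+ q))) //.
  rewrite /zi -resample_sum // -mulN1r -resampleZ; last first.
    by apply: polyfunZ; apply: polyfun_trace; apply: mxpolyfunM => //; exact: mxpolyfun_cst.
  rewrite -resampleD; last 2 first.
  - exact: polyfun_sum.
  - do 2 apply: polyfunZ; apply: polyfun_trace; apply: mxpolyfunM => //; exact: mxpolyfun_cst.
  rewrite momE; congr resample; apply/funext => x.
  rewrite exprS -[_ * _]/(_ *m _) {1}/S /deviation mulmxBl linearB /= -scalemxAl.
  by rewrite mxtraceZ mulmx_suml raddf_sum mulN1r.
have lhsE : moment m.*2.+2 = \sum_i (zi m.*2.+1 i - z0 m.*2.+1).
  by rewrite sumE; exact: sum_ord_subr.
have rhsE : moment m.*2.+1 + 2 * n%:R * (\int[P]_w \tr (E *m deviation (sampleX X w) ^+ m.*2))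
    = \sum_i (zi m.*2 i + z0 m.*2).
  rewrite -indep -/(z0 m.*2) sumE; move: (zi m.*2) (z0 m.*2) => F e.
  rewrite -[in RHS](opprK e) -sum_ord_subr.
  move: (\sum_i F i) => t; ring.
rewrite lhsE rhsE.
rewrite mulr_sumr; apply: ler_sum => i _.
have := trace_resample_le i m.
have -> : L (fun x => \tr ((Z (x (lift ord0 i)) - Z (x ord0)) *m S x ^+ m.*2.+1))
    = zi m.*2.+1 i - z0 m.*2.+1.
  rewrite -mulN1r -(resampleZ X nu _ (pZ m.*2.+1 ord0)).
  rewrite -(resampleD X nu (pZ m.*2.+1 (lift ord0 i)) (polyfunZ _ (pZ m.*2.+1 ord0))).
  by congr resample; apply/funext => x; rewrite mulmxBl linearB mulN1r.
have -> : L (fun x => \tr ((Z (x (lift ord0 i)) + Z (x ord0)) *m S x ^+ m.*2))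
    = zi m.*2 i + z0 m.*2.
  rewrite -(resampleD X nu (pZ m.*2 (lift ord0 i)) (pZ m.*2 ord0)).
  by congr resample; apply/funext => x; rewrite mulmxDl linearD.
by [].
Qed.

Let moment1 : moment 1 = 0.
Proof.
have -> : moment 1 = L (fun x => \sum_i \tr (Z (x (lift ord0 i))) + - (n%:R * \tr E)).
  rewrite (resample_lift X nu (fun x => \sum_i \tr (Z (x i)) + - (n%:R * \tr E))).
  apply: eq_Rintegral => w _; rewrite expr1 /deviation linearB /= mxtraceZ.
  by rewrite raddf_sum.
have pZ t : polyfun (fun x : 'I_n.+1 -> D => \tr (Z (x t))) by exact: polyfun_trace.
rewrite resampleD; [|exact: polyfun_sum|exact: polyfun_cst].
rewrite (resample_lift X nu (fun=> _)) prob_Rintegral_cst resample_sum //.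
rewrite (eq_bigr (fun=> \tr E)) ?sumr_const ?card_ord ?mulr_natl ?subrr // => i _.
rewrite -(resample_swap Xind Xlaw i (pZ (lift ord0 i))).
have -> : (fun x : 'I_n.+1 -> D => \tr (Z (x (tperm ord0 (lift ord0 i) (lift ord0 i)))))
    = (fun x => \tr (1%:M *m Z (x ord0))).
  by apply/funext => x; rewrite tpermR mul1mx.
rewrite (trace_indep (mxpolyfun_cst _ _ _)).
by under eq_Rintegral do rewrite mul1mx; exact: prob_Rintegral_cst.
Qed.

Let bmf_trace (M : ('I_n -> D) -> 'M[R]_N) : mxpolyfun M ->
  bmf (fun w => \tr (M (sampleX X w))).
Proof. by move=> pM; exact: (polyfun_sampleX X nu (polyfun_trace pM)). Qed.

Lemma bmf_deviation_trace m : bmf (fun w => \tr (deviation (sampleX X w) ^+ m)).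
Proof. by apply: (bmf_trace (M := fun x => deviation x ^+ m)); exact: mxpolyfunX. Qed.

Lemma moment_even_ge0 m : 0 <= moment m.*2.
Proof.
apply: Rintegral_ge0 => w _; rewrite -addnn exprD -{1}[_ ^+ m]trmxK trmxX deviation_sym.
exact: mxtrace_trmul_ge0.
Qed.

(** The recursion starts at the second moment, where the first moment vanishes and [moment_step]
    leaves [2 n r tr E]. Starting there and not at [moment 0] brings in the trace of the mean in
    place of the dimension [N]. *)
Lemma moment_bound m : (0 < n)%N -> 0 <= r -> 32 * (m.*2.+1%:R * r) <= n%:R ->
  moment m.+1.*2 <= (9 / 124 * n%:R ^+ 2) ^+ m * (2 * n%:R * r * \tr E).
Proof.
move=> n_gt0 r0; elim: m => [_|m IH rn].
  have := moment_step 0; rewrite moment1 add0r mul1r expr0 mul1r.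
  under eq_Rintegral do rewrite expr0 -[1]/(1%:M) mulmx1.
  by rewrite prob_Rintegral_cst mulrA [r * _]mulrC.
have {}IH : moment m.+1.*2 <= (9 / 124 * n%:R ^+ 2) ^+ m * (2 * n%:R * r * \tr E).
  apply: IH; apply: le_trans rn; rewrite ler_wpM2l // ler_wpM2r // ler_nat.
  by rewrite ltnS leq_double.
have n0 : 0 < n%:R :> R by rewrite ltr0n.
apply: le_trans (_ : 9 / 124 * n%:R ^+ 2 * moment m.+1.*2 <= _); last first.
  by rewrite [_ ^+ m.+1]exprS -[leRHS]mulrA ler_wpM2l ?IH // mulr_ge0 ?exprn_ge0.
have step := moment_step m.+1.
have bX q := bmf_deviation_trace q.
have odd_le : moment m.+1.*2.+1 <= n%:R^-1 * moment m.+2.*2 + n%:R / 4 * moment m.+1.*2.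
  rewrite /moment -!bmf_RintegralZl // -bmf_RintegralD; last 2 first.
  - by apply: bmfM => //; exact: bmf_cst.
  - by apply: bmfM => //; exact: bmf_cst.
  apply: bmf_Rintegral_le => //.
    by apply: bmfD; apply: bmfM => //; exact: bmf_cst.
  by move=> w; exact: (trace_odd_power_le _ (deviation_sym _) n0).
have E_le : \int[P]_w \tr (E *m deviation (sampleX X w) ^+ m.+1.*2) <= moment m.+1.*2.
  apply: bmf_Rintegral_le => //.
    apply: (bmf_trace (M := fun x => E *m deviation x ^+ m.+1.*2)).
    by apply: mxpolyfunM; [exact: mxpolyfun_cst|exact: mxpolyfunX].
  move=> w; rewrite -[leRHS](congr1 mxtrace (mul1mx _)).
  exact: (psd_trace_le _ (deviation_sym _)).
have M0 := moment_even_ge0 m.+1; have M1 := moment_even_ge0 m.+2.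
exact: moment_recursion_absorb n0 (mulr_ge0 (ler0n _ _) r0) rn M1 M0 odd_le E_le step.
Qed.

(** Markov's inequality at level [(n/2)^(2m+2)]: divided by [n^2 / 4], each factor [(9/124) n^2]
    becomes [9/31]. *)
Lemma deviation_tail m : (0 < n)%N -> 0 <= r -> 32 * (m.*2.+1%:R * r) <= n%:R ->
  (P [set w | ((n%:R / 2) ^+ m.+1.*2 < \tr (deviation (sampleX X w) ^+ m.+1.*2))%R]
   <= ((9 / 31) ^+ m * (8 * r * \tr E / n%:R))%:E)%E.
Proof.
move=> n_gt0 r0 rn.
have n0 : 0 < n%:R :> R by rewrite ltr0n.
pose t : R := (n%:R / 2) ^+ m.+1.*2.
have t0 : 0 < t by rewrite exprn_gt0 // divr_gt0.
rewrite -(@lee_pmul2l _ t%:E) ?lte_fin //.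
have bX := bmf_deviation_trace m.+1.*2.
apply: le_trans (bmf_markov P bX _ t0) _.
  move=> w; rewrite -addnn exprD -{1}[_ ^+ m.+1]trmxK trmxX deviation_sym.
  exact: mxtrace_trmul_ge0.
rewrite -EFinM lee_fin; apply: le_trans (moment_bound n_gt0 r0 rn) _.
rewrite le_eqVlt; apply/orP; left; apply/eqP.
have -> : t = (n%:R ^+ 2 / 4) ^+ m * (n%:R ^+ 2 / 4).
  by rewrite /t -mul2n exprM -exprSr; congr (_ ^+ _); field.
rewrite [RHS]mulrACA -exprMn.
have -> : n%:R ^+ 2 / 4 * (9 / 31) = 9 / 124 * n%:R ^+ 2 :> R by field.
by congr (_ * _); move: (\tr E) => e; field; rewrite gt_eqF.
Qed.
End MatrixMoments.

(** * Reproducing kernel Hilbert spaces and approximation numbers *)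

Section ScalarTheory.
Context (R : realType) (s : scalar_kind).
Local Notation K := (scalar_of R s).
Implicit Types x y z : K.

Lemma scalar_eqP x y : sRe x = sRe y -> sIm x = sIm y -> x = y.
Proof. by case: s x y => //= -[a b] [c e] /= -> ->. Qed.

Lemma sReD x y : sRe (x + y) = sRe x + sRe y.
Proof. by case: s x y => //= -[a b] [c e]. Qed.

Lemma sImD x y : sIm (x + y) = sIm x + sIm y.
Proof. by case: s x y => [|[a b] [c e]] //=; rewrite addr0. Qed.

Lemma sReN x : sRe (- x) = - sRe x.
Proof. by case: s x => //= -[a b]. Qed.

Lemma sImN x : sIm (- x) = - sIm x.
Proof. by case: s x => [|[a b]] //=; rewrite oppr0. Qed.

Lemma sRe0 : @sRe R s 0 = 0. Proof. by case: s. Qed.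
Lemma sIm0 : @sIm R s 0 = 0. Proof. by case: s. Qed.

Lemma sReB x y : sRe (x - y) = sRe x - sRe y.
Proof. by rewrite sReD sReN. Qed.

Lemma sRe_sum I (r : seq I) (P : pred I) (F : I -> K) :
  sRe (\sum_(i <- r | P i) F i) = \sum_(i <- r | P i) sRe (F i).
Proof. exact: (big_morph _ sReD sRe0). Qed.

Lemma sIm_sum I (r : seq I) (P : pred I) (F : I -> K) :
  sIm (\sum_(i <- r | P i) F i) = \sum_(i <- r | P i) sIm (F i).
Proof. exact: (big_morph _ sImD sIm0). Qed.

Lemma sReM x y : sRe (x * y) = sRe x * sRe y - sIm x * sIm y.
Proof. by case: s x y => [x y|[a b] [c e]] //=; rewrite mulr0 subr0. Qed.

Lemma sImM x y : sIm (x * y) = sRe x * sIm y + sIm x * sRe y.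
Proof. by case: s x y => [x y|[a b] [c e]] //=; rewrite mulr0 mul0r addr0. Qed.

Lemma sRe_conj x : sRe (sconj x) = sRe x.
Proof. by case: s x => [|[a b]]. Qed.

Lemma sIm_conj x : sIm (sconj x) = - sIm x.
Proof. by case: s x => [|[a b]] //=; rewrite oppr0. Qed.

Lemma sconjK x : sconj (sconj x) = x.
Proof. by apply: scalar_eqP; rewrite ?sRe_conj ?sIm_conj ?opprK. Qed.

Lemma sRe_sMk (a c : R) : sRe (sMk s a c) = a. Proof. by case: s. Qed.

Definition of_real (a : R) : K := sMk s a 0.

Lemma sRe_of_real a : sRe (of_real a) = a. Proof. exact: sRe_sMk. Qed.
Lemma sIm_of_real a : sIm (of_real a) = 0. Proof. by rewrite /of_real; case: s. Qed.

Lemma of_real1 : of_real 1 = 1. Proof. by rewrite /of_real; case: s. Qed.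

Lemma sle x y : (x <= y) = (sIm y == sIm x) && (sRe x <= sRe y).
Proof. by case: s x y => [x y|[a b] [c e]] //=; rewrite eqxx. Qed.

Lemma sabs_ge0 x : 0 <= sabs x.
Proof. by have := normr_ge0 x; rewrite sle sRe0 => /andP[]. Qed.

Lemma normE x : `|x| = of_real (sabs x).
Proof.
apply: scalar_eqP; first by rewrite sRe_of_real.
by have := normr_ge0 x; rewrite sle sIm0 sIm_of_real => /andP[/eqP].
Qed.

Lemma sabs_sqr x : sabs x ^+ 2 = sRe x ^+ 2 + sIm x ^+ 2.
Proof.
rewrite /sabs; case: s x => [x|[a b]] /=; first by rewrite expr0n addr0 real_normK ?num_real.
by rewrite sqr_sqrtr // addr_ge0 ?sqr_ge0.
Qed.

Lemma sqr_sabs_conj x y : sRe (x * sconj y) = sRe x * sRe y + sIm x * sIm y.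
Proof. by rewrite sReM sRe_conj sIm_conj mulrN opprK. Qed.

Lemma sIm_mul_conj x y : sIm (x * sconj y) = sIm x * sRe y - sRe x * sIm y.
Proof. by rewrite sImM sRe_conj sIm_conj mulrN addrC. Qed.

Lemma sabs0 : @sabs R s 0 = 0. Proof. by rewrite /sabs normr0 sRe0. Qed.

Lemma sconj0 : sconj (0 : K) = 0.
Proof. by apply: scalar_eqP; rewrite ?sRe_conj ?sIm_conj ?sIm0 ?oppr0. Qed.

Lemma sconj_of_real (a : R) : sconj (of_real a) = of_real a.
Proof. by apply: scalar_eqP; rewrite ?sRe_conj ?sIm_conj ?sIm_of_real ?oppr0. Qed.

Lemma sconjM (x y : K) : sconj (x * y) = sconj x * sconj y.
Proof. by apply: scalar_eqP; rewrite !(sReM, sImM, sRe_conj, sIm_conj, sReM, sImM); ring. Qed.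

Lemma sabs_eq0 x : sabs x = 0 -> x = 0.
Proof. by move=> x0; apply/eqP; rewrite -normr_eq0 normE x0; apply/eqP/scalar_eqP; rewrite ?sRe_of_real ?sIm_of_real ?sRe0 ?sIm0. Qed.

Lemma sabsM x y : sabs (x * y) = sabs x * sabs y.
Proof. by rewrite {1}/sabs normrM !normE sReM !sRe_of_real !sIm_of_real mulr0 subr0. Qed.

Lemma sabsN x : sabs (- x) = sabs x.
Proof. by rewrite /sabs normrN. Qed.

Lemma sabs_of_real a : sabs (of_real a) = `|a|.
Proof.
apply/eqP; rewrite -(@eqrXn2 _ 2) ?sabs_ge0 //.
by rewrite sabs_sqr sRe_of_real sIm_of_real expr0n addr0 real_normK ?num_real.
Qed.

Lemma sabs_conj x : sabs (sconj x) = sabs x.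
Proof.
apply/eqP; rewrite -(@eqrXn2 _ 2) ?sabs_ge0 //.
by rewrite !sabs_sqr sRe_conj sIm_conj sqrrN.
Qed.

Lemma sRe_mul_conj_self x : sRe (x * sconj x) = sabs x ^+ 2.
Proof. by rewrite sqr_sabs_conj sabs_sqr !expr2. Qed.

Lemma sRe_le_sabs x : `|sRe x| <= sabs x.
Proof.
rewrite -(@ler_pXn2r _ 2) ?nnegrE ?sabs_ge0 // sabs_sqr real_normK ?num_real //.
by rewrite lerDl sqr_ge0.
Qed.

Lemma sIm_le_sabs x : `|sIm x| <= sabs x.
Proof.
rewrite -(@ler_pXn2r _ 2) ?nnegrE ?sabs_ge0 // sabs_sqr real_normK ?num_real //.
by rewrite lerDr sqr_ge0.
Qed.

Lemma sRe_ge0 x : 0 <= x -> 0 <= sRe x.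
Proof. by rewrite sle sRe0 => /andP[]. Qed.

Lemma sIm_ge0 x : 0 <= x -> sIm x = 0.
Proof. by rewrite sle sIm0 => /andP[/eqP]. Qed.
End ScalarTheory.

Section L2Theory.
Context (R : realType) (s : scalar_kind) d (D : measurableType d)
  (mu : {measure set D -> \bar R}).
Implicit Types f g : D -> scalar_of R s.

Lemma L2norm_ge0 f : (0 <= L2norm mu f)%E.
Proof. exact: Lnorm_ge0. Qed.

Lemma L2norm_sqr f : (L2norm mu f ^+ 2 = \int[mu]_x (sabs (f x) ^+ 2)%:E)%E.
Proof.
have -> : (L2norm mu f ^+ 2 = L2norm mu f `^ 2)%E.
  case: (L2norm mu f) (L2norm_ge0 f) => [r r0||//].
    by rewrite poweR_EFin powR_mulrn // -EFin_expe.
  by rewrite poweRyr // expe2 mulyy.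
rewrite /L2norm poweR_Lnorm //; apply: eq_integral => x _.
by rewrite abse_EFin poweR_EFin powR_mulrn ?normr_ge0 // real_normK ?num_real.
Qed.

Lemma in_L2_fin_integral f : in_L2 mu f ->
  (\int[mu]_x (sabs (f x) ^+ 2)%:E < +oo)%E.
Proof.
by case=> _ _ fin; rewrite -L2norm_sqr expe2 lte_mul_pinfty // ?L2norm_ge0 // ge0_fin_numE // L2norm_ge0.
Qed.

Lemma measurable_sabs_sqr f : in_L2 mu f -> measurable_fun setT (fun x => sabs (f x) ^+ 2).
Proof.
case=> mR mI _; under eq_fun do rewrite sabs_sqr.
by apply: measurable_funD; exact: measurable_funX.
Qed.

Lemma integrable_sabs_sqr f : in_L2 mu f -> mu.-integrable setT (fun x => (sabs (f x) ^+ 2)%:E).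
Proof.
move=> fL2; apply/integrableP; split; first exact/measurable_EFinP/measurable_sabs_sqr.
under eq_integral => x _ do rewrite abse_EFin ger0_norm ?sqr_ge0 //.
exact: in_L2_fin_integral.
Qed.

Lemma sabs_mul_le f g x : sabs (f x * sconj (g x)) <= sabs (f x) ^+ 2 + sabs (g x) ^+ 2.
Proof.
rewrite sabsM sabs_conj.
have := sqr_ge0 (sabs (f x) - sabs (g x)).
have := mulr_ge0 (sabs_ge0 (f x)) (sabs_ge0 (g x)); nra.
Qed.

Lemma integrable_sRe_mul f g : in_L2 mu f -> in_L2 mu g ->
  mu.-integrable setT (EFin \o (fun x => sRe (f x * sconj (g x)))).
Proof.
move=> fL2 gL2; have [mfR mfI _] := fL2; have [mgR mgI _] := gL2.
apply: (le_integrable measurableT _ _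
  (integrableD measurableT (integrable_sabs_sqr fL2) (integrable_sabs_sqr gL2))).
  apply/measurable_EFinP; under eq_fun do rewrite sqr_sabs_conj.
  by apply: measurable_funD; exact: measurable_funM.
move=> x _ /=; rewrite lee_fin (le_trans (sRe_le_sabs _)) // (le_trans (sabs_mul_le _ _ _)) //.
exact: ler_norm.
Qed.

Lemma integrable_sIm_mul f g : in_L2 mu f -> in_L2 mu g ->
  mu.-integrable setT (EFin \o (fun x => sIm (f x * sconj (g x)))).
Proof.
move=> fL2 gL2; have [mfR mfI _] := fL2; have [mgR mgI _] := gL2.
apply: (le_integrable measurableT _ _
  (integrableD measurableT (integrable_sabs_sqr fL2) (integrable_sabs_sqr gL2))).
  apply/measurable_EFinP; under eq_fun do rewrite sIm_mul_conj.
  by apply: measurable_funB; exact: measurable_funM.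
move=> x _ /=; rewrite lee_fin (le_trans (sIm_le_sabs _)) // (le_trans (sabs_mul_le _ _ _)) //.
exact: ler_norm.
Qed.

Lemma sRe_L2dot f g : sRe (L2dot mu f g) = \int[mu]_x sRe (f x * sconj (g x)).
Proof. exact: sRe_sMk. Qed.

Lemma sIm_L2dot f g : sIm (L2dot mu f g) = \int[mu]_x sIm (f x * sconj (g x)).
Proof.
rewrite /L2dot; case: s f g => f g //=.
by rewrite Rintegral_cst // mul0r.
Qed.

Lemma L2dot_conj f g : in_L2 mu f -> in_L2 mu g -> L2dot mu g f = sconj (L2dot mu f g).
Proof.
move=> fL2 gL2; apply: scalar_eqP; rewrite ?sRe_conj ?sIm_conj ?sRe_L2dot ?sIm_L2dot.
  by apply: eq_Rintegral => x _; rewrite !sqr_sabs_conj mulrC [sIm _ * _]mulrC.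
rewrite -mulN1r -RintegralZl //; last exact: integrable_sIm_mul.
by apply: eq_Rintegral => x _; rewrite !sIm_mul_conj mulN1r opprB mulrC [sRe (g x) * _]mulrC.
Qed.

Lemma L2norm_L2dot f : in_L2 mu f -> (L2norm mu f ^+ 2 = (sRe (L2dot mu f f))%:E)%E.
Proof.
move=> fL2; rewrite L2norm_sqr sRe_L2dot /Rintegral fineK.
  by apply: eq_integral => x _; rewrite sRe_mul_conj_self.
apply: integrable_fin_num => //; exact: integrable_sRe_mul.
Qed.
End L2Theory.

(** * Norm, inner product and point evaluations of the Hilbert space *)

Section HilbertNorm.
Context (R : realType) (s : scalar_kind) (D : Type) (H : rkhs R s D).
Local Notation K := (scalar_of R s).
Implicit Types (f g h : H) (a c : K).

Lemma dotDl f g h : rk_dot H (f + g) h = rk_dot H f h + rk_dot H g h.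
Proof. exact: linearDl. Qed.

Lemma dotDr f g h : rk_dot H f (g + h) = rk_dot H f g + rk_dot H f h.
Proof. exact: linearDr. Qed.

Lemma dotZl a f g : rk_dot H (a *: f) g = a * rk_dot H f g.
Proof. exact: linearZl_LR. Qed.

Lemma dotZr a f g : rk_dot H f (a *: g) = sconj a * rk_dot H f g.
Proof. exact: linearZr_LR. Qed.

Lemma dot_conj f g : rk_dot H g f = sconj (rk_dot H f g).
Proof. by rewrite [LHS]hermitian_subproof expr0 mul1r. Qed.

Lemma dot0l f : rk_dot H 0 f = 0.
Proof. exact: linear0l. Qed.

Lemma dot_suml I (r : seq I) (P : pred I) (F : I -> H) g :
  rk_dot H (\sum_(i <- r | P i) F i) g = \sum_(i <- r | P i) rk_dot H (F i) g.
Proof. by apply: (big_morph (fun f => rk_dot H f g)) => [a c|]; [exact: dotDl|exact: dot0l]. Qed.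

Lemma dot_sumr I (r : seq I) (P : pred I) (F : I -> H) g :
  rk_dot H g (\sum_(i <- r | P i) F i) = \sum_(i <- r | P i) rk_dot H g (F i).
Proof. exact: linear_sumr. Qed.

Lemma dotNl f g : rk_dot H (- f) g = - rk_dot H f g.
Proof. exact: linearNl. Qed.

Lemma dotNr f g : rk_dot H f (- g) = - rk_dot H f g.
Proof. exact: linearNr. Qed.

Definition nrm f : R := sRe `|f|.

Lemma norm_nrm f : `|f| = of_real s (nrm f).
Proof. by apply: scalar_eqP; rewrite ?sRe_of_real // sIm_of_real sIm_ge0. Qed.

Lemma nrm_ge0 f : 0 <= nrm f.
Proof. exact: sRe_ge0. Qed.

Lemma nrm_sqr f : nrm f ^+ 2 = sRe (rk_dot H f f).
Proof.
by rewrite -rk_norm norm_nrm expr2 sReM !sRe_of_real sIm_of_real mulr0 subr0.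
Qed.

Lemma dot_self f : rk_dot H f f = of_real s (nrm f ^+ 2).
Proof.
rewrite -rk_norm norm_nrm; apply: scalar_eqP; rewrite !expr2.
  by rewrite sReM !sRe_of_real sIm_of_real mulr0 subr0.
by rewrite sImM !sIm_of_real mulr0 mul0r addr0.
Qed.

Lemma le_of_real (x y : R) : (of_real s x <= of_real s y) = (x <= y).
Proof. by rewrite sle !sIm_of_real eqxx !sRe_of_real. Qed.

Lemma lt_of_real (x y : R) : (of_real s x < of_real s y) = (x < y).
Proof.
rewrite !lt_def le_of_real; congr (_ && _); congr (~~ _).
by apply/eqP/eqP => [/(congr1 (@sRe R s))|->//]; rewrite !sRe_of_real.
Qed.

Lemma gt0_of_real (e : K) : 0 < e -> e = of_real s (sRe e) /\ 0 < sRe e.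
Proof.
move=> e0; have eE : e = of_real s (sRe e).
  by apply: scalar_eqP; rewrite ?sRe_of_real // sIm_of_real sIm_ge0 ?ltW.
split=> //; move: e0; rewrite eE -{1}(_ : of_real s 0 = 0) ?lt_of_real ?sRe_of_real //.
by apply: scalar_eqP; rewrite ?sRe_of_real ?sIm_of_real ?sRe0 ?sIm0.
Qed.

Lemma norm_le1 f : (`|f| <= 1) = (nrm f <= 1).
Proof. by rewrite norm_nrm -(of_real1 R s) le_of_real. Qed.

Lemma nrmD f g : nrm (f + g) <= nrm f + nrm g.
Proof.
rewrite -le_of_real -norm_nrm (le_trans (ler_normD _ _)) // !norm_nrm.
rewrite le_eqVlt; apply/orP; left; apply/eqP; apply: scalar_eqP.
  by rewrite sReD !sRe_of_real.
by rewrite sImD !sIm_of_real addr0.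
Qed.

Lemma nrmN f : nrm (- f) = nrm f. Proof. by rewrite /nrm normrN. Qed.

Lemma nrmZ a f : nrm (a *: f) = sabs a * nrm f.
Proof.
by rewrite {1}/nrm normrZ normE norm_nrm sReM !sRe_of_real sIm_of_real mul0r subr0.
Qed.

Lemma nrm_eq0 f : nrm f = 0 -> f = 0.
Proof.
move=> f0; apply/eqP; rewrite -normr_eq0 norm_nrm f0; apply/eqP.
by apply: scalar_eqP; rewrite ?sRe_of_real ?sIm_of_real ?sRe0 ?sIm0.
Qed.

Lemma rk_funB f g x : rk_fun H (f - g) x = rk_fun H f x - rk_fun H g x.
Proof. by rewrite linearB. Qed.

Lemma rk_funZ a f x : rk_fun H (a *: f) x = a * rk_fun H f x.
Proof. by rewrite linearZ. Qed.

Lemma rk_fun_sum I (r : seq I) (P : pred I) (F : I -> H) x :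
  rk_fun H (\sum_(i <- r | P i) F i) x = \sum_(i <- r | P i) rk_fun H (F i) x.
Proof. by rewrite linear_sum fct_sumE. Qed.

Lemma eval_bounded x : exists2 C, 0 <= C & forall f, sabs (rk_fun H f x) <= C * nrm f.
Proof.
have := @rk_eval_continuous _ _ _ H x 0.
move=> /cvgrPdist_lt /(_ 1 ltr01) /nbhs_normP [e /= e0 He].
have [eE re0] := gt0_of_real e0; set r := sRe e in eE re0.
exists (2 / r) => [|f]; first by rewrite divr_ge0 // ltW.
have [f0|f0] := eqVneq (nrm f) 0.
  by rewrite (nrm_eq0 f0) linear0 sabs0 mulr_ge0 ?divr_ge0 ?nrm_ge0 // ltW.
have fgt0 : 0 < nrm f by rewrite lt_def f0 nrm_ge0.
(* Scales [f] to norm [r / 2], strictly inside the ball on which the evaluation stays below 1. *)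
pose t := r / (2 * nrm f).
have t0 : 0 < t by rewrite divr_gt0 ?mulr_gt0.
have /= := He (of_real s t *: f).
rewrite /ball_ /= sub0r normrN norm_nrm {1}eE lt_of_real nrmZ sabs_of_real.
rewrite (gtr0_norm t0) => /(_ _).
have -> : t * nrm f = r / 2 by rewrite /t; field.
have r2 : r / 2 < r by rewrite ltr_pdivrMr // mulr_natr mulr2n ltrDl.
move=> /(_ r2); rewrite linear0 sub0r normrN normE -(of_real1 R s) lt_of_real.
rewrite rk_funZ sabsM sabs_of_real (gtr0_norm t0) mulrC -ltr_pdivlMr // div1r => /ltW.
by rewrite /t invf_div mulrAC.
Qed.

Lemma lipschitz_continuous (L : {linear H -> K^o}) C : 0 < C ->
  (forall f, sabs (L f) <= C * nrm f) -> continuous L.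
Proof.
move=> C0 LC f; apply/cvgrPdist_lt => e e0.
have [eE re0] := gt0_of_real e0.
apply/nbhs_normP; exists (of_real s (sRe e / C)) => /=.
  rewrite -(_ : of_real s 0 = 0) ?lt_of_real ?divr_gt0 //.
  by apply: scalar_eqP; rewrite ?sRe_of_real ?sIm_of_real ?sRe0 ?sIm0.
move=> g /=; rewrite /ball_ /= norm_nrm lt_of_real ltr_pdivlMr // mulrC => fg.
by rewrite -linearB normE eE lt_of_real (le_lt_trans (LC _)).
Qed.

Lemma dot_CS f g : sabs (rk_dot H f g) <= nrm f * nrm g.
Proof.
have [g0|g0] := eqVneq (nrm g) 0.
  by rewrite dot_conj sabs_conj (nrm_eq0 g0) dot0l sabs0 mulr_ge0 // nrm_ge0.
have ggt0 : 0 < nrm g by rewrite lt_def g0 nrm_ge0.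
have c0 := exprn_gt0 2 ggt0.
set c := nrm g ^+ 2 in c0; set z := rk_dot H f g.
have := nrm_ge0 (f - (of_real s c^-1 * z) *: g).
move=> /(ler_wpM2r (nrm_ge0 (f - (of_real s c^-1 * z) *: g))).
rewrite mul0r -expr2 nrm_sqr dotDl dotNl !dotDr !dotNr dotZl !dotZr dotZl (dot_conj f g).
rewrite !dot_self -/z -/c !(sReD, sReN) sRe_of_real.
have E1 : sRe (sconj (of_real s c^-1 * z) * z) = c^-1 * sabs z ^+ 2.
  rewrite sReM sRe_conj sIm_conj sReM sImM sRe_of_real sIm_of_real sabs_sqr; ring.
have E2 : sRe (of_real s c^-1 * z * sconj z) = c^-1 * sabs z ^+ 2.
  rewrite -mulrA sReM sRe_of_real sIm_of_real sRe_mul_conj_self; ring.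
have E3 : sRe (sconj (of_real s c^-1 * z) * (of_real s c^-1 * z * of_real s c)) = c^-1 * sabs z ^+ 2.
  rewrite !(sReM, sImM) !sRe_conj !sIm_conj !(sReM, sImM) !sRe_of_real !sIm_of_real sabs_sqr.
  by field; rewrite gt_eqF.
rewrite E1 E2 E3 subrr subr0 subr_ge0 ler_pdivrMl // mulrC => h.
rewrite -(@ler_pXn2r _ 2) ?nnegrE ?sabs_ge0 ?mulr_ge0 ?nrm_ge0 //.
by rewrite exprMn.
Qed.
End HilbertNorm.

(** * The eigenbasis in [H] and in [L2] *)

Section Eigenbasis.
Context (R : realType) (s : scalar_kind) d (D : measurableType d)
  (mu : {measure set D -> \bar R}) (H : rkhs R s D) (hH : embedded_in_L2 mu H)
  (idstar : (D -> scalar_of R s) -> H) (hidstar : embedding_adjoint mu idstar)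
  (b : nat -> H) (hb : eigenbasis mu (fun f => idstar (rk_fun H f)) b).
Local Notation K := (scalar_of R s).
Implicit Types (f g h : H) (c : nat -> K).

Definition l2 f g := L2dot mu (rk_fun H f) (rk_fun H g).
Definition l2sq f : R := sRe (l2 f f).
Definition beta j : R := nrm (b j).
(** This is the approximation number [a_j], as [approx_numberE] shows. *)
Definition inv_nrm j : R := (beta j)^-1.
Definition comb N c : H := \sum_(j < N) c j *: b j.

Lemma l2E f g : l2 f g = rk_dot H (idstar (rk_fun H f)) g.
Proof. by rewrite hidstar //; case: hH. Qed.

Lemma in_L2_rk f : in_L2 mu (rk_fun H f). Proof. by case: hH. Qed.

Lemma l2_conj f g : l2 g f = sconj (l2 f g).
Proof. by apply: L2dot_conj; exact: in_L2_rk. Qed.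

Lemma L2norm_rk f : (L2norm mu (rk_fun H f) ^+ 2 = (l2sq f)%:E)%E.
Proof. exact/L2norm_L2dot/in_L2_rk. Qed.

Lemma l2sq_ge0 f : 0 <= l2sq f.
Proof. by rewrite -lee_fin -L2norm_rk expe_ge0 // L2norm_ge0. Qed.

Lemma l2_self f : l2 f f = of_real s (l2sq f).
Proof.
apply: scalar_eqP; first by rewrite sRe_of_real.
have /(congr1 (@sIm R s)) := l2_conj f f.
rewrite sIm_conj sIm_of_real => /eqP; rewrite -addr_eq0 -mulr2n mulrn_eq0 /=.
by move/eqP.
Qed.

Lemma l2Zr a f g : l2 f (a *: g) = sconj a * l2 f g.
Proof. by rewrite !l2E dotZr. Qed.

Lemma l2_sumr I (r : seq I) (P : pred I) (F : I -> H) g :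
  l2 g (\sum_(i <- r | P i) F i) = \sum_(i <- r | P i) l2 g (F i).
Proof. by rewrite l2E dot_sumr; apply: eq_bigr => i _; rewrite l2E. Qed.

Lemma l2sq_sub_orth f g : l2 g f = 0 -> l2sq (f - g) = l2sq f + l2sq g.
Proof.
move=> gf; have fg : l2 f g = 0 by rewrite l2_conj gf sconj0.
have l2Br f1 f2 h : l2 h (f1 - f2) = l2 h f1 - l2 h f2 by rewrite !l2E dotDr dotNr.
rewrite /l2sq l2Br sReB (l2_conj f) (l2_conj g) !sRe_conj !l2Br !sReB gf fg sRe0.
by rewrite subr0 sub0r opprK.
Qed.

Lemma l2sq_b j : l2sq (b j) = 1.
Proof. by apply: EFin_inj; rewrite -L2norm_rk (eb_normalized hb) expe2 mule1. Qed.

Lemma beta_gt0 j : 0 < beta j.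
Proof.
rewrite lt_def nrm_ge0 andbT; apply/eqP => /nrm_eq0 bj0.
have := l2sq_b j; rewrite /l2sq l2E bj0 -{2}(scale0r (0 : H)) dotZr sReM sRe_conj sIm_conj.
by rewrite sRe0 sIm0 mul0r oppr0 mul0r subr0 => /eqP; rewrite eq_sym oner_eq0.
Qed.

Lemma inv_nrm_gt0 j : 0 < inv_nrm j.
Proof. by rewrite invr_gt0 beta_gt0. Qed.

Lemma beta_le i j : (i <= j)%N -> beta i <= beta j.
Proof. by move=> /(eb_ordered hb); rewrite !norm_nrm le_of_real. Qed.

Lemma inv_nrm_le i j : (i <= j)%N -> inv_nrm j <= inv_nrm i.
Proof. by move=> ij; rewrite lef_pV2 ?posrE ?beta_gt0 // beta_le. Qed.

(** Testing the eigenvector equation against [b j], whose [L2] norm is 1, identifies the eigenvalue.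
    Pairing with [b j] in [L2] is then a multiple of pairing in [H], which carries orthogonality
    over to [L2]. *)
Lemma l2_b j g : l2 (b j) g = of_real s (inv_nrm j ^+ 2) * rk_dot H (b j) g.
Proof.
have [lam lamE] := eb_eigen hb j.
have l2lam h : l2 (b j) h = lam * rk_dot H (b j) h by rewrite l2E lamE dotZl.
rewrite l2lam; congr (_ * _).
have := l2lam (b j); rewrite l2_self l2sq_b dot_self -/(beta j) => E.
have beta0 := beta_gt0 j.
have ReE := congr1 (@sRe R s) E; have ImE := congr1 (@sIm R s) E.
move: ReE ImE; rewrite sReM sImM !sRe_of_real !sIm_of_real !mulr0 subr0 add0r => ReE ImE.
have b2 : beta j ^+ 2 != 0 by rewrite sqrf_eq0 gt_eqF.
apply: scalar_eqP; rewrite ?sRe_of_real ?sIm_of_real.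
  by rewrite /inv_nrm exprVn; apply: (mulIf b2); rewrite -ReE mulVf.
by apply: (mulIf b2); rewrite mul0r -ImE.
Qed.

Lemma dot_bb i j : rk_dot H (b i) (b j) = if i == j then of_real s (beta i ^+ 2) else 0.
Proof.
by case: eqP => [->|/eqP ij]; [exact: dot_self|exact: eb_orthogonal hb _ _ ij].
Qed.

Lemma l2_bb i j : l2 (b i) (b j) = if i == j then 1 else 0.
Proof.
case: eqP => [->|/eqP ij]; first by rewrite l2_self l2sq_b of_real1.
by rewrite l2_b dot_bb (negbTE ij) mulr0.
Qed.

Lemma dot_b_comb j N c : rk_dot H (b j) (comb N c) =
  if (j < N)%N then sconj (c j) * of_real s (beta j ^+ 2) else 0.
Proof.
rewrite dot_sumr; case: ltnP => jN.
  rewrite (bigD1 (Ordinal jN)) //= dotZr dot_bb eqxx big1 ?addr0 // => i ij.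
  rewrite dotZr dot_bb ifN ?mulr0 //; apply: contra ij => /eqP ji; exact/eqP/val_inj.
rewrite big1 // => i _; rewrite dotZr dot_bb ifN ?mulr0 //.
by apply: contraTneq jN => ->; rewrite -ltnNge.
Qed.

Lemma nrm_comb N c : nrm (comb N c) ^+ 2 = \sum_(j < N) sabs (c j) ^+ 2 * beta j ^+ 2.
Proof.
rewrite nrm_sqr {1}/comb dot_suml sRe_sum; apply: eq_bigr => j _.
rewrite dotZl dot_b_comb ltn_ord mulrA sReM sRe_of_real sIm_of_real mulr0 subr0.
by rewrite sRe_mul_conj_self.
Qed.

Lemma l2_b_comb j N c : l2 (b j) (comb N c) = if (j < N)%N then sconj (c j) else 0.
Proof.
rewrite l2_b dot_b_comb; case: ifP => _; rewrite ?mulr0 // mulrCA.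
rewrite (_ : of_real s _ * _ = 1) ?mulr1 //.
apply: scalar_eqP; rewrite -(of_real1 R s) ?(sReM, sImM) !sRe_of_real !sIm_of_real.
  by rewrite mulr0 subr0 /inv_nrm exprVn mulVf // sqrf_eq0 gt_eqF ?beta_gt0.
by rewrite mulr0 mul0r addr0.
Qed.

Lemma l2sq_comb N c : l2sq (comb N c) = \sum_(j < N) sabs (c j) ^+ 2.
Proof.
rewrite /l2sq {2}/comb l2_sumr sRe_sum; apply: eq_bigr => j _.
rewrite l2Zr l2_conj l2_b_comb ltn_ord sconjK mulrC sRe_mul_conj_self //.
Qed.

Lemma comb_widen M N c : (M <= N)%N -> (forall j, (M <= j)%N -> c j = 0) -> comb N c = comb M c.
Proof.
move=> MN c0; rewrite /comb -!(big_mkord xpredT (fun j => c j *: b j)) (big_cat_nat (leq0n M) MN) //=.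
rewrite [X in _ + X](_ : _ = 0) ?addr0 // big_nat_cond big1 // => j /andP[/andP[Mj _] _].
by rewrite c0 // scale0r.
Qed.

Lemma first_spanP k f : first_span b k f <->
  exists c, (forall j, (k <= j)%N -> c j = 0) /\ f = comb k c.
Proof.
split=> [[c fE]|[c [_ fE]]]; last by exists (fun i => c i).
exists (fun j => if insub j is Some i then c i else 0); split.
  by move=> j kj; rewrite insubF // ltnNge kj.
by rewrite fE; apply: eq_bigr => i _; rewrite valK.
Qed.

Lemma comb_dense f (e : R) M : 0 < e -> exists N c, (M <= N)%N /\ nrm (f - comb N c) < e.
Proof.
move=> e0; have : closure (\bigcup_k first_span b k) f by rewrite (eb_total hb).
have e0' : 0 < of_real s e.
  rewrite -(_ : of_real s 0 = 0) ?lt_of_real //.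
  by apply: scalar_eqP; rewrite ?sRe_of_real ?sIm_of_real ?sRe0 ?sIm0.
move=> /(_ _ (nbhsx_ballx f _ e0')) [g [[k _ /first_spanP[c [c0 gE]]]]].
rewrite -ball_normE /ball_ /= norm_nrm lt_of_real => fg.
exists (maxn k M), c; split; first exact: leq_maxr.
by rewrite (@comb_widen k) ?leq_maxl // -gE.
Qed.

Definition proj k f : H := comb k (fun j => rk_dot H f (b j) * of_real s (inv_nrm j ^+ 2)).

Lemma inv_nrm_beta j : inv_nrm j ^+ 2 * beta j ^+ 2 = 1.
Proof. by rewrite /inv_nrm exprVn mulVf // sqrf_eq0 gt_eqF ?beta_gt0. Qed.

Lemma of_real_anum_beta j : of_real s (inv_nrm j ^+ 2) * of_real s (beta j ^+ 2) = 1.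
Proof.
apply: scalar_eqP; rewrite -(of_real1 R s) ?(sReM, sImM) !sRe_of_real !sIm_of_real.
  by rewrite mulr0 subr0 inv_nrm_beta.
by rewrite mulr0 mul0r addr0.
Qed.

Lemma proj_orth j k f : (j < k)%N -> rk_dot H (b j) (f - proj k f) = 0.
Proof.
move=> jk; rewrite dotDr dotNr dot_b_comb jk sconjM sconj_of_real -mulrA of_real_anum_beta.
by rewrite mulr1 -dot_conj subrr.
Qed.

Definition tail k h := forall j, (j < k)%N -> rk_dot H (b j) h = 0.

Lemma nrm_sqrB_orth f g : rk_dot H g f = 0 -> nrm (f - g) ^+ 2 = nrm f ^+ 2 + nrm g ^+ 2.
Proof.
move=> gf; rewrite !nrm_sqr dotDl dotNl !dotDr !dotNr gf (dot_conj g f) gf.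
rewrite !(sReD, sReN) sRe_conj sRe0; ring.
Qed.

Lemma nrm_tail_le k f : nrm (f - proj k f) <= nrm f.
Proof.
rewrite -(@ler_pXn2r _ 2) ?nnegrE ?nrm_ge0 //.
have : rk_dot H (- proj k f) (f - proj k f) = 0.
  by rewrite dotNl dot_suml big1 ?oppr0 // => j _; rewrite dotZl proj_orth ?mulr0.
by move=> /nrm_sqrB_orth; rewrite opprK subrK => ->; rewrite lerDl sqr_ge0.
Qed.

(** Deleting the head coefficients of a nearby finite combination brings it no farther from [h],
    because the head is orthogonal to [h] and to the rest of the combination. *)
Lemma tail_approx k h (e : R) M : tail k h -> 0 < e ->
  exists N c, [/\ (M <= N)%N, forall j, (j < k)%N -> c j = 0 & nrm (h - comb N c) < e].
Proof.
move=> th e0; have [N [c [MN hc]]] := comb_dense h (maxn M k) e0.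
pose c' j := if (j < k)%N then 0 else c j.
exists N, c'; split; first exact: leq_trans (leq_maxl _ _) MN.
  by move=> j jk; rewrite /c' jk.
apply: le_lt_trans hc; rewrite -(@ler_pXn2r _ 2) ?nnegrE ?nrm_ge0 //.
pose c0 j := if (j < k)%N then c j else 0.
have cE : comb N c = comb N c' + comb N c0.
  rewrite /comb -big_split /=; apply: eq_bigr => j _.
  by rewrite -scalerDl /c' /c0; case: ifP; rewrite ?addr0 ?add0r.
rewrite cE opprD addrA [leRHS]nrm_sqrB_orth ?lerDl ?sqr_ge0 //.
rewrite {1}/comb dot_suml big1 // => j _; rewrite dotZl /c0; case: ifPn => [jk|_]; last by rewrite mul0r.
by rewrite dotDr dotNr th // dot_b_comb ltn_ord /c' jk sconj0 mul0r subrr mulr0.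
Qed.

Lemma l2sq_tail_comb k N c : (forall j, (j < k)%N -> c j = 0) ->
  l2sq (comb N c) <= inv_nrm k ^+ 2 * nrm (comb N c) ^+ 2.
Proof.
move=> c0; rewrite l2sq_comb nrm_comb mulr_sumr; apply: ler_sum => j _.
case: (ltnP j k) => jk; first by rewrite c0 // sabs0 expr0n /= !mul0r mulr0.
rewrite mulrCA -[leLHS]mulr1 ler_wpM2l ?sqr_ge0 // -(inv_nrm_beta k) ler_wpM2l ?sqr_ge0 //.
by rewrite ler_pXn2r ?nnegrE ?nrm_ge0 // beta_le.
Qed.

(** For finite combinations the bound holds coefficient by coefficient. Convergence in [H] gives
    pointwise convergence, evaluations being bounded, and Fatou's lemma carries the bound to [h]
    without prior knowledge that the embedding is continuous. *)
Lemma l2sq_tail_le k h : tail k h -> l2sq h <= inv_nrm k ^+ 2 * nrm h ^+ 2.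
Proof.
move=> th; pose e (m : nat) : R := m.+1%:R^-1.
have e0 m : 0 < e m by rewrite invr_gt0.
have /choice[u uP] : forall m, exists u : H,
    nrm (h - u) < e m /\ l2sq u <= inv_nrm k ^+ 2 * (nrm h + e m) ^+ 2.
  move=> m; have [N [c [_ c0 hc]]] := tail_approx 0 th (e0 m).
  exists (comb N c); split => //; apply: le_trans (l2sq_tail_comb _ c0) _.
  rewrite ler_wpM2l ?sqr_ge0 // ler_pXn2r ?nnegrE ?addr_ge0 ?nrm_ge0 ?(ltW (e0 m)) //.
  have := nrmD h (- (h - comb N c)); rewrite nrmN opprB addrCA subrr addr0.
  by move=> /le_trans; apply; rewrite lerD2l ltW.
have ucvg x : (sabs (rk_fun H (u m) x))%:E @[m --> \oo] --> (sabs (rk_fun H h x))%:E.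
  have [C C0 hC] := eval_bounded H x.
  apply/fine_cvgP; split; first by near=> m.
  apply/cvgrPdist_le => eps eps0.
  have : \forall m \near \oo, C * e m <= eps.
    have : C * e m @[m --> \oo] --> C * 0.
      by apply: cvgM; [exact: cvg_cst|exact: cvg_harmonic].
    rewrite mulr0 => /cvgrPdist_le /(_ _ eps0); apply: filterS => m.
    by rewrite sub0r normrN ger0_norm // mulr_ge0 // ltW.
  apply: filterS => m; apply: le_trans => /=.
  have : sabs (rk_fun H (h - u m) x) <= C * e m.
    by apply: le_trans (hC _) _; rewrite ler_wpM2l // ltW //; case: (uP m).
  apply: le_trans; rewrite rk_funB.
  have tri (z w : K) : sabs z <= sabs w + sabs (z - w).
    rewrite -(le_of_real s) -normE -{1}(subrKC w z) (le_trans (ler_normD _ _)) // !normE.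
    rewrite le_eqVlt; apply/orP; left; apply/eqP; apply: scalar_eqP.
      by rewrite sReD !sRe_of_real.
    by rewrite sImD !sIm_of_real addr0.
  rewrite ler_distlC; apply/andP; split.
    have := tri (rk_fun H h x) (rk_fun H (u m) x); lra.
  have := tri (rk_fun H (u m) x) (rk_fun H h x); rewrite -[sabs (_ - _)]sabsN opprB; lra.
have ucvg2 x : (sabs (rk_fun H (u m) x) ^+ 2)%:E @[m --> \oo] --> (sabs (rk_fun H h x) ^+ 2)%:E.
  apply/fine_cvgP; split; first by near=> m.
  have /fine_cvgP[_ cx] := ucvg x.
  by rewrite !expr2; apply: cvgM.
have mf m : measurable_fun setT (fun x => (sabs (rk_fun H (u m) x) ^+ 2)%:E).
  exact/measurable_EFinP/measurable_sabs_sqr/in_L2_rk.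
have := @fatou _ _ _ mu setT measurableT (fun m x => (sabs (rk_fun H (u m) x) ^+ 2)%:E) mf.
have f0 m x : setT x -> (0 <= (sabs (rk_fun H (u m) x) ^+ 2)%:E)%E.
  by move=> _; rewrite lee_fin sqr_ge0.
move=> /(_ f0).
under eq_integral => x _ do rewrite (cvg_limn_einf_sup (ucvg2 x)).1.
rewrite -L2norm_sqr L2norm_rk => qle; rewrite -lee_fin; apply: le_trans qle _.
pose B m : \bar R := (inv_nrm k ^+ 2 * (nrm h + e m) ^+ 2)%:E.
have Bcvg : B m @[m --> \oo] --> (inv_nrm k ^+ 2 * nrm h ^+ 2)%:E.
  apply/fine_cvgP; split; first by near=> m.
  rewrite -[nrm h in X in _ --> X](addr0 (nrm h)).
  apply: cvgM; first exact: cvg_cst.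
  have hc : nrm h + e m @[m --> \oo] --> nrm h + 0.
    by apply: cvgD; [exact: cvg_cst|exact: cvg_harmonic].
  by rewrite !expr2; apply: cvgM.
rewrite limn_einf_lim -(cvg_lim _ Bcvg) //.
apply: lee_lim; [exact: is_cvg_einfs|by apply/cvg_ex; eexists; exact: Bcvg|].
apply: nearW => m; apply: (@le_trans _ _ (l2sq (u m))%:E).
  by apply: ereal_inf_lbound; exists m => //=; rewrite -L2norm_sqr L2norm_rk.
by rewrite lee_fin; case: (uP m).
Unshelve. all: by end_near. Qed.
End Eigenbasis.

Lemma le_of_sqre (R : realType) (x : \bar R) (r : R) :
  0 <= r -> (x ^+ 2 <= (r ^+ 2)%:E)%E -> (x <= r%:E)%E.
Proof.
move=> r0; case: x => [x| |_]; last exact: leNye.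
  rewrite -EFin_expe !lee_fin => h; apply: le_trans (ler_norm x) _.
  by rewrite -(@ler_pXn2r _ 2) ?nnegrE // real_normK ?num_real.
by rewrite expe2 mulyy.
Qed.

Lemma ge_of_sqre (R : realType) (x : \bar R) (r : R) :
  (0 <= x)%E -> ((r ^+ 2)%:E <= x ^+ 2)%E -> (r%:E <= x)%E.
Proof.
case: x => [x| |//]; last by move=> *; rewrite leey.
rewrite -EFin_expe !lee_fin => x0 h; apply: le_trans (ler_norm r) _.
by rewrite -(@ler_pXn2r _ 2) ?nnegrE // real_normK ?num_real.
Qed.

(** * Approximation numbers as inverse norms of the basis *)

Section ApproximationNumbers.
Context (R : realType) (s : scalar_kind) d (D : measurableType d)
  (mu : {measure set D -> \bar R}) (H : rkhs R s D) (hH : embedded_in_L2 mu H)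
  (idstar : (D -> scalar_of R s) -> H) (hidstar : embedding_adjoint mu idstar)
  (b : nat -> H) (hb : eigenbasis mu (fun f => idstar (rk_fun H f)) b).
Local Notation K := (scalar_of R s).
Implicit Types (f g h : H) (c : nat -> K).
Local Notation anum := (inv_nrm b).
Local Notation beta := (beta b).
Local Notation q := (l2sq mu).

Definition coordinate i f : K^o := rk_dot H f (b i) * of_real s (anum i ^+ 2).

Let coordinate_linear i : linear (coordinate i).
Proof. by move=> a f g; rewrite /coordinate dotDl dotZl mulrDl -mulrA. Qed.

Let coordinate_le i f : sabs (coordinate i f) <= (nrm (b i) * anum i ^+ 2) * nrm f.
Proof.
rewrite sabsM sabs_of_real ger0_norm ?sqr_ge0 // mulrAC ler_wpM2r ?sqr_ge0 //.
by rewrite mulrC dot_CS.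
Qed.

(** Orthogonal projection onto the first [j] basis functions is an admissible choice in the
    infimum. *)
Lemma approx_number_le j : (approx_number mu H j <= (anum j)%:E)%E.
Proof.
pose L (i : 'I_j) : {linear H -> K^o} :=
  HB.pack (coordinate i) (GRing.isLinear.Build K H K^o *:%R _ (coordinate_linear i)).
apply: (@le_trans _ _ (ereal_sup [set L2norm mu (fun x => rk_fun H f x -
    \sum_(i < j) L i f * rk_fun H (b i) x) | f in [set f : H | `|f| <= 1]])).
  apply: ereal_inf_lbound; exists L, (fun i => rk_fun H (b i)); split => // i.
    apply: (@lipschitz_continuous _ _ _ _ _ (nrm (b i) * anum i ^+ 2)).
      by rewrite mulr_gt0 ?exprn_gt0 ?(inv_nrm_gt0 hH hidstar hb) // (beta_gt0 hH hidstar hb).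
    exact: coordinate_le.
  by case: hH.
apply: ge_ereal_sup => _ [f /= f1 <-].
have -> : (fun x => rk_fun H f x - \sum_(i < j) L i f * rk_fun H (b i) x)
    = rk_fun H (f - proj b j f).
  apply/funext => x; rewrite rk_funB; congr (_ - _); rewrite rk_fun_sum.
  by apply: eq_bigr => i _; rewrite rk_funZ.
apply: le_of_sqre; first by rewrite ltW // (inv_nrm_gt0 hH hidstar hb).
rewrite (L2norm_rk hH) lee_fin.
apply: le_trans (l2sq_tail_le hH hidstar hb (fun i ij => proj_orth hH hidstar hb f ij)) _.
rewrite -[leRHS]mulr1 ler_wpM2l ?sqr_ge0 // -(expr1n _ 2) ler_pXn2r ?nnegrE ?nrm_ge0 //.
by rewrite (le_trans (nrm_tail_le hH hidstar hb _ _)) // -norm_le1.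
Qed.

(** A dimension count: any [j] functionals vanish at a common nonzero element of the span of [b 0],
    ..., [b j], and on that span the [L2] norm is at least [anum j] times the norm of [H]. *)
Lemma approx_number_ge j : ((anum j)%:E <= approx_number mu H j)%E.
Proof.
apply: le_ereal_inf_tmp => e [L [phi [_ _ ->]]].
pose A : 'M[K]_(j.+1, j) := \matrix_(i, l) L l (b i).
have kerA : kermx A != 0.
  rewrite -mxrank_eq0 mxrank_ker subn_eq0 -ltnNge ltnS; exact: rank_leq_col.
have [v /sub_kermxP vA v0] := rowV0Pn kerA.
pose c i : K := v 0 (inord i).
have cE (i : 'I_j.+1) : c i = v 0 i by rewrite /c inord_val.
pose u := comb b j.+1 c.
have Lu l : L l u = 0.
  have /matrixP/(_ 0 l) := vA; rewrite !mxE => vAl.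
  rewrite /u /comb linear_sum -[RHS]vAl.
  by apply: eq_bigr => i _; rewrite linearZ cE mxE.
have [i vi0] : exists i, v 0 i != 0.
  apply: contrapT => /forallNP vi; case/eqP: v0; apply/rowP => i; rewrite mxE.
  by apply/eqP; rewrite -[_ == _]negbK; apply/negP; exact: vi.
have u0 : 0 < nrm u ^+ 2.
  rewrite (nrm_comb hb) (bigD1 i) //= ltr_pwDl //; last first.
    by apply: sumr_ge0 => l _; rewrite mulr_ge0 // sqr_ge0.
  rewrite mulr_gt0 ?exprn_gt0 ?(beta_gt0 hH hidstar hb) // lt_def sabs_ge0 andbT cE.
  by apply: contra_neq vi0 => /sabs_eq0.
have qu : anum j ^+ 2 * nrm u ^+ 2 <= q u.
  rewrite (nrm_comb hb) (l2sq_comb hH hidstar hb) mulr_sumr; apply: ler_sum => l _.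
  rewrite mulrCA -[leRHS]mulr1 ler_wpM2l ?sqr_ge0 //.
  rewrite -(inv_nrm_beta hH hidstar hb j) ler_wpM2l ?sqr_ge0 //.
  by rewrite ler_pXn2r ?nnegrE ?nrm_ge0 // (beta_le hb) // -ltnS.
have nu0 : 0 < nrm u by rewrite lt_def nrm_ge0 andbT; move: u0; rewrite exprn_even_gt0.
pose f := of_real s (nrm u)^-1 *: u.
have f1 : nrm f = 1.
  by rewrite nrmZ sabs_of_real ger0_norm ?invr_ge0 ?nrm_ge0 // mulVf // gt_eqF.
apply: (@le_trans _ _ (L2norm mu (fun x => rk_fun H f x - \sum_(i < j) L i f * phi i x))).
  have -> : (fun x => rk_fun H f x - \sum_(i < j) L i f * phi i x) = rk_fun H f.
    apply/funext => x; rewrite big1 ?subr0 // => l _.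
    have -> : L l f = 0 by rewrite /f linearZ Lu; exact: mulr0.
    exact: mul0r.
  apply: ge_of_sqre; first exact: L2norm_ge0.
  rewrite (L2norm_rk hH) lee_fin /f.
  have -> : q (of_real s (nrm u)^-1 *: u) = (nrm u ^+ 2)^-1 * q u.
    rewrite /l2sq (l2Zr hH hidstar) (l2_conj hH) (l2Zr hH hidstar) sconj_of_real.
    rewrite (l2_self hH) sconjM !sconj_of_real mulrA sReM sReM !sRe_of_real.
    by rewrite sImM !sIm_of_real !mulr0 !subr0 -invfM -expr2.
  by rewrite mulrC ler_pdivlMr.
by apply: ereal_sup_ubound; exists f => //=; rewrite norm_le1 f1.
Qed.

Lemma approx_numberE j : approx_number mu H j = (anum j)%:E.
Proof. by apply/eqP; rewrite eq_le approx_number_le approx_number_ge. Qed.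

(** The functions [a_j b_j] are orthonormal in [H], so the sum is both the squared norm and the
    value at [x] of the truncated kernel; boundedness of the evaluation at [x] then bounds it. This
    makes the infinite sum in the density finite at every point. *)
Lemma bessel_eval x : exists C, forall N,
  \sum_(j < N) anum j ^+ 2 * sabs (rk_fun H (b j) x) ^+ 2 <= C.
Proof.
have [C C0 hC] := eval_bounded H x; exists (C ^+ 2) => N.
set S := \sum_(_ < _) _.
have S0 : 0 <= S by apply: sumr_ge0 => j _; rewrite mulr_ge0 ?sqr_ge0.
pose c j : K := of_real s (anum j ^+ 2) * sconj (rk_fun H (b j) x).
have uS : sRe (rk_fun H (comb b N c) x) = S.
  rewrite rk_fun_sum sRe_sum; apply: eq_bigr => j _.
  rewrite rk_funZ -mulrA sReM sRe_of_real sIm_of_real mul0r subr0.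
  by rewrite [sconj _ * _]mulrC sRe_mul_conj_self.
have uN : nrm (comb b N c) ^+ 2 = S.
  rewrite (nrm_comb hb); apply: eq_bigr => j _.
  rewrite sabsM sabs_conj sabs_of_real ger0_norm ?sqr_ge0 // exprMn.
  by rewrite -[in RHS](mulr1 (anum j ^+ 2)) -(inv_nrm_beta hH hidstar hb j); ring.
have SC : S <= C * nrm (comb b N c).
  by rewrite -{1}uS (le_trans (ler_norm _)) // (le_trans (sRe_le_sabs _)).
have [->|S1] := eqVneq S 0; first exact: sqr_ge0.
have Sgt0 : 0 < S by rewrite lt_def S1.
rewrite -(ler_pM2r Sgt0) -{3}uN -exprMn -expr2.
by rewrite ler_pXn2r ?nnegrE ?mulr_ge0 ?nrm_ge0.
Qed.
End ApproximationNumbers.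

(** * The sampling density and the sample matrices *)

Section SamplingDensity.
Context (R : realType) (s : scalar_kind) d (D : measurableType d)
  (mu : {measure set D -> \bar R}) (H : rkhs R s D) (hH : embedded_in_L2 mu H)
  (idstar : (D -> scalar_of R s) -> H) (hidstar : embedding_adjoint mu idstar)
  (b : nat -> H) (hb : eigenbasis mu (fun f => idstar (rk_fun H f)) b).
Context (k : nat) (k_gt0 : (0 < k)%N) (T : R)
  (TE : (\sum_(k <= j <oo) approx_number mu H j ^+ 2 = T%:E)%E).
Local Notation K := (scalar_of R s).
Local Notation anum := (inv_nrm b).
Local Notation rho := (rho mu b k).

Let aE := approx_numberE hH hidstar hb.
Let anum0 j : 0 < anum j. Proof. exact: (inv_nrm_gt0 hH hidstar hb j). Qed.

Let v j x : R := sabs (rk_fun H (b j) x) ^+ 2.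
Let v0 j x : 0 <= v j x. Proof. exact: sqr_ge0. Qed.
Let w j x : \bar R := (anum j ^+ 2 * v j x)%:E.
Let w0 j x : (0 <= w j x)%E. Proof. by rewrite lee_fin mulr_ge0 ?sqr_ge0. Qed.

Definition head_sum x : R := \sum_(j < k) v j x.
Definition tail_sum x : R := fine (\sum_(k <= j <oo) w j x)%E.

Lemma T_gt0 : 0 < T.
Proof.
rewrite -lte_fin -TE; apply: lt_le_trans (nneseries_lim_ge k.+1 _); last first.
  by move=> j _ _; rewrite aE -EFin_expe lee_fin sqr_ge0.
by rewrite big_nat1 aE -EFin_expe lte_fin exprn_gt0.
Qed.

Lemma tail_sumE x : (tail_sum x)%:E = (\sum_(k <= j <oo) w j x)%E.
Proof.
rewrite /tail_sum fineK // ge0_fin_numE; last by apply: nneseries_ge0 => j _ _.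
have [C hC] := bessel_eval hH hidstar hb x.
apply: (@le_lt_trans _ _ C%:E); last exact: ltry.
apply: lime_le; first by apply: is_cvg_nneseries => j _ _.
apply: nearW => N; rewrite sumEFin lee_fin; apply: le_trans (hC N).
rewrite -(big_mkord xpredT (fun j => anum j ^+ 2 * v j x)).
case: (leqP k N) => kN; last first.
  by rewrite [leLHS]big_geq ?(ltnW kN) //; apply: sumr_ge0 => j _; rewrite mulr_ge0 ?sqr_ge0.
rewrite [leRHS](big_cat_nat (leq0n k) kN) /= lerDr.
by apply: sumr_ge0 => j _; rewrite mulr_ge0 ?sqr_ge0.
Qed.

Lemma rhoE x : rho x = 2^-1 * (k%:R^-1 * head_sum x + T^-1 * tail_sum x).
Proof.
have kneq : (k%:R == 0 :> R) = false by rewrite pnatr_eq0 gtn_eqF.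
have Tneq : (T == 0) = false by rewrite gt_eqF ?T_gt0.
rewrite /Defs.rho TE !inver kneq Tneq.
rewrite (_ : (\sum_(k <= j <oo) approx_number mu H j ^+ 2 * (sabs (rk_fun H (b j) x) ^+ 2)%:E)%E
  = (tail_sum x)%:E); last first.
  by rewrite tail_sumE; apply: eq_eseriesr => j _; rewrite aE -EFin_expe -EFinM.
rewrite (_ : \sum_(0 <= j < k) sabs (rk_fun H (b j) x) ^+ 2 = head_sum x) //.
by rewrite big_mkord.
Qed.

Lemma tail_sum_ge x N : \sum_(k <= j < N) anum j ^+ 2 * v j x <= tail_sum x.
Proof.
rewrite -lee_fin tail_sumE -sumEFin.
by apply: (@nneseries_lim_ge _ (fun j => w j x) xpredT k N) => j _ _.
Qed.

Lemma tail_sum_ge0 x : 0 <= tail_sum x.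
Proof. by have := tail_sum_ge x 0; rewrite big_geq. Qed.

Lemma head_sum_ge0 x : 0 <= head_sum x.
Proof. exact: sumr_ge0. Qed.

Lemma rho_ge0 x : 0 <= rho x.
Proof.
rewrite rhoE mulr_ge0 // addr_ge0 // mulr_ge0 ?invr_ge0 ?head_sum_ge0 ?tail_sum_ge0 //.
exact/ltW/T_gt0.
Qed.

Let mv j : measurable_fun setT (v j).
Proof. exact: (measurable_sabs_sqr (in_L2_rk hH (b j))). Qed.

Lemma measurable_rho : measurable_fun setT rho.
Proof.
rewrite (funext rhoE).
apply: measurable_funM => //; apply: measurable_funD; apply: measurable_funM => //.
  exact: measurable_sum.
apply/measurable_EFinP; rewrite (_ : EFin \o tail_sum = fun x => \sum_(k <= j <oo) w j x)%E; last first.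
  by apply/funext => x /=; exact: tail_sumE.
apply: (@emeasurable_fun_cvg _ _ _ setT (fun N x => \sum_(k <= j < N) w j x)%E).
  move=> N; apply: emeasurable_sum => j; apply/measurable_EFinP.
  exact: measurable_funM.
by move=> x _; apply: is_cvg_nneseries => j _ _.
Qed.

(* [gam2] dominates both [a_k^2] and the average [T / k], the two quantities that
   control the tail block of the Gram matrix. *)
Definition gam2 : R := anum k ^+ 2 + T / k%:R.

Let k0 : 0 < k%:R :> R. Proof. by rewrite ltr0n. Qed.

Lemma gam2_gt0 : 0 < gam2.
Proof. by rewrite addr_gt0 ?exprn_gt0 // divr_gt0 ?T_gt0. Qed.

Definition weight2 j : R := if (j < k)%N then 1 else anum j ^+ 2 / gam2.
Definition weight j : R := Num.sqrt (weight2 j).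

Lemma weight2_gt0 j : 0 < weight2 j.
Proof. by rewrite /weight2; case: ifP => // _; rewrite divr_gt0 ?gam2_gt0 ?exprn_gt0. Qed.

Lemma weight_sqr j : weight j ^+ 2 = weight2 j.
Proof. by rewrite sqr_sqrtr // ltW ?weight2_gt0. Qed.

Lemma weight_gt0 j : 0 < weight j.
Proof. by rewrite sqrtr_gt0 weight2_gt0. Qed.

(** The summand [a_k^2] of [gam2] is there for this bound, which yields [E <= 1] for the mean
    matrix. *)
Lemma weight2_le1 j : weight2 j <= 1.
Proof.
rewrite /weight2; case: ltnP => // kj; rewrite ler_pdivrMr ?gam2_gt0 // mul1r.
apply: le_trans (_ : anum k ^+ 2 <= _).
  by rewrite ler_pXn2r ?nnegrE ?(ltW (anum0 _)) // (inv_nrm_le hH hidstar hb).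
by rewrite lerDl divr_ge0 // ltW // T_gt0.
Qed.

(** Since [gam2 >= T / k], the tail weights are at most [k a_j^2 / T]. The function [F] is general
    because two cases are used: the squared basis functions, which give [2 k rho], and [F = 1],
    which bounds the trace of the mean. *)
Lemma sum_sig2_le (F : nat -> R) S N : (k <= N)%N -> (forall j, 0 <= F j) ->
  \sum_(k <= j < N) anum j ^+ 2 * F j <= S ->
  \sum_(j < N) weight2 j * F j <= \sum_(j < k) F j + k%:R * (T^-1 * S).
Proof.
move=> kN F0 FS; rewrite -(big_mkord xpredT (fun j => weight2 j * F j)).
rewrite [leLHS](big_cat_nat (leq0n k) kN) /= big_mkord lerD //.
  by apply: ler_sum => j _; rewrite /weight2 ltn_ord mul1r.
have -> : \sum_(k <= j < N) weight2 j * F j = gam2^-1 * \sum_(k <= j < N) anum j ^+ 2 * F j.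
  rewrite mulr_sumr; apply: eq_big_nat => j /andP[kj _].
  by rewrite /weight2 ltnNge kj /=; ring.
have S0 : 0 <= S.
  by apply: le_trans FS; apply: sumr_ge0 => j _; rewrite mulr_ge0 ?sqr_ge0.
have T0 := T_gt0.
apply: le_trans (_ : gam2^-1 * S <= _); first by rewrite ler_wpM2l // invr_ge0 ltW // gam2_gt0.
rewrite mulrA ler_wpM2r // -[leRHS]invrK lef_pV2 ?posrE ?gam2_gt0 //; last first.
  by rewrite invr_gt0 mulr_gt0 ?invr_gt0.
by rewrite invfM invrK [_ * T]mulrC lerDr sqr_ge0.
Qed.

Lemma sum_sig2_v_le x N : (k <= N)%N -> \sum_(j < N) weight2 j * v j x <= 2 * k%:R * rho x.
Proof.
move=> kN; apply: le_trans (sum_sig2_le kN (v0 ^~ x) (tail_sum_ge x N)) _.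
rewrite rhoE -/(head_sum x) le_eqVlt; apply/orP; left; apply/eqP; field.
by rewrite !gt_eqF ?T_gt0.
Qed.

Lemma sum_sig2_trace N : (k <= N)%N -> \sum_(j < N) weight2 j <= 2 * k%:R.
Proof.
move=> kN; have TN : \sum_(k <= j < N) anum j ^+ 2 * 1 <= T.
  rewrite -lee_fin -TE -sumEFin; apply: le_trans (nneseries_lim_ge N _); last first.
    by move=> j _ _; rewrite aE -EFin_expe lee_fin sqr_ge0.
  rewrite le_eqVlt; apply/orP; left; apply/eqP.
  by apply: eq_bigr => j _; rewrite aE -EFin_expe mulr1.
have := sum_sig2_le kN (fun=> ler01) TN.
under eq_bigr do rewrite mulr1.
by rewrite sumr_const card_ord mulVf ?gt_eqF ?T_gt0 // mulr1 mulr2n mulrDl mul1r.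
Qed.
End SamplingDensity.

(** * The random Gram matrix in real coordinates *)

Section ModelMatrix.
Context (R : realType) (s : scalar_kind) d (D : measurableType d)
  (mu : {measure set D -> \bar R}) (H : rkhs R s D) (hH : embedded_in_L2 mu H)
  (idstar : (D -> scalar_of R s) -> H) (hidstar : embedding_adjoint mu idstar)
  (b : nat -> H) (hb : eigenbasis mu (fun f => idstar (rk_fun H f)) b).
Context (k : nat) (k_gt0 : (0 < k)%N) (T : R)
  (TE : (\sum_(k <= j <oo) approx_number mu H j ^+ 2 = T%:E)%E).
Context (N : nat) (kN : (k <= N)%N) (nu : probability D R)
  (nuE : forall B, measurable B -> nu B = (\int[mu]_(x in B) (rho mu b k x)%:E)%E).
Local Notation K := (scalar_of R s).
Local Notation rho := (rho mu b k).
Local Notation sig := (weight b k T).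
Local Notation sig2 := (weight2 b k T).
Implicit Types (c : nat -> K) (x : D) (j : 'I_N) (a : 'I_(N + N)).

Let v (j : nat) x : K := rk_fun H (b j) x.
Let rho0 x : 0 <= rho x. Proof. exact: (rho_ge0 hH hidstar hb k_gt0 TE). Qed.
Let ssig (j : nat) : sig j ^+ 2 = sig2 j. Proof. exact: (weight_sqr hH hidstar hb k_gt0 TE). Qed.

(** The signs make the pairings of [realify c] with [re_part x] and [im_part x] the real and
    imaginary parts of [scaled_comb c] at [x]. The two vectors are orthogonal with equal norms, as
    [rank2_mx_sqr] requires; for real scalars one half of each is zero. *)
Definition re_part x : 'cV[R]_(N + N) :=
  col_mx (\col_j (sig j * sRe (v j x))) (\col_j - (sig j * sIm (v j x))).
Definition im_part x : 'cV[R]_(N + N) :=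
  col_mx (\col_j (sig j * sIm (v j x))) (\col_j (sig j * sRe (v j x))).

(* The rank-one matrix [z z^*] of the complex vector [z_j = weight_j b_j(x)], written
   as a real matrix of twice the size and divided by [rho x]. *)
Definition sample_mx x : 'M[R]_(N + N) := rank2_mx (rho x)^-1 (re_part x) (im_part x).

Let t x : R := \sum_(j < N) sig2 j * sabs (v j x) ^+ 2.

Let t_le x : t x <= 2 * k%:R * rho x.
Proof. exact: (sum_sig2_v_le hH hidstar hb k_gt0 TE x kN). Qed.

Let t0 x : 0 <= t x.
Proof. by apply: sumr_ge0 => j _; rewrite mulr_ge0 ?sqr_ge0 // -ssig sqr_ge0. Qed.

Let re_im x : dotv (re_part x) (im_part x) = 0.
Proof.
rewrite dotv_col_mx !dotvE -big_split big1 //= => j _; rewrite !mxE; ring.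
Qed.

Let re_re x : dotv (re_part x) (re_part x) = t x.
Proof.
rewrite dotv_col_mx !dotvE -big_split; apply: eq_bigr => j _.
rewrite !mxE sabs_sqr -ssig /=; ring.
Qed.

Let im_im x : dotv (im_part x) (im_part x) = t x.
Proof.
rewrite dotv_col_mx !dotvE -big_split; apply: eq_bigr => j _.
rewrite !mxE sabs_sqr -ssig /=; ring.
Qed.

Lemma sample_mx_psd x : psd (sample_mx x).
Proof. by apply: rank2_mx_psd; rewrite invr_ge0. Qed.

Lemma sample_mx_sqr x : exists2 e, e <= 2 * k%:R & sample_mx x *m sample_mx x = e *: sample_mx x.
Proof.
exists ((rho x)^-1 * t x); last exact: rank2_mx_sqr.
have [->|r0] := eqVneq (rho x) 0; first by rewrite invr0 mul0r mulr_ge0.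
by rewrite mulrC ler_pdivrMr // lt_def r0 rho0.
Qed.

Let entry_sqr_le (u : 'cV[R]_(N + N)) a : u a 0 ^+ 2 <= dotv u u.
Proof.
rewrite dotvE (bigD1 a) //= -expr2 lerDl; apply: sumr_ge0 => i _.
by rewrite -expr2 sqr_ge0.
Qed.

Let entry_mul_le (u : 'cV[R]_(N + N)) a a' : `|u a 0 * u a' 0| <= dotv u u.
Proof.
have h := entry_sqr_le u a; have h' := entry_sqr_le u a'.
rewrite -(@ler_pXn2r _ 2) ?nnegrE ?dotv_ge0 // real_normK ?num_real // exprMn.
by rewrite [leRHS]expr2 ler_pM ?sqr_ge0.
Qed.

Let entry x a a' := re_part x a 0 * re_part x a' 0 + im_part x a 0 * im_part x a' 0.

Let entry_le x a a' : `|entry x a a'| <= 2 * t x.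
Proof.
rewrite (le_trans (ler_normD _ _)) // mulr2n mulrDl mul1r lerD //.
  by rewrite -re_re.
by rewrite -im_im.
Qed.

Let mRe (j : nat) : measurable_fun setT (fun x => sig j * sRe (v j x)).
Proof. by apply: measurable_funM => //; case: (in_L2_rk hH (b j)). Qed.

Let mIm (j : nat) : measurable_fun setT (fun x => sig j * sIm (v j x)).
Proof. by apply: measurable_funM => //; case: (in_L2_rk hH (b j)). Qed.

Let m_re a : measurable_fun setT (fun x => re_part x a 0).
Proof.
case: (split_ordP a) => j ->.
  by under eq_fun do rewrite col_mxEu mxE; exact: mRe.
under eq_fun do rewrite col_mxEd mxE.
by apply: measurableT_comp => //; exact: mIm.
Qed.

Let m_im a : measurable_fun setT (fun x => im_part x a 0).
Proof.
case: (split_ordP a) => j ->.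
  by under eq_fun do rewrite col_mxEu mxE; exact: mIm.
by under eq_fun do rewrite col_mxEd mxE; exact: mRe.
Qed.

Lemma bmf_sample_mx a a' : bmf (fun x => sample_mx x a a').
Proof.
under eq_fun do rewrite rank2_mxE; split.
  apply: measurable_funM.
    under eq_fun do rewrite -(powR_inv1 (rho0 _)).
    by apply: measurableT_comp (measurable_powR _) _; exact: (measurable_rho hH hidstar hb k_gt0 TE).
  by apply: measurable_funD; apply: measurable_funM.
exists (4 * k%:R) => x; rewrite -/(entry x a a') normrM.
have [->|r0] := eqVneq (rho x) 0; first by rewrite invr0 normr0 mul0r mulr_ge0.
have rgt0 : 0 < rho x by rewrite lt_def r0 rho0.
rewrite gtr0_norm ?invr_gt0 // mulrC ler_pdivrMr // (le_trans (entry_le x a a')) //.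
have -> : 4 * k%:R * rho x = 2 * (2 * k%:R * rho x) by ring.
by rewrite ler_pM2l.
Qed.

(** Where [rho] vanishes its inverse is 0 by convention, but there [t x <= 2 k rho x] forces the
    entry itself to vanish. Dividing by the density therefore loses nothing in the mean. *)
Let entry_rho x a a' : sample_mx x a a' * rho x = entry x a a'.
Proof.
rewrite rank2_mxE -/(entry x a a'); have [r0|r0] := eqVneq (rho x) 0; last by field.
rewrite r0 mulr0; apply/esym/eqP; rewrite -normr_le0 (le_trans (entry_le x a a')) //.
by rewrite pmulr_rle0 // (le_trans (t_le x)) // r0 mulr0.
Qed.

Let int_entry a a' : \int[nu]_x sample_mx x a a' = \int[mu]_x entry x a a'.
Proof.
have mr := measurable_rho hH hidstar hb k_gt0 TE.
rewrite (@Rintegral_weight _ _ _ _ _ mu nu id rho (@measurable_id _ _ _) mr rho0 nuE).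
  by apply: eq_Rintegral => x _; exact: entry_rho.
by case: (bmf_sample_mx a a').
Qed.

Let intRe (e : R) (j j' : nat) :
  \int[mu]_x (e * sRe (v j x * sconj (v j' x))) = e * (j == j')%:R.
Proof.
rewrite RintegralZl //; last by apply: integrable_sRe_mul; exact: in_L2_rk.
rewrite -sRe_L2dot -[L2dot _ _ _]/(l2 mu (b j) (b j')) (l2_bb hH hidstar hb).
by case: eqP => _; rewrite ?sRe0 // -(of_real1 R s) sRe_of_real.
Qed.

Let intIm (e : R) (j j' : nat) : \int[mu]_x (e * sIm (v j x * sconj (v j' x))) = 0.
Proof.
rewrite RintegralZl //; last by apply: integrable_sIm_mul; exact: in_L2_rk.
rewrite -sIm_L2dot -[L2dot _ _ _]/(l2 mu (b j) (b j')) (l2_bb hH hidstar hb).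
by case: eqP => _; rewrite ?sIm0 ?mulr0 // -(of_real1 R s) sIm_of_real mulr0.
Qed.

Definition mean_diag : 'rV[R]_(N + N) := row_mx (\row_j sig2 j) (\row_j sig2 j).

(** Orthonormality of the basis in [L2]: the diagonal blocks hold real parts of inner products, the
    off-diagonal blocks imaginary parts, which are all zero. *)
Lemma mean_sample_mx : mean_mx nu sample_mx = diag_mx mean_diag.
Proof.
apply/matrixP => a a'; rewrite mxE int_entry mxE /entry.
case: (split_ordP a) => j ->; case: (split_ordP a') => j' ->.
- rewrite row_mxEl mxE eq_lshift.
  under eq_Rintegral => x _ do rewrite !col_mxEu !mxE.
  transitivity (\int[mu]_x (sig j * sig j' * sRe (v j x * sconj (v j' x)))).
    by apply: eq_Rintegral => x _; rewrite sqr_sabs_conj; ring.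
  rewrite intRe (inj_eq val_inj); case: eqP => [->|_]; last by rewrite mulr0.
  by rewrite mulr1 -expr2 ssig.
- rewrite eq_lrshift.
  under eq_Rintegral => x _ do rewrite !col_mxEu !col_mxEd !mxE.
  rewrite -[RHS](intIm (sig j * sig j') j j').
  by apply: eq_Rintegral => x _; rewrite sIm_mul_conj; ring.
- rewrite eq_rlshift.
  under eq_Rintegral => x _ do rewrite !col_mxEu !col_mxEd !mxE.
  rewrite -[RHS](intIm (sig j' * sig j) j' j).
  by apply: eq_Rintegral => x _; rewrite sIm_mul_conj; ring.
rewrite row_mxEr mxE eq_rshift.
under eq_Rintegral => x _ do rewrite !col_mxEd !mxE.
transitivity (\int[mu]_x (sig j * sig j' * sRe (v j x * sconj (v j' x)))).
  by apply: eq_Rintegral => x _; rewrite sqr_sabs_conj; ring.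
rewrite intRe (inj_eq val_inj); case: eqP => [->|_]; last by rewrite mulr0.
by rewrite mulr1 -expr2 ssig.
Qed.

Lemma mean_sample_mx_form (u w : 'cV[R]_(N + N)) :
  dotv u (diag_mx mean_diag *m w) = \sum_a mean_diag 0 a * (u a 0 * w a 0).
Proof.
rewrite dotvE; apply: eq_bigr => a _; rewrite mul_diag_mx mxE; ring.
Qed.

Lemma mean_diag_le1 a : mean_diag 0 a <= 1.
Proof.
by case: (split_ordP a) => j ->; rewrite ?row_mxEl ?row_mxEr mxE (weight2_le1 hH hidstar hb k_gt0 TE).
Qed.

Lemma mean_sample_mx_le1 : psd (1%:M - mean_mx nu sample_mx).
Proof.
rewrite mean_sample_mx; split=> [|u]; first by rewrite linearB /= trmx1 tr_diag_mx.
rewrite mulmxBl mul1mx dotvDr -scaleN1r dotvZr mean_sample_mx_form dotvE mulN1r -sumrB.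
apply: sumr_ge0 => a _; rewrite -[X in X - _]mul1r -mulrBl mulr_ge0 ?subr_ge0 ?mean_diag_le1 //.
by rewrite -expr2 sqr_ge0.
Qed.

Lemma trace_mean_sample_mx : \tr (mean_mx nu sample_mx) <= 4 * k%:R.
Proof.
rewrite mean_sample_mx mxtrace_diag big_split_ord /=.
under eq_bigr do rewrite row_mxEl mxE.
under [X in _ + X]eq_bigr do rewrite row_mxEr mxE.
have := sum_sig2_trace hH hidstar hb k_gt0 TE kN; lra.
Qed.

Definition realify c : 'cV[R]_(N + N) := col_mx (\col_j sRe (c j)) (\col_j sIm (c j)).

Definition scaled_comb c : H := comb b N (fun j : nat => c j * of_real s (sig j)).

Lemma dotv_realify c c' : dotv (realify c) (realify c') = \sum_(j < N) sRe (c j * sconj (c' j)).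
Proof.
rewrite dotv_col_mx !dotvE -big_split; apply: eq_bigr => j _.
by rewrite !mxE sqr_sabs_conj.
Qed.

Lemma mean_realify c c' : dotv (realify c) (mean_mx nu sample_mx *m realify c') =
  \sum_(j < N) sig2 j * sRe (c j * sconj (c' j)).
Proof.
rewrite mean_sample_mx mean_sample_mx_form big_split_ord /= -big_split.
apply: eq_bigr => j _; rewrite /= row_mxEl row_mxEr !col_mxEu !col_mxEd !mxE sqr_sabs_conj.
ring.
Qed.

Lemma sample_mx_realify c c' x : dotv (realify c) (sample_mx x *m realify c') =
  sRe (rk_fun H (scaled_comb c) x * sconj (rk_fun H (scaled_comb c') x)) / rho x.
Proof.
have re_c e : dotv (realify e) (re_part x) = sRe (rk_fun H (scaled_comb e) x).
  rewrite rk_fun_sum sRe_sum dotv_col_mx !dotvE -big_split; apply: eq_bigr => j _ /=.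
  rewrite !mxE rk_funZ !(sReM, sImM) sRe_of_real sIm_of_real; ring.
have im_c e : dotv (realify e) (im_part x) = sIm (rk_fun H (scaled_comb e) x).
  rewrite rk_fun_sum sIm_sum dotv_col_mx !dotvE -big_split; apply: eq_bigr => j _ /=.
  rewrite !mxE rk_funZ !(sReM, sImM) sRe_of_real sIm_of_real; ring.
by rewrite rank2_mx_form !re_c !im_c sqr_sabs_conj mulrC.
Qed.

Lemma deviation_realify n (x : 'I_n -> D) c c' :
  dotv (realify c) (deviation nu sample_mx x *m realify c') =
  \sum_i sRe (rk_fun H (scaled_comb c) (x i) * sconj (rk_fun H (scaled_comb c') (x i))) / rho (x i)
  - n%:R * \sum_(j < N) sig2 j * sRe (c j * sconj (c' j)).
Proof.
rewrite /deviation mulmxBl dotvDr -scaleN1r dotvZr -scalemxAl dotvZr mean_realify mulN1r.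
congr (_ - _); rewrite mulmx_suml /dotv mulmx_sumr summxE.
by apply: eq_bigr => i _; exact: sample_mx_realify.
Qed.
End ModelMatrix.

(** * The error of weighted least squares *)

(** A first-order condition without derivatives. The test point is [t = - x / (y + 1)], whose
    denominator is positive even if [y] is 0. *)
Lemma quadratic_ge0_linear0 (R : realFieldType) (x y : R) :
  0 <= y -> (forall t, 0 <= 2 * t * x + t ^+ 2 * y) -> x = 0.
Proof.
move=> y0 h; have y1 : 0 < y + 1 by rewrite ltr_wpDl.
have := h (- x / (y + 1)).
have -> : 2 * (- x / (y + 1)) * x + (- x / (y + 1)) ^+ 2 * y
    = - ((x ^+ 2) * ((y + 2) / (y + 1) ^+ 2)) by field; rewrite gt_eqF.
rewrite oppr_ge0 pmulr_lle0 ?divr_gt0 ?exprn_gt0 ?ltr_wpDl // => x2.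
by apply/eqP; rewrite -sqrf_eq0 eq_le x2 sqr_ge0.
Qed.

Section Deterministic.
Context (R : realType) (s : scalar_kind) d (D : measurableType d)
  (mu : {measure set D -> \bar R}) (H : rkhs R s D) (hH : embedded_in_L2 mu H)
  (idstar : (D -> scalar_of R s) -> H) (hidstar : embedding_adjoint mu idstar)
  (b : nat -> H) (hb : eigenbasis mu (fun f => idstar (rk_fun H f)) b).
Context (k : nat) (k_gt0 : (0 < k)%N) (T : R)
  (TE : (\sum_(k <= j <oo) approx_number mu H j ^+ 2 = T%:E)%E).
Context (nu : probability D R)
  (nuE : forall B, measurable B -> nu B = (\int[mu]_(x in B) (rho mu b k x)%:E)%E).
Context (n : nat) (n_gt0 : (0 < n)%N) (x : 'I_n -> D) (m : nat).
(** Good truncation levels need only be unbounded, since each estimate below starts from finitely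
    many coordinates and takes a single [N] beyond them. *)
Hypothesis trace_le : forall M, exists N, [/\ (M <= N)%N, (k <= N)%N &
  \tr (deviation nu (@sample_mx R s d D mu H b k T N) x ^+ m.+1.*2) <= (n%:R / 2) ^+ m.+1.*2].
Local Notation K := (scalar_of R s).
Local Notation rho := (rho mu b k).
Local Notation sig := (weight b k T).
Local Notation sig2 := (weight2 b k T).
Local Notation gam2 := (gam2 b k T).
Local Notation anum := (inv_nrm b).
Local Notation q := (l2sq mu).
Implicit Types (f g h : H) (c e : nat -> K).

Definition sample_form f g : R :=
  \sum_i sRe (rk_fun H f (x i) * sconj (rk_fun H g (x i))) / rho (x i).

Let rho0 y : 0 <= rho y. Proof. exact: (rho_ge0 hH hidstar hb k_gt0 TE). Qed.

Lemma sample_formC f g : sample_form f g = sample_form g f.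
Proof.
apply: eq_bigr => i _; rewrite !sqr_sabs_conj.
by rewrite [sRe (rk_fun H f _) * _]mulrC [sIm (rk_fun H f _) * _]mulrC.
Qed.

Lemma sample_formDl f g h : sample_form (f + g) h = sample_form f h + sample_form g h.
Proof.
rewrite -big_split; apply: eq_bigr => i _ /=.
by rewrite linearD /= mulrDl sReD mulrDl.
Qed.

Lemma sample_formZl (t : R) f h : sample_form (of_real s t *: f) h = t * sample_form f h.
Proof.
rewrite mulr_sumr; apply: eq_bigr => i _ /=.
by rewrite rk_funZ -mulrA sReM sRe_of_real sIm_of_real mul0r subr0 mulrA.
Qed.

Lemma sample_formNl f h : sample_form (- f) h = - sample_form f h.
Proof.
rewrite -mulN1r -sample_formZl; congr (sample_form _ h).
rewrite -scaleN1r; congr (_ *: _).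
by apply: scalar_eqP; rewrite ?sRe_of_real ?sIm_of_real ?sReN ?sImN -(of_real1 R s) ?sRe_of_real ?sIm_of_real ?oppr0.
Qed.

Lemma sample_form_sqr (t : R) f g :
  sample_form (f + of_real s t *: g) (f + of_real s t *: g) =
  sample_form f f + 2 * t * sample_form f g + t ^+ 2 * sample_form g g.
Proof.
set w := _ *: g; rewrite sample_formDl (sample_formC f) (sample_formC w) !sample_formDl.
rewrite (sample_formC f w) (sample_formZl t g f) (sample_formZl t g w) (sample_formC g w).
rewrite (sample_formZl t g g) (sample_formC g f); ring.
Qed.

Lemma sample_form_ge0 f : 0 <= sample_form f f.
Proof. by apply: sumr_ge0 => i _; rewrite sRe_mul_conj_self divr_ge0 ?sqr_ge0. Qed.

Lemma sample_form_bounded g : exists2 C, 0 <= C & forall f, `|sample_form g f| <= C * nrm f.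
Proof.
have /choice[C hC] : forall i, exists C, 0 <= C /\ forall f, sabs (rk_fun H f (x i)) <= C * nrm f.
  by move=> i; have [C C0 hC] := eval_bounded H (x i); exists C.
exists (\sum_i sabs (rk_fun H g (x i)) * C i / rho (x i)).
  by apply: sumr_ge0 => i _; rewrite divr_ge0 // mulr_ge0 ?sabs_ge0 //; case: (hC i).
move=> f; rewrite (le_trans (ler_norm_sum _ _ _)) // mulr_suml; apply: ler_sum => i _.
rewrite normrM normfV (ger0_norm (rho0 _)) mulrAC ler_wpM2r ?invr_ge0 //.
rewrite (le_trans (sRe_le_sabs _)) // sabsM sabs_conj -mulrA ler_wpM2l ?sabs_ge0 //.
by case: (hC i).
Qed.

Lemma residualE f g : lsq_residual mu b k x f g = sample_form (g - f) (g - f).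
Proof. by apply: eq_bigr => i _; rewrite rk_funB sRe_mul_conj_self. Qed.

Let n2_ge0 : 0 <= n%:R / 2 :> R. Proof. by rewrite divr_ge0. Qed.

Let dev_form N (u w : 'cV[R]_(N + N)) : (k <= N)%N ->
  \tr (deviation nu (@sample_mx R s d D mu H b k T N) x ^+ m.+1.*2) <= (n%:R / 2) ^+ m.+1.*2 ->
  dotv u (deviation nu (@sample_mx R s d D mu H b k T N) x *m w) ^+ 2 <=
  (n%:R / 2) ^+ 2 * (dotv u u * dotv w w).
Proof.
move=> kN; apply: trace_power_form_le n2_ge0; apply: deviation_sym => y.
exact: (sample_mx_psd hH hidstar hb k_gt0 TE).
Qed.

Let weight_head j : (j < k)%N -> sig j = 1.
Proof. by move=> jk; rewrite /weight /weight2 jk sqrtr1. Qed.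

Let head_comb N c : (k <= N)%N -> (forall j, (k <= j)%N -> c j = 0) ->
  scaled_comb b k T N c = comb b k c.
Proof.
move=> kN c0; rewrite /scaled_comb (comb_widen b kN); last first.
  by move=> j kj; rewrite c0 // mul0r.
by apply: eq_bigr => j _; rewrite weight_head // of_real1 mulr1.
Qed.

Let head_l2sq N c : (k <= N)%N -> (forall j, (k <= j)%N -> c j = 0) ->
  \sum_(j < N) sabs (c j) ^+ 2 = q (comb b k c).
Proof. by move=> kN c0; rewrite -(comb_widen b kN c0) (l2sq_comb hH hidstar hb). Qed.

(** The weights are 1 on the head, so the deviation form at [realify c] is the sample form minus [n]
    times the squared [L2] norm. A deviation of at most [n / 2] leaves the other half. *)
Lemma sample_form_head_ge c : (forall j, (k <= j)%N -> c j = 0) ->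
  n%:R / 2 * q (comb b k c) <= sample_form (comb b k c) (comb b k c).
Proof.
move=> c0; have [N [_ kN trN]] := trace_le 0.
have := dev_form (realify N c) (realify N c) kN trN.
rewrite (deviation_realify hH hidstar hb k_gt0 TE kN nuE) head_comb //.
rewrite -/(sample_form (comb b k c) (comb b k c)) dotv_realify.
have -> : \sum_(j < N) sRe (c j * sconj (c j)) = q (comb b k c).
  by rewrite -(head_l2sq kN c0); apply: eq_bigr => j _; rewrite sRe_mul_conj_self.
have -> : \sum_(j < N) sig2 j * sRe (c j * sconj (c j)) = q (comb b k c).
  rewrite -(head_l2sq kN c0); apply: eq_bigr => j _; rewrite sRe_mul_conj_self.
  have [jk|kj] := ltnP j k; first by rewrite /weight2 jk mul1r.
  by rewrite c0 // sabs0 expr0n mulr0.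
rewrite -expr2 -exprMn => sq.
have : `|sample_form (comb b k c) (comb b k c) - n%:R * q (comb b k c)| <=
    n%:R / 2 * q (comb b k c).
  rewrite -(@ler_pXn2r _ 2) ?nnegrE ?mulr_ge0 ?(l2sq_ge0 hH) //.
  by rewrite real_normK ?num_real.
rewrite ler_norml => /andP[+ _].
rewrite lerBrDr; apply: le_trans; rewrite le_eqVlt; apply/orP; left; apply/eqP; by field.
Qed.

(** Dividing [e] by the weights undoes the scaling. As [1 / a_j^2] is the squared norm of [b j], the
    squared Euclidean norm of the quotient is [gam2] times the squared norm in [H]. Head and tail
    indices are disjoint, so the mean contributes nothing. *)
Lemma sample_form_cross_comb c M e : (forall j, (k <= j)%N -> c j = 0) ->
  (forall j, (j < k)%N -> e j = 0) ->
  sample_form (comb b k c) (comb b M e) ^+ 2 <=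
  (n%:R / 2) ^+ 2 * (q (comb b k c) * (gam2 * nrm (comb b M e) ^+ 2)).
Proof.
move=> c0 e0; have [N [MN kN trN]] := trace_le M.
pose e' j := if (j < M)%N then e j else 0.
have e'E : comb b N e' = comb b M e.
  rewrite (comb_widen b MN); last by move=> j Mj; rewrite /e' ltnNge Mj.
  by apply: eq_bigr => j _; rewrite /e' ltn_ord.
have sig0 j : 0 < sig j by exact: (weight_gt0 hH hidstar hb k_gt0 TE).
pose w j : K := e' j * of_real s (sig j)^-1.
have wE : scaled_comb b k T N w = comb b M e.
  rewrite -e'E; apply: eq_bigr => j _; rewrite /w -mulrA.
  rewrite (_ : of_real s _ * of_real s _ = 1) ?mulr1 //.
  apply: scalar_eqP; rewrite -(of_real1 R s) ?(sReM, sImM) !sRe_of_real !sIm_of_real.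
    by rewrite mulr0 subr0 mulVf // gt_eqF.
  by rewrite mulr0 mul0r addr0.
have := dev_form (realify N c) (realify N w) kN trN.
rewrite (deviation_realify hH hidstar hb k_gt0 TE kN nuE) head_comb // wE.
rewrite -/(sample_form (comb b k c) (comb b M e)) [X in _ - _ * X]big1; last first.
  move=> j _; have [jk|kj] := ltnP j k; last by rewrite c0 // mul0r sRe0 mulr0.
  by rewrite /w /e' e0 // if_same mul0r sconj0 mulr0 sRe0 mulr0.
rewrite mulr0 subr0 !dotv_realify.
under eq_bigr do rewrite sRe_mul_conj_self; rewrite (head_l2sq kN c0).
under eq_bigr do rewrite sRe_mul_conj_self.
rewrite -e'E (nrm_comb hb) => /le_trans; apply; rewrite le_eqVlt; apply/orP; left.
apply/eqP; congr (_ * (_ * _)); rewrite mulr_sumr; apply: eq_bigr => j _.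
rewrite /w sabsM sabs_of_real exprMn real_normK ?num_real // exprVn.
rewrite (weight_sqr hH hidstar hb k_gt0 TE).
have [jk|kj] := ltnP j k; first by rewrite /e' e0 // if_same sabs0 expr0n /= !mul0r mulr0.
have g0 := gam2_gt0 hH hidstar hb k_gt0 TE.
rewrite /weight2 ltnNge kj /= mulrCA; congr (_ * _).
by rewrite invf_div /inv_nrm exprVn invrK.
Qed.

(** Finite tail combinations approach [h], and for fixed [g] the sample form is a bounded
    functional, being a finite sum of evaluations. *)
Lemma sample_form_cross c h : (forall j, (k <= j)%N -> c j = 0) -> tail b k h ->
  `|sample_form (comb b k c) h| <=
  n%:R / 2 * Num.sqrt (q (comb b k c) * gam2) * nrm h.
Proof.
move=> c0 th; set g := comb b k c; set A := n%:R / 2 * _.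
have g0 := gam2_gt0 hH hidstar hb k_gt0 TE.
have A0 : 0 <= A by rewrite mulr_ge0 // sqrtr_ge0.
have [C C0 hC] := sample_form_bounded g.
apply/ler_addgt0Pr => eps eps0.
have AC : 0 < A + C + 1 by rewrite ltr_wpDl // addr_ge0.
have d0 : 0 < eps / (A + C + 1) by rewrite divr_gt0.
have [M [e [_ e0 hM]]] := tail_approx hb 0 th d0.
set u := comb b M e in hM.
have hu : `|sample_form g u| <= A * nrm u.
  rewrite -(@ler_pXn2r _ 2) ?nnegrE ?mulr_ge0 ?nrm_ge0 ?sqrtr_ge0 // real_normK ?num_real //.
  apply: le_trans (sample_form_cross_comb M c0 e0) _.
  rewrite /A !exprMn sqr_sqrtr; last by rewrite mulr_ge0 ?(l2sq_ge0 hH) // ltW.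
  by rewrite !mulrA.
have ule : nrm u <= nrm h + eps / (A + C + 1).
  have := nrmD h (- (h - u)); rewrite nrmN opprB addrCA subrr addr0.
  by move=> /le_trans; apply; rewrite lerD2l ltW.
have -> : sample_form g h = sample_form g u + sample_form g (h - u).
  by rewrite !(sample_formC g) -sample_formDl addrCA subrr addr0.
apply: le_trans (ler_normD _ _) _.
apply: le_trans (lerD hu (hC (h - u))) _.
apply: le_trans (lerD (ler_wpM2l A0 ule) (ler_wpM2l C0 (ltW hM))) _.
rewrite mulrDr -addrA lerD2l -mulrDl mulrA ler_pdivrMr // mulrC.
by rewrite ler_wpM2l ?(ltW eps0) // lerDl.
Qed.

(** Here [h] is the tail of [f] and [g] the difference between [u] and the projection of [f].
    Minimality along [g] gives [B(g, g) = B(g, h)] for the sample form [B]. The head bound on the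
    left and the cross bound on the right yield [q g <= gam2 * nrm h ^+ 2], and [f - u = h - g]
    splits orthogonally in [L2]. *)
Lemma least_squares_error f u : first_span b k u ->
  (forall g, first_span b k g ->
    lsq_residual mu b k x f u <= lsq_residual mu b k x f g) ->
  q (f - u) <= (anum k ^+ 2 + gam2) * nrm f ^+ 2.
Proof.
move=> /first_spanP[cu [cu0 uE]] umin.
pose h := f - proj b k f.
have th : tail b k h by move=> j jk; exact: (proj_orth hH hidstar hb).
pose cp j : K := if (j < k)%N then rk_dot H f (b j) * of_real s (anum j ^+ 2) else 0.
have pE : proj b k f = comb b k cp.
  by apply: eq_bigr => j _; rewrite /cp ltn_ord.
pose c j := cu j - cp j.
have c0 j : (k <= j)%N -> c j = 0 by move=> kj; rewrite /c cu0 // /cp ltnNge kj subrr.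
set g := comb b k c.
have gE : g = u - proj b k f.
  rewrite pE uE /g /comb -sumrB; apply: eq_bigr => j _; by rewrite scalerBl.
have ufE : u - f = g - h by rewrite gE /h opprB addrA subrK.
have normal : sample_form (g - h) g = 0.
  apply: (quadratic_ge0_linear0 (sample_form_ge0 g)) => t.
  have := umin (u + of_real s t *: g).
  have sp : first_span b k (u + of_real s t *: g).
    apply/first_spanP; exists (fun j => cu j + of_real s t * c j); split.
      by move=> j kj; rewrite cu0 // c0 // mulr0 addr0.
    rewrite uE /g /comb scaler_sumr -big_split; apply: eq_bigr => j _ /=.
    by rewrite [RHS]scalerDl scalerA.
  move=> /(_ sp); rewrite !residualE addrAC ufE sample_form_sqr -addrA.
  by rewrite lerDl.
have Bgg : sample_form g g = sample_form g h.
  move: normal; rewrite sample_formDl sample_formNl => /eqP; rewrite subr_eq0 => /eqP ->.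
  exact: sample_formC.
have g0 := gam2_gt0 hH hidstar hb k_gt0 TE.
have qg0 := l2sq_ge0 hH g.
have n0 : 0 < n%:R / 2 :> R by rewrite divr_gt0 ?ltr0n.
have qg : q g <= gam2 * nrm h ^+ 2.
  have := sample_form_head_ge c0; rewrite -/g Bgg.
  move=> /le_trans /(_ (le_trans (ler_norm _) (sample_form_cross c0 th))).
  rewrite -[leRHS]mulrA ler_pM2l // -/g => qs.
  have {qs} : q g ^+ 2 <= q g * gam2 * nrm h ^+ 2.
    rewrite -[X in X * _]sqr_sqrtr ?mulr_ge0 ?(ltW g0) // -exprMn.
    by rewrite ler_pXn2r ?nnegrE ?mulr_ge0 ?sqrtr_ge0 ?nrm_ge0.
  have [->|qn0] := eqVneq (q g) 0; first by rewrite mulr_ge0 ?sqr_ge0 // ltW.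
  by rewrite expr2 -mulrA ler_pM2l // lt_def qn0.
have qh := l2sq_tail_le hH hidstar hb th.
have qfu : q (f - u) = q h + q g.
  have -> : f - u = h - g by rewrite -opprB ufE opprB.
  apply: (l2sq_sub_orth hH hidstar); rewrite (l2_conj hH) /g /comb (l2_sumr hH hidstar).
  rewrite big1 ?sconj0 // => j _.
  by rewrite (l2Zr hH hidstar) (l2_conj hH) (l2_b hH hidstar hb) th // mulr0 sconj0 mulr0.
rewrite qfu mulrDl; apply: le_trans (lerD qh qg) _.
have := nrm_tail_le hH hidstar hb k f; rewrite -/h => hf.
have h2 : nrm h ^+ 2 <= nrm f ^+ 2 by rewrite ler_pXn2r ?nnegrE ?nrm_ge0.
by apply: lerD; apply: ler_wpM2l => //; rewrite ?sqr_ge0 // ltW.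
Qed.
End Deterministic.

(** * Numerical constants *)

Section Numerics.
Context (R : realType) (n : nat) (c : R) (hn : (2 <= n)%N) (hc : 0 < c).
Let l : R := (2 + c) * ln n%:R.

Let n2 : 2 <= n%:R :> R. Proof. by rewrite ler_nat. Qed.
Let n0 : 0 < n%:R :> R. Proof. exact: lt_le_trans n2. Qed.

Let ln_ge : 2^-1 <= ln n%:R :> R.
Proof.
rewrite -ler_expR lnK ?posrE //; apply: le_trans n2.
rewrite -[leRHS]invrK -[leLHS]invrK lef_pV2 ?posrE ?invr_gt0 ?expR_gt0 // -expRN.
by apply: le_trans (expR_ge1Dx _); lra.
Qed.

Lemma log_ge1 : 1 <= l.
Proof.
rewrite -[leLHS](@mulfV _ 2) ?pnatr_eq0 //.
by apply: ler_pM => //; rewrite lerDl ltW.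
Qed.

(** The factor 2 in front of the floor turns [2^8] into 128. *)
Lemma k_of_le : (k_of n c)%:R * (128 * l) <= n%:R :> R.
Proof.
have l0 : 0 < l by exact: lt_le_trans log_ge1.
have y0 : 0 <= n%:R / (2 ^+ 8 * (2 + c) * ln n%:R) :> R.
  by rewrite divr_ge0 // -mulrA mulr_ge0 ?exprn_ge0 // ltW.
rewrite /k_of natrM -mulrA [_%:R * (128 * l)]mulrC.
have := truncn_ge_nat (Num.truncn (n%:R / (2 ^+ 8 * (2 + c) * ln n%:R) : R)) y0.
rewrite leqnn => /esym; rewrite -[2 ^+ 8 * _ * _]mulrA -/l.
rewrite ler_pdivlMr ?(mulr_gt0 _ l0) ?exprn_gt0 //.
move=> h; apply: le_trans h.
by rewrite le_eqVlt; apply/orP; left; apply/eqP; ring.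
Qed.

(** From [exp(-1/4) >= 3/4], as [(3/4)^4 = 81/256] exceeds [9/31]. *)
Let exp1 : 9 / 31 <= expR (-1) :> R.
Proof.
have q34 : 3 / 4 <= expR (- 4^-1) :> R by apply: le_trans (expR_ge1Dx _); lra.
have -> : -1 = - 4^-1 * 4%:R :> R by field.
rewrite expRM_natr; apply: le_trans (_ : (3 / 4) ^+ 4 <= _); first lra.
by rewrite ler_pXn2r ?nnegrE ?expR_ge0.
Qed.

(** With [exp(2 - l) = e^2 / n^(2+c)] and [e^2 < 10], the left side is at most [8 / n^c] times
    [80 k^2 / n^3], and [128 k <= n] makes the last factor at most 1. *)
Lemma tail_bound_le (k m : nat) (tau : R) : (0 < k)%N -> k%:R * (128 * l) <= n%:R ->
  l - 2 <= m%:R -> 0 <= tau -> tau <= 4 * k%:R ->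
  (9 / 31) ^+ m * (8 * (2 * k%:R) * tau / n%:R) <= 8 / n%:R `^ c.
Proof.
move=> k_gt0 kn lm tau0 tau_le.
have k0 : 0 < k%:R :> R by rewrite ltr0n.
have l1 := log_ge1.
have kn' : k%:R * 128 <= n%:R :> R.
  by apply: le_trans kn; rewrite (ler_wpM2l (ltW k0)) // ler_peMr.
have nc0 : 0 < n%:R `^ c by rewrite powR_gt0.
have e_m : (9 / 31) ^+ m <= 10 / (n%:R ^+ 2 * n%:R `^ c) :> R.
  apply: le_trans (_ : expR (-1) ^+ m <= _).
    by apply: lerXn2r; rewrite ?nnegrE ?expR_ge0 // divr_ge0.
  rewrite -expRM_natr mulN1r.
  apply: le_trans (_ : expR (2 - l) <= _); first by rewrite ler_expR; lra.
  have -> : expR (2 - l) = expR 2 / (n%:R ^+ 2 * n%:R `^ c).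
    rewrite expRB /l mulrDl [X in _ / X]expRD expRM_natl lnK ?posrE //.
    by rewrite /powR gt_eqF.
  rewrite ler_wpM2r ?invr_ge0 ?mulr_ge0 ?exprn_ge0 ?ltW //.
  have e2 : expR 2 = (expR (-1) ^+ 2)^-1 :> R.
    by rewrite -expRM_natr mulN1r expRN invrK.
  rewrite e2 -[ltRHS]invrK ltf_pV2 ?posrE ?invr_gt0 ?exprn_gt0 ?expR_gt0 //.
  have q34 : 3 / 4 <= expR (- 4^-1) :> R by apply: le_trans (expR_ge1Dx _); lra.
  have -> : -1 = - 4^-1 * 4%:R :> R by field.
  (* [(3/4)^8 = 6561/65536] is just above [1/10]. *)
  rewrite expRM_natr -exprM; apply: lt_le_trans (_ : (3 / 4) ^+ 8 <= _); first lra.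
  by rewrite ler_pXn2r ?nnegrE ?expR_ge0.
have r_le : 8 * (2 * k%:R) * tau / n%:R <= 64 * k%:R ^+ 2 / n%:R.
  rewrite ler_wpM2r ?invr_ge0 ?(ltW n0) //.
  have -> : 64 * k%:R ^+ 2 = 8 * (2 * k%:R) * (4 * k%:R) :> R by ring.
  by rewrite ler_wpM2l // !mulr_ge0 // ltW.
have r0 : 0 <= 8 * (2 * k%:R) * tau / n%:R by rewrite !mulr_ge0 ?invr_ge0 // ltW.
apply: le_trans (ler_pM _ r0 e_m r_le) _; first by rewrite exprn_ge0 // divr_ge0.
have -> : 10 / (n%:R ^+ 2 * n%:R `^ c) * (64 * k%:R ^+ 2 / n%:R) =
    (8 / n%:R `^ c) * (80 * k%:R ^+ 2 / n%:R ^+ 3) :> R.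
  by field; rewrite !gt_eqF.
rewrite -[leRHS]mulr1 ler_wpM2l ?divr_ge0 ?(ltW nc0) // ler_pdivrMr ?exprn_gt0 // mul1r.
have k2 : (k%:R * 128) ^+ 2 <= n%:R ^+ 2 :> R.
  by rewrite ler_pXn2r ?nnegrE ?mulr_ge0 // ltW.
have n23 : n%:R ^+ 2 <= n%:R ^+ 3 :> R.
  by rewrite [leRHS]exprS -[leLHS]mul1r ler_wpM2r ?exprn_ge0 // ler1n (ltn_trans _ hn).
apply: le_trans n23; apply: le_trans k2; rewrite exprMn mulrC ler_wpM2l ?exprn_ge0 //; lra.
Qed.
End Numerics.

(** * Assembling the event and the error bound *)

Theorem theorem2 (R : realType) (n : nat) (c : R) (hn : (2 <= n)%N) (hc : 0 < c)
  (d : measure_display) (D : measurableType d) (mu : {measure set D -> \bar R})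
  (s : scalar_kind) (H : rkhs R s D) (hH : embedded_in_L2 mu H)
  (idstar : (D -> scalar_of R s) -> H) (hidstar : embedding_adjoint mu idstar)
  (b : nat -> H) (hb : eigenbasis mu (fun f => idstar (rk_fun H f)) b)
  (A : ('I_n -> D) -> H -> H) (hA : least_squares mu b (k_of n c) A)
  (d' : measure_display) (Omega : measurableType d') (P : probability Omega R)
  (X : 'I_n -> {RV P >-> D}) (hXind : mutually_independent X)
  (hXdens : forall i, has_density mu (X i) (rho mu b (k_of n c))) :
  exists2 E : set Omega, measurable E &
    E `<=` [set w | (worst_case_error mu (A (fun i => X i w)) ^+ 2
                     <= 4%:E / (k_of n c)%:R%:E
                        * \sum_((k_of n c)./2 <= j <oo)
                            approx_number mu H j ^+ 2)%E]
    /\ ((1 - 8 / n%:R `^ c)%:E <= P E)%E.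
Proof.
set k := k_of n c in hA hXdens *.
have aE := approx_numberE hH hidstar hb.
have a0 j : (0 <= approx_number mu H j ^+ 2)%E by rewrite aE -EFin_expe lee_fin sqr_ge0.
set S := (\sum_(_ <= j <oo) _)%E.
have nc0 : 0 < n%:R `^ c by rewrite powR_gt0 // ltr0n; exact: leq_trans hn.
have trivial_case : (4%:E / k%:R%:E * S = +oo)%E -> exists2 E : set Omega, measurable E &
    E `<=` [set w | (worst_case_error mu (A (fun i => X i w)) ^+ 2 <= 4%:E / k%:R%:E * S)%E]
    /\ ((1 - 8 / n%:R `^ c)%:E <= P E)%E.
  move=> Soo; exists setT => //; split; first by move=> w _ /=; rewrite Soo leey.
  have -> : P setT = 1%E by exact: probability_setT.
  by rewrite lee_fin gerBl divr_ge0 // ltW.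
have S_gt0 : (0 < S)%E.
  apply: lt_le_trans (nneseries_lim_ge k./2.+1 _) => //.
  by rewrite big_nat1 aE -EFin_expe lte_fin exprn_gt0 // (inv_nrm_gt0 hH hidstar hb).
(* In [\bar R] the quotient [4 / 0] is [+oo] and [S] is positive, so the claimed bound is
   infinite. *)
have [k_eq0|k_neq0] := eqVneq k 0%N.
  apply: trivial_case; rewrite k_eq0 inver eqxx gt0_muley ?lte_fin //.
  exact: gt0_mulye.
have k_gt0 : (0 < k)%N by rewrite lt0n.
have k0 : 0 < k%:R :> R by rewrite ltr0n.
have kV : (k%:R%:E^-1 = (k%:R^-1)%:E :> \bar R)%E by rewrite inver gt_eqF.
have [S_oo|S_fin] := eqVneq S +oo%E.
  by apply: trivial_case; rewrite S_oo kV -EFinM gt0_muley // lte_fin divr_gt0.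
have {}S_fin : S \is a fin_num by rewrite ge0_fin_numE ?ltW // lt_neqAle S_fin leey.
clear trivial_case.
have k_even : (k./2 + k./2 = k)%N.
  by rewrite /k /k_of mul2n doubleK addnn.
have S_split : (S = \sum_(k./2 <= j < k) approx_number mu H j ^+ 2
    + \sum_(k <= j <oo) approx_number mu H j ^+ 2)%E.
  by rewrite /S (nneseries_split _ k./2) // k_even.
have tail_ge0 : (0 <= \sum_(k <= j <oo) approx_number mu H j ^+ 2)%E by exact: nneseries_ge0.
have tail_fin : (\sum_(k <= j <oo) approx_number mu H j ^+ 2)%E \is a fin_num.
  rewrite ge0_fin_numE //; apply: le_lt_trans (_ : S < +oo)%E.
    by rewrite S_split leeDr // sume_ge0.
  by rewrite -ge0_fin_numE // ltW.
pose T : R := fine (\sum_(k <= j <oo) approx_number mu H j ^+ 2)%E.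
have TE : (\sum_(k <= j <oo) approx_number mu H j ^+ 2 = T%:E)%E by rewrite fineK.
have T0 := T_gt0 hH hidstar hb TE.
set B := inv_nrm b k ^+ 2 + gam2 b k T.
have B_le : (B%:E <= 4%:E / k%:R%:E * S)%E.
  (* Each of the [k / 2] head terms of [S] is at least [a_k^2]; multiplied by [4 / k] they cover the
     [2 a_k^2] contained in [B], and the tail covers [T / k]. *)
  have head_ge : ((k./2%:R * inv_nrm b k ^+ 2)%:E <=
      \sum_(k./2 <= j < k) approx_number mu H j ^+ 2)%E.
    under eq_bigr do rewrite aE -EFin_expe.
    rewrite sumEFin lee_fin.
    have -> : k./2%:R * inv_nrm b k ^+ 2 = \sum_(k./2 <= j < k) inv_nrm b k ^+ 2.
      by rewrite sumr_const_nat -[X in (X - _)%N]k_even addKn mulr_natl.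
    apply: ler_sum_nat => j /andP[_ jk].
    rewrite ler_pXn2r ?nnegrE ?(ltW (inv_nrm_gt0 hH hidstar hb _)) //.
    exact: (inv_nrm_le hH hidstar hb (ltnW jk)).
  have k2 : k%:R = 2 * k./2%:R :> R by rewrite -{1}k_even natrD mulr2n mulrDl mul1r.
  rewrite kV -EFinM S_split TE.
  apply: le_trans (lee_wpmul2l _ (leeD head_ge (lexx _))); last by rewrite lee_fin divr_ge0.
  rewrite -EFinD -EFinM lee_fin mulrDr.
  have -> : 4 / k%:R * (k./2%:R * inv_nrm b k ^+ 2) = 2 * inv_nrm b k ^+ 2.
    rewrite k2; field; rewrite pnatr_eq0 -lt0n.
    by move: k_gt0; rewrite -{1}k_even addn_gt0 orbb.
  rewrite /B /gam2; have := mulr_ge0 (ltW T0) (ltW (_ : 0 < k%:R^-1)); rewrite invr_gt0 => /(_ k0).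
  by move: (_ ^+ 2) => a; rewrite mulrAC -mulrA; lra.
have n_gt0 : (0 < n)%N by exact: leq_trans hn.
pose i0 : 'I_n := Ordinal n_gt0.
(* All nodes have the same density, so the law of any one of them is the sampling measure. *)
pose nu : probability D R := distribution P (X i0).
have nuE B' : measurable B' -> nu B' = (\int[mu]_(x in B') (rho mu b k x)%:E)%E.
  exact: hXdens.
have Xlaw i B' : measurable B' -> distribution P (X i) B' = nu B'.
  by move=> mB; rewrite nuE // hXdens.
pose l : R := (2 + c) * ln n%:R.
have l1 : 1 <= l by exact: log_ge1.
(* With [m.+1 = p], the bound [m.+1 <= l] gives the condition [32 (2m+1) 2k <= n], and [l < m.+2]
   gives the decay in the tail bound. *)
pose p := Num.truncn l.
have p0 : (0 < p)%N by rewrite truncn_gt0.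
pose m := p.-1; have pE : p = m.+1 by rewrite prednK.
have pl : p%:R <= l by rewrite -truncn_ge_nat ?(le_trans ler01).
have lp : l < p.+1%:R by rewrite -truncn_le_nat.
have kl := k_of_le hn hc : k%:R * (128 * l) <= n%:R.
have budget : 32 * (m.*2.+1%:R * (2 * k%:R)) <= n%:R :> R.
  apply: le_trans kl; have -> : 32 * (m.*2.+1%:R * (2 * k%:R)) = k%:R * (64 * m.*2.+1%:R) :> R by ring.
  rewrite ler_wpM2l ?(ltW k0) //.
  have m2 : m.*2.+1%:R <= 2 * p%:R :> R.
    by rewrite -natrM ler_nat mul2n pE doubleS ltnW.
  have -> : 128 * l = 64 * (2 * l) by ring.
  by rewrite ler_wpM2l // (le_trans m2) // ler_wpM2l.
pose M N := @sample_mx R s d D mu H b k T N.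
pose V N w := \tr (deviation nu (M N) (sampleX X w) ^+ m.+1.*2).
pose F N := [set w | (n%:R / 2) ^+ m.+1.*2 < V N w].
have Z_bmf N (kN : (k <= N)%N) i j : bmf (fun y => M N y i j).
  exact: (bmf_sample_mx hH hidstar hb k_gt0 TE kN).
have mF N : (k <= N)%N -> measurable (F N).
  move=> kN; have [mV _] := bmf_deviation_trace X nu (Z_bmf N kN) m.+1.*2.
  have := mV measurableT `](n%:R / 2) ^+ m.+1.*2, +oo[%classic (measurable_itv _).
  by rewrite setTI; congr measurable; apply/seteqP; split => w /=; rewrite in_itv/= andbT.
have PF N : (k <= N)%N -> (P (F N) <= (8 / n%:R `^ c)%:E)%E.
  move=> kN; have r0 : 0 <= 2 * k%:R :> R by rewrite mulr_ge0.
  have Z_psd := sample_mx_psd hH hidstar hb k_gt0 TE N.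
  have Z_sqr := sample_mx_sqr hH hidstar hb k_gt0 TE kN.
  have E_le1 := mean_sample_mx_le1 hH hidstar hb k_gt0 TE kN nuE.
  have := deviation_tail hXind Xlaw (Z_bmf N kN) Z_psd Z_sqr E_le1 n_gt0 r0 budget.
  move=> /le_trans; apply; rewrite lee_fin; apply: tail_bound_le => //.
  - by rewrite lerBlDr -natrD addn2 -pE ltW.
  - rewrite (mean_sample_mx hH hidstar hb k_gt0 TE kN nuE) mxtrace_diag.
    apply: sumr_ge0 => i _.
    by case: (split_ordP i) => j ->; rewrite ?row_mxEl ?row_mxEr mxE ltW // (weight2_gt0 hH hidstar hb k_gt0 TE).
  exact: (trace_mean_sample_mx hH hidstar hb k_gt0 TE kN nuE).
(* The bad event: from some truncation level on, every deviation is too large. *)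
pose G L := \bigcap_(N in [set N | (L + k <= N)%N]) F N.
have mG L : measurable (G L).
  apply: bigcap_measurable => [|N LN]; first by exists (L + k)%N => /=.
  exact: mF (leq_trans (leq_addl _ _) LN).
have PG L : (P (G L) <= (8 / n%:R `^ c)%:E)%E.
  apply: le_trans (PF (L + k)%N (leq_addl _ _)).
  apply: le_measure; rewrite ?inE //; first exact/mF/leq_addl.
  by move=> w; apply => /=.
(* The sets [G L] increase with [L], so their common bound passes to the union by continuity of
   [P]. *)
have PGU : (P (\bigcup_L G L) <= (8 / n%:R `^ c)%:E)%E.
  have G_nd : {homo G : i j / (i <= j)%N >-> (i <= j)%O}.
    move=> i j ij; apply/subsetPset => w Gw N /= jN; apply: Gw => /=.
    by apply: leq_trans jN; rewrite leq_add2r.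
  have cvgG : P \o G @ \oo --> P (\bigcup_L G L).
    by apply: nondecreasing_cvg_mu => //; apply: bigcup_measurable => i _; exact: mG.
  rewrite -(cvg_lim _ cvgG) //; apply: lime_le; first by apply: cvgP cvgG.
  by apply: nearW => L; exact: PG.
have mGU : measurable (\bigcup_L G L) by apply: bigcup_measurable => i _; exact: mG.
exists (~` \bigcup_L G L); first exact: measurableC.
split; last first.
  rewrite [X in (_ <= X)%E](_ : _ = 1 - P (\bigcup_L G L))%E; last exact: probability_setC.
  by rewrite EFinB leeB.
move=> w /= notG; apply: le_trans B_le.
(* Outside the union, no level is followed by bad [N] only, so a good [N] exists beyond every
   [L]. *)
have trace_le L : exists N, [/\ (L <= N)%N, (k <= N)%N & V N w <= (n%:R / 2) ^+ m.+1.*2].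
  apply: contrapT => noN; apply: notG; exists L => // N /= LN.
  rewrite /F /= ltNge; apply/negP => VN; apply: noN; exists N; split => //.
    exact: leq_trans (leq_addr _ _) LN.
  exact: leq_trans (leq_addl _ _) LN.
have B0 : 0 <= B.
  by rewrite addr_ge0 ?sqr_ge0 // ltW // (gam2_gt0 hH hidstar hb k_gt0 TE).
have W_ge0 : (0 <= worst_case_error mu (A (fun i => X i w)))%E.
  apply: le_trans (L2norm_ge0 mu (fun x => rk_fun H 0 x - rk_fun H (A (fun i => X i w) 0) x)) _.
  by apply: ereal_sup_ubound; exists 0 => //=; rewrite normr0.
have W_le : (worst_case_error mu (A (fun i => X i w)) <= (Num.sqrt B)%:E)%E.
  apply: ge_ereal_sup => _ [f /= f1 <-].
  rewrite (_ : (fun x => _) = rk_fun H (f - A (fun i => X i w) f)); last first.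
    by apply/funext => x; rewrite rk_funB.
  apply: le_of_sqre; first exact: sqrtr_ge0.
  rewrite (L2norm_rk hH) lee_fin sqr_sqrtr //.
  have [Asp Amin] := hA (fun i => X i w) f.
  apply: le_trans (least_squares_error hH hidstar hb k_gt0 TE nuE n_gt0 trace_le Asp Amin) _.
  rewrite -[leRHS]mulr1 ler_wpM2l // -(expr1n _ 2) ler_pXn2r ?nnegrE ?nrm_ge0 //.
  by rewrite -norm_le1.
have -> : (B%:E = (Num.sqrt B)%:E * (Num.sqrt B)%:E)%E by rewrite -EFinM -expr2 sqr_sqrtr.
exact: lee_pmul.
Qed.
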